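(* In algorithm NEON-$\mathcal A$ for $\min_{x\in\mathbb{R}^d}F(x)=\mathrm E_\xi[f(x;\xi)]$, let $\mathcal A(x_j)$ be implemented by the mini-batch SGD step $$z_j=x_j-L_1^{-1}\nabla F_{\mathbf S_1}(x_j),\qquad y_j=x_j,$$ where $\mathbf S_1$ is a set of samples independent of $x_j$ with $|\mathbf S_1|=\widetilde O(1/\epsilon^2)$. Then $T_a=\widetilde O(1/\epsilon^2)$ and $\varepsilon(\epsilon,\alpha)=\frac{\epsilon^2}{4L_1}$. With high probability, the resulting algorithm NEON-MSGD finds an $(\epsilon,\gamma)$-second-order stationary point with a total IFO complexity of $$\widetilde O\left(\max\left(\frac1{\epsilon^2},\frac1{\gamma^3}\right)\left(T_n+\frac1{\epsilon^2}\right)\right).$$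
   Context: Standing assumptions: each $f(\cdot;\xi)$ is twice differentiable with $L_1$-Lipschitz gradient and $L_2$-Lipschitz Hessian (spectral norm); $F(x_1)-\min F\le\Delta<\infty$ for the initial point; $\mathrm E[\exp(\|\nabla f(x;\xi)-\nabla F(x)\|^2/G^2)]\le\exp(1)$ for some $G>0$; $\mathrm E\|\nabla f(x;\xi)-\nabla F(x)\|^2\le V$ for some $V>0$. IFO complexity is the number of evaluations of stochastic gradients $\nabla f(x;\xi)$. $\widetilde O$ hides logarithmic factors and problem constants (in ''$|\mathbf S_1|=\widetilde O(1/\epsilon^2)$'' it denotes a sample size of that order with suitable constants). An $(\epsilon,\gamma)$-second-order stationary point is $x$ with $\|\nabla F(x)\|\le\epsilon$ and $\lambda_{\min}(\nabla^2F(x))\ge-\gamma$ (the paper's general guarantee yields these up to constant factors, $O(\epsilon)$ and $2\gamma$). For a sample set $\mathcal S$, $F_{\mathcal S}(x)=\frac1{|\mathcal S|}\sum_{\xi\in\mathcal S}f(x;\xi)$. Algorithm NEON-$\mathcal A$ with input $x_1$: for $j=1,2,\dots$: compute $(y_j,z_j)=\mathcal A(x_j)$; if the first-order condition at $y_j$ is not met, set $x_{j+1}=z_j$; else compute $u_j$ by the NEON procedure applied to $F_{\mathcal S_2}$ at $y_j$ (independent mini-batch $\mathcal S_2$); if $u_j=0$ return $y_j$, else set $x_{j+1}=y_j-\frac{c\gamma\bar\xi}{L_2}\frac{u_j}{\|u_j\|}$ with a Rademacher variable $\bar\xi\in\{1,-1\}$. The first-order condition is $\|\nabla F_{\mathbf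 S}(y_j)\|\le\epsilon$ for a mini-batch $\mathbf S$ independent of $y_j$ with $\|\nabla F(y_j)-\nabla F_{\mathbf S}(y_j)\|\le\epsilon/2$ (cost $T_c=\widetilde O(1/\epsilon^2)$). The NEON procedure is a randomized first-order procedure (NEON: from uniformly random $u_0$ in a small ball, gradient descent $u_{\tau+1}=u_\tau-\eta'(\nabla F_{\mathcal S_2}(y_j+u_\tau)-\nabla F_{\mathcal S_2}(y_j))$, or its Nesterov-accelerated version NEON$^+$) with parameters and $|\mathcal S_2|$ chosen so that: if $\lambda_{\min}(\nabla^2F(y_j))\le-\gamma$, with high probability it returns $u_j\neq0$ with $u_j^\top\nabla^2F(y_j)u_j/\|u_j\|^2\le-c\gamma$ ($c$ the inverse of a logarithmic factor); if it returns $0$, with high probability $\lambda_{\min}(\nabla^2F(y_j))\ge-2\gamma$. $T_n$ is the total IFO complexity of the NEON call and ensuing update, which satisfies that if $\lambda_{\min}(\nabla^2F(y_j))\le-\gamma$ then $\mathrm E[F(x_{j+1})-F(y_j)]\le-C\gamma^3$ for some $C>0$; $T_n=\widetilde O(1/\gamma^3)$ with NEON and $\widetilde O(1/\gamma^{2.5})$ with NEON$^+$. $T_a$ is the total IFO complexity of $\mathcal A(x)$. $\varepsilon(\epsilon,\alpha)$ (a function of $\epsilon$ and a parameter $\alpha>0$) denotes the decrease guaranteed by $\mathcal A$: $\|\nabla F(y_j)\|\ge\epsilon$ implies $\mathrm E[F(z_j)-F(x_j)]\le-\varepsilon(\epsilon,\alpha)$.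
   Formalization: Return of the point is shown only if nonzero NEON outputs are w.h.p. negative-curvature directions (else an SSP is returned or visited), as the stated NEON guarantees do not force termination; for γ<ε² the constant is K/δ at confidence 1−δ, since log(1/δ) dependence fails there. *)

(* Defs.v *)
From HB Require Import structures.
From mathcomp Require Import all_boot all_order all_algebra.
From mathcomp Require Import all_classical all_reals all_analysis.
Set Implicit Arguments.
Unset Strict Implicit.
Unset Printing Implicit Defensive.
Import Order.TTheory GRing.Theory Num.Theory.
Import numFieldNormedType.Exports.
Local Open Scope classical_set_scope.
Local Open Scope ring_scope.

Section Calculus.
Context {R : realType} {d : nat}.
Implicit Types (g : 'rV[R]_d -> R) (x u : 'rV[R]_d) (A : 'M[R]_d).

(* The norm `|x| of the library is the sup norm; it induces the same topology,
   hence the same notion of differentiability. *)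
Definition enorm x : R := Num.sqrt (\sum_(i < d) x 0 i ^+ 2).

Definition specnorm A : R :=
  sup [set enorm (u *m A) | u in [set u | enorm u <= 1]].

Definition grad g x : 'rV[R]_d := \row_(i < d) 'D_(delta_mx 0 i) g x.

Definition hess g x : 'M[R]_d := 'J (grad g) x.

Definition twice_differentiable g : Prop :=
  forall x, differentiable g x /\ differentiable (grad g) x.

(* When A is symmetric and d > 0 the set of eigenvalues is finite and nonempty,
   so the infimum is a minimum. *)
Definition lambda_min A : R := inf [set a | eigenvalue A a].

Definition rayleigh A u : R := (u *m A *m u^T) 0 0 / enorm u ^+ 2.

Definition second_order_stationary g (eps gam : R) x : Prop :=
  enorm (grad g x) <= eps /\ - gam <= lambda_min (hess g x).

End Calculus.

Notation borel_rV R d := (g_sigma_algebraType (@open 'rV[R]_d)).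

Section PowerProbability.
Context {dT : measure_display} {T : measurableType dT} {R : realType}.

Definition tuple_cons n (xt : T * n.-tuple T) : n.+1.-tuple T :=
  [tuple of xt.1 :: xt.2].

Lemma measurable_tuple_cons n : measurable_fun setT (@tuple_cons n).
Proof. exact: (measurable_cons measurable_fst measurable_snd). Qed.

HB.instance Definition _ n :=
  isMeasurableFun.Build _ _ _ _ (@tuple_cons n) (@measurable_tuple_cons n).

(* The law of n independent samples from P. *)
Fixpoint sample_law (P : probability T R) n : probability (n.-tuple T) R :=
  match n with
  | 0 => dirac [tuple]
  | m.+1 => distribution (P \x sample_law P m)%E (@tuple_cons m)
  end.

End PowerProbability.

(* Computations with access to an incremental first-order oracle: a call
   [Ask x i k] queries f(x; xi_i) and its gradient for the i-th of n samples and
   passes them to k.  The dependence of the result on f and on the samples is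
   through these calls only, and the second component of [run] counts them. *)
Section FirstOrderPrograms.
Context {R : realType} {d n : nat}.

Inductive prog (A : Type) : Type :=
  | Ret of A
  | Ask of 'rV[R]_d & 'I_n & (R * 'rV[R]_d -> prog A).

Fixpoint bind (A B : Type) (p : prog A) (h : A -> prog B) : prog B :=
  match p with
  | Ret a => h a
  | Ask x i k => Ask x i (fun r => bind (k r) h)
  end.

Fixpoint run (A : Type) (oracle : 'rV[R]_d -> 'I_n -> R * 'rV[R]_d)
    (p : prog A) : A * nat :=
  match p with
  | Ret a => (a, 0%N)
  | Ask x i k => let r := run oracle (k (oracle x i)) in (r.1, r.2.+1)
  end.

Definition batch_grad (x : 'rV[R]_d) : prog 'rV[R]_d :=
  foldr (fun (i : 'I_n) (k : 'rV[R]_d -> prog 'rV[R]_d) (acc : 'rV[R]_d) =>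
           Ask x i (fun r => k (acc + r.2)))
        (fun acc : 'rV[R]_d => Ret (n%:R^-1 *: acc)) (enum 'I_n) 0.

Definition msgd (L1 : R) (x : 'rV[R]_d) : prog ('rV[R]_d * 'rV[R]_d) :=
  bind (batch_grad x) (fun g => Ret (x, x - L1^-1 *: g)).

End FirstOrderPrograms.
Arguments prog : clear implicits.

Section Problem.
Context {R : realType} {d : nat} {dX : measure_display}
  {X : measurableType dX}.
Variables (P : probability X R) (f : 'rV[R]_d -> X -> R).

Definition objective (x : 'rV[R]_d) : R := fine ('E_P[f x])%E.

Definition sgrad (x : 'rV[R]_d) (xi : X) : 'rV[R]_d := grad (f ^~ xi) x.

(* problem_gap is F(x1) - min F <= Delta, the minimum need not be attained. *)
Record problem (L1 L2 Delta G V : R) (x1 : 'rV[R]_d) : Prop := {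
  problem_integrable : forall x, P.-integrable setT (EFin \o f x);
  problem_smooth : forall xi, twice_differentiable (f ^~ xi);
  problem_grad_lip : forall xi x y,
    enorm (sgrad x xi - sgrad y xi) <= L1 * enorm (x - y);
  problem_hess_lip : forall xi x y,
    specnorm (hess (f ^~ xi) x - hess (f ^~ xi) y) <= L2 * enorm (x - y);
  problem_gap : forall x, objective x1 - objective x <= Delta;
  problem_subgaussian : forall x,
    ('E_P[fun xi => expR (enorm (sgrad x xi - grad objective x) ^+ 2 / G ^+ 2)]
      <= (expR 1)%:E)%E;
  problem_variance : forall x,
    ('E_P[fun xi => (enorm (sgrad x xi - grad objective x) ^+ 2)%R]
      <= V%:E)%E }.

Definition oracle n (S : n.-tuple X) (x : 'rV[R]_d) (i : 'I_n) :
    R * 'rV[R]_d := (f x (tnth S i), sgrad x (tnth S i)).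

Definition output n A (p : prog R d n A) (S : n.-tuple X) : A :=
  (run (oracle S) p).1.

Definition ifo n A (p : prog R d n A) (S : n.-tuple X) : nat :=
  (run (oracle S) p).2.

Lemma run_batch_grad n (x : 'rV[R]_d) (S : n.-tuple X) :
  run (oracle S) (batch_grad x) =
  (n%:R^-1 *: \sum_(i < n) sgrad x (tnth S i), n).
Proof.
have eqv e (v : 'rV[R]_d) :
    run (oracle S) (foldr (fun i (k : 'rV[R]_d -> prog R d n 'rV[R]_d) acc =>
      Ask x i (fun r => k (acc + r.2))) (fun acc => Ret (n%:R^-1 *: acc)) e v) =
    (n%:R^-1 *: (v + \sum_(i <- e) sgrad x (tnth S i)), size e).
  elim: e v => [|i e IHe] v /=; first by rewrite big_nil addr0.
  by rewrite IHe big_cons addrA.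
by rewrite /batch_grad eqv add0r big_enum size_enum_ord.
Qed.

(* The first-order algorithm alg, mapping x to (y, z), guarantees the expected
   decrease dec: if |grad F(y)| >= eps then E[F(z) - F(x)] <= - dec, where the
   samples of alg are independent of x. *)
Definition decrease_guarantee n
    (alg : 'rV[R]_d -> prog R d n ('rV[R]_d * 'rV[R]_d)) (eps dec : R) : Prop :=
  forall x,
    (forall S, eps <= enorm (grad objective (output (alg x) S).1)) ->
    let change S := objective (output (alg x) S).2 - objective x in
    (sample_law P n).-integrable setT (EFin \o change) /\
    ('E_(sample_law P n)[change] <= (- dec)%:E)%E.

Section Neon.
Context {dT : measure_display} {T : measurableType dT}.

(* A randomized first-order procedure applied at y to the empirical objective
   of n samples from P; its internal randomness has law mu.  It returns 0 or a
   direction of negative curvature, each guarantee failing with probability at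
   most pfail, and makes at most Tn oracle calls. *)
Record neon_spec n (mu : probability T R)
    (neon : 'rV[R]_d -> T -> prog R d n 'rV[R]_d)
    (Tn : nat) (gam c pfail : R) : Prop := {
  neon_measurable : measurable_fun setT
    (fun w : borel_rV R d * (n.-tuple X * T) =>
       output (neon w.1 w.2.2) w.2.1 : borel_rV R d);
  neon_ifo : forall y t S, (ifo (neon y t) S <= Tn)%N;
  neon_negative_curvature : forall y,
    lambda_min (hess objective y) <= - gam ->
    ((1 - pfail)%:E <= (sample_law P n \x mu)
      [set q | (let u := output (neon y q.2) q.1 in
                u != 0 /\ rayleigh (hess objective y) u <= - (c * gam))%R])%E;
  neon_zero : forall y,
    lambda_min (hess objective y) < - (2 * gam) ->
    ((sample_law P n \x mu) [set q | (output (neon y q.2) q.1 = 0)%R]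
      <= pfail%:E)%E }.

(* A nonzero output is wrong with probability at most pfail, also at points
   where the Hessian has no eigenvalue below - gam. *)
Definition neon_certifies n (mu : probability T R)
    (neon : 'rV[R]_d -> T -> prog R d n 'rV[R]_d) (gam c pfail : R) : Prop :=
  forall y,
    ((sample_law P n \x mu)
      [set q | (let u := output (neon y q.2) q.1 in
                u != 0 /\ - (c * gam) < rayleigh (hess objective y) u)%R]
      <= pfail%:E)%E.

End Neon.
End Problem.

(* The fresh randomness of one iteration: the samples of the first-order
   algorithm, of the first-order condition and of the NEON procedure, the
   internal randomness of the latter and the sign. *)
Notation seed n1 nc n2 X T :=
  (n1.-tuple X * nc.-tuple X * (n2.-tuple X * T) * bool)%type.

Section Seeds.
Context {R : realType} {dX dT : measure_display}
  {X : measurableType dX} {T : measurableType dT}.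

Definition seed_law {n1 nc n2 : nat} (P : probability X R)
    (mu : probability T R) : set (seed n1 nc n2 X T) -> \bar R :=
  ((sample_law P n1 \x sample_law P nc) \x (sample_law P n2 \x mu)
    \x bernoulli_prob 2^-1)%E.

Definition iid {dO dW : measure_display} {O : measurableType dO}
    {W : measurableType dW} (Pr : probability O R) (law : set W -> \bar R)
    (w : nat -> O -> W) : Prop :=
  (forall j, measurable_fun setT (w j)) /\
  forall N (B : nat -> set W), (forall j, measurable (B j)) ->
    (Pr (\bigcap_(j in `I_N) (w j @^-1` B j)) =
     \big[*%E/1]_(j < N) law (B j))%E.

Definition with_probability {dO : measure_display} {O : measurableType dO}
    (Pr : probability O R) (p : R) (A : set O) : Prop :=
  exists E, [/\ measurable E, E `<=` A & (p%:E <= Pr E)%E].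

End Seeds.

Inductive status (V : Type) : Type := Running of V | Returned of V.

Section NeonA.
Context {R : realType} {d : nat} {dX : measure_display}
  {X : measurableType dX} {T : Type} {n1 nc n2 : nat}.
Variables (f : 'rV[R]_d -> X -> R) (L2 eps gam c : R)
  (alg : 'rV[R]_d -> prog R d n1 ('rV[R]_d * 'rV[R]_d))
  (neon : 'rV[R]_d -> T -> prog R d n2 'rV[R]_d)
  (x1 : 'rV[R]_d).
Implicit Types (s : seed n1 nc n2 X T) (w : nat -> seed n1 nc n2 X T).

(* One iteration from x, with the number of oracle calls it makes; the boolean
   s.2 encodes the Rademacher variable (-1) ^ s.2. *)
Definition neonA_step (x : 'rV[R]_d) s : status 'rV[R]_d * nat :=
  let: (S1, Sc, (S2, t), b) := s in
  let: (y, z) := output f (alg x) S1 in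
  let cost := (ifo f (alg x) S1 + ifo f (batch_grad y) Sc)%N in
  if enorm (output f (batch_grad y) Sc) <= eps then
    let u := output f (neon y t) S2 in
    (if u == 0 then Returned y
     else Running (y - (c * gam * (-1) ^+ b / L2) *: ((enorm u)^-1 *: u)),
     (cost + ifo f (neon y t) S2)%N)
  else (Running z, cost).

(* Status after j iterations and number of oracle calls made so far. *)
Fixpoint neonA w (j : nat) : status 'rV[R]_d * nat :=
  match j with
  | 0 => (Running x1, 0%N)
  | i.+1 =>
    let: (st, cost) := neonA w i in
    match st with
    | Running x => let: (st', k) := neonA_step x (w i) in (st', (cost + k)%N)
    | Returned y => (st, cost)
    end
  end.

(* y is the point y_j computed in iteration j, counted from 0. *)
Definition neonA_point w (j : nat) (y : 'rV[R]_d) : Prop :=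
  exists2 x, (neonA w j).1 = Running x & y = (output f (alg x) (w j).1.1.1).1.

Definition neonA_returns w (N : nat) (Q : 'rV[R]_d -> Prop) : Prop :=
  exists2 y, (neonA w N).1 = Returned y & Q y.

(* Within N iterations: the point returned satisfies Q or, if there is none yet,
   some y_j already satisfies Q. *)
Definition neonA_finds w (N : nat) (Q : 'rV[R]_d -> Prop) : Prop :=
  match (neonA w N).1 with
  | Returned y => Q y
  | Running _ => exists j y, [/\ (j < N)%N, neonA_point w j y & Q y]
  end.

End NeonA.
Arguments neonA {R d dX X T n1 nc n2} f L2 eps gam c alg neon x1 w j.

(* The quantity whose powers are hidden by the notation O~. *)
Definition log_factor {R : realType} (eps gam delta : R) : R :=
  1 + ln (eps * gam * delta)^-1.

(* The constant of the complexity bound does not depend on the confidence 1 - delta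
   when eps^2 <= gam.  Below that threshold the random signs along a direction of
   slope of order eps dominate the drift of order gam^3: the number of iterations
   then has a polynomial tail, and no constant is uniform in delta. *)
Definition bound_constant {R : realType} (K eps gam delta : R) : R :=
  if eps ^+ 2 <= gam then K else K / delta.

(* n = O~(1/eps^2) with at least a l / eps^2 samples. *)
Definition batch_size {R : realType} (a b : R) (q : nat) (l eps : R) (n : nat) :
    Prop :=
  a * l / eps ^+ 2 <= n%:R <= b * l ^+ q / eps ^+ 2.

(* Main.v *)
(** Let [D] be a lower bound on the mean decrease per iteration of order
  [min(eps^2, gam^3)] up to logarithms.  As long as no mini-batch gradient is
  off by more than [eps / 4] and no NEON call errs, an SGD step decreases [F] by
  at least [eps^2 / (4 L1)], and a step of length [c gam / L2] along a direction
  of curvature at most [- c gam] decreases it by [c^3 gam^3 / (6 L2^2)] up to a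
  term that is linear in the random sign, of size at most [m], a multiple of
  [c gam eps].  Hence [psi (F x_j - F_inf + j D)], with [F_inf] a lower bound of
  [F], is a supermartingale until the algorithm stops or fails, for [psi] the
  identity and, when [eps^2 <= gam], for [psi y = exp (lam y)] with [lam] of
  order [c], since then [lam m^2] is dominated by the drift.  Running on for [N]
  iterations has therefore probability at most [psi Delta / psi (N D)], which
  bounds [N] by a logarithm of [1 / delta] for the exponential and by
  [1 / delta] for the identity.  The probability of a failure is controlled by a
  subgaussian tail bound for the mini-batches and a union bound over the [N]
  iterations.

  No spectral theory is needed: the points from which NEON must move are taken
  to be those where it returns a certified direction with high probability. *)
Require Import Defs.
From HB Require Import structures.
From mathcomp Require Import all_boot all_order all_algebra.
From mathcomp Require Import all_classical all_reals all_analysis.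
From mathcomp Require Import measurable_realfun ring lra.
Set Implicit Arguments.
Unset Strict Implicit.
Unset Printing Implicit Defensive.
Import Order.TTheory GRing.Theory Num.Theory.
Import numFieldNormedType.Exports.
Local Open Scope classical_set_scope.
Local Open Scope ring_scope.

(** * Euclidean norm and matrices *)

Section EuclideanNorm.
Context {R : realType} {d : nat}.
Implicit Types (u v x y : 'rV[R]_d) (A B : 'M[R]_d).

(** The decrease in expectation of an SGD step does not enter the analysis of a run. Accurate
    mini-batches make the descent pathwise, so the sign of a NEON step is the only randomness left
    in the drift. Failing runs are killed rather than conditioned away, which preserves the
    independence of the iterations.

    At a point that is already stationary NEON may return an uncertified direction, along which [F]
    may increase. Hence two analyses, selected by the boolean [certify]: without [neon_certifies]
    the chain is stopped at such a point, and some y_j is stationary; with it the chain stops only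
    when the algorithm returns.

    Regularity is given for each sample, not for [F]. Taylor bounds with a remainder uniform in the
    sample survive integration and identify the gradient and the Hessian of [F]; joint measurability
    in the point and the sample comes from Lipschitz continuity and rational points.

    Batches must be large enough for a union bound over the iterations, but the number of iterations
    does not involve the batch sizes, so there is no circle between the constants. *)

Definition dotp u v : R := \sum_(i < d) u 0 i * v 0 i.

Lemma coordB u v i : (u - v) 0 i = u 0 i - v 0 i.
Proof. by rewrite !mxE. Qed.

Lemma coordD u v i : (u + v) 0 i = u 0 i + v 0 i.
Proof. by rewrite mxE. Qed.

Lemma mxcoordB A B i j : (A - B) i j = A i j - B i j.
Proof. by rewrite !mxE. Qed.

Lemma dotpC u v : dotp u v = dotp v u.
Proof. by apply: eq_bigr => i _; rewrite mulrC. Qed.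

Lemma dotpDl u v x : dotp (u + v) x = dotp u x + dotp v x.
Proof. by rewrite -big_split; apply: eq_bigr => i _; rewrite mxE mulrDl. Qed.

Lemma dotpZl a u v : dotp (a *: u) v = a * dotp u v.
Proof. by rewrite mulr_sumr; apply: eq_bigr => i _; rewrite mxE mulrA. Qed.

Lemma dotpNl u v : dotp (- u) v = - dotp u v.
Proof. by rewrite -scaleN1r dotpZl mulN1r. Qed.

Lemma dotpDr u v x : dotp x (u + v) = dotp x u + dotp x v.
Proof. by rewrite dotpC dotpDl !(dotpC x). Qed.

Lemma dotpZr a u v : dotp v (a *: u) = a * dotp v u.
Proof. by rewrite dotpC dotpZl (dotpC v). Qed.

Lemma dotpNr u v : dotp v (- u) = - dotp v u.
Proof. by rewrite dotpC dotpNl (dotpC v). Qed.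

Lemma dotpp_ge0 u : 0 <= dotp u u.
Proof. by apply: sumr_ge0 => i _; rewrite -expr2 sqr_ge0. Qed.

Lemma enorm_ge0 u : 0 <= enorm u.
Proof. exact: sqrtr_ge0. Qed.

Lemma enorm_sqr u : enorm u ^+ 2 = dotp u u.
Proof.
rewrite sqr_sqrtr; first by apply: eq_bigr => i _; rewrite expr2.
by apply: sumr_ge0 => i _; rewrite sqr_ge0.
Qed.

Lemma coord_le_enorm u i : `|u 0 i| <= enorm u.
Proof.
rewrite -(@ler_pXn2r _ 2) ?nnegrE ?enorm_ge0// real_normK ?num_real//.
rewrite enorm_sqr /dotp (bigD1 i)//= -expr2 lerDl.
by apply: sumr_ge0 => j _; rewrite -expr2 sqr_ge0.
Qed.

Lemma enorm_eq0 u : (enorm u == 0) = (u == 0).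
Proof.
apply/eqP/eqP => [u0|->]; last first.
  by rewrite /enorm big1 ?sqrtr0// => i _; rewrite mxE expr0n.
by apply/rowP => i; rewrite mxE; apply/eqP; rewrite -normr_le0 -u0 coord_le_enorm.
Qed.

Lemma enorm0 : enorm (0 : 'rV[R]_d) = 0.
Proof. by apply/eqP; rewrite enorm_eq0. Qed.

(** Cauchy-Schwarz, from the nonnegative square of [dotp u u *: v - dotp u v *: u]. *)
Lemma dotp_sqr_le u v : dotp u v ^+ 2 <= dotp u u * dotp v v.
Proof.
have [/eqP|u0] := eqVneq (dotp u u) 0.
  rewrite -enorm_sqr sqrf_eq0 enorm_eq0 => /eqP ->.
  by rewrite -(scale0r (0 : 'rV[R]_d)) dotpZl mul0r expr0n/= mulr_ge0 ?sqr_ge0 ?dotpp_ge0.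
have uu : 0 < dotp u u by rewrite lt_def u0 dotpp_ge0.
have := dotpp_ge0 (dotp u u *: v - dotp u v *: u).
rewrite !(dotpDl, dotpDr, dotpNl, dotpNr, dotpZl, dotpZr) (dotpC v u).
set a := dotp u u in uu *; set b := dotp u v; set c := dotp v v => h.
rewrite -(ler_pM2l uu) -subr_ge0; apply: le_trans h _.
by rewrite le_eqVlt; apply/orP; left; apply/eqP; ring.
Qed.

Lemma norm_dotp_le u v : `|dotp u v| <= enorm u * enorm v.
Proof.
rewrite -(@ler_pXn2r _ 2) ?nnegrE ?mulr_ge0 ?enorm_ge0// real_normK ?num_real//.
by rewrite exprMn !enorm_sqr dotp_sqr_le.
Qed.

Lemma dotp_le u v : dotp u v <= enorm u * enorm v.
Proof. exact: le_trans (ler_norm _) (norm_dotp_le _ _). Qed.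

Lemma enormZ a u : enorm (a *: u) = `|a| * enorm u.
Proof.
apply/eqP; rewrite -(@eqrXn2 _ 2) ?mulr_ge0 ?enorm_ge0//.
by rewrite exprMn real_normK ?num_real// !enorm_sqr dotpZl dotpZr mulrA expr2.
Qed.

Lemma enormN u : enorm (- u) = enorm u.
Proof. by rewrite -scaleN1r enormZ normrN1 mul1r. Qed.

Lemma enormD u v : enorm (u + v) <= enorm u + enorm v.
Proof.
rewrite -(@ler_pXn2r _ 2) ?nnegrE ?addr_ge0 ?enorm_ge0//.
rewrite sqrrD !enorm_sqr dotpDl !dotpDr (dotpC v u).
have := dotp_le u v; lra.
Qed.

Lemma enormB_ge u v : enorm u - enorm v <= enorm (u - v).
Proof. by rewrite lerBlDr -{1}(subrK v u) enormD. Qed.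

Lemma enorm_le_coord u b : 0 <= b -> (forall i, `|u 0 i| <= b) ->
  enorm u <= d%:R * b.
Proof.
move=> b0 ub; case: (posnP d) => [d0|d0].
  by rewrite /enorm big1 ?sqrtr0 ?mulr_ge0// => i; have := ltn_ord i; rewrite {2}d0.
rewrite -(@ler_pXn2r _ 2) ?nnegrE ?mulr_ge0 ?enorm_ge0// enorm_sqr.
apply: (@le_trans _ _ (\sum_(i < d) b ^+ 2)).
  apply: ler_sum => i _; rewrite -expr2 -real_normK ?num_real//.
  by rewrite ler_pXn2r ?nnegrE.
rewrite sumr_const card_ord -[leLHS]mulr_natl exprMn ler_wpM2r ?sqr_ge0//.
by rewrite expr2 ler_peMl ?ler0n// ler1n.
Qed.

Lemma coord_le_norm u i : `|u 0 i| <= `|u|.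
Proof. by rewrite [leRHS]/Num.norm/= mx_normrE; apply/bigmax_geP; right; exists (0, i). Qed.

(** Links the Euclidean norm of the hypotheses to the sup norm in which differentials and balls are
    expressed. *)
Lemma enorm_le_norm u : enorm u <= d%:R * `|u|.
Proof. by apply: enorm_le_coord => // i; exact: coord_le_norm. Qed.

Lemma norm_le_enorm u : `|u| <= enorm u.
Proof.
have [->|] := eqVneq `|u| 0; first exact: enorm_ge0.
move=> /mx_norm_neq0[[j i] /=]; rewrite /Num.norm/= (ord1 j) => ->.
exact: coord_le_enorm.
Qed.

Lemma mulmxE_dotp u v : (u *m v^T) 0 0 = dotp u v.
Proof. by rewrite !mxE; apply: eq_bigr => i _; rewrite mxE. Qed.

(** Makes the [sup] in [specnorm] meaningful: it takes the default value 0 on a set without an upper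
    bound. *)
Lemma specnorm_has_ubound A :
  has_ubound [set enorm (u *m A) | u in [set u | enorm u <= 1]].
Proof.
exists (d%:R * \sum_(i < d) \sum_(j < d) `|A j i|) => _ [u /= u1 <-].
apply: enorm_le_coord => [|i]; first by do 2!apply: sumr_ge0 => ? _.
rewrite mxE (le_trans (ler_norm_sum _ _ _))// [leRHS](bigD1 i)//= -[leLHS]addr0 lerD//.
  apply: ler_sum => j _; rewrite normrM ler_piMl//.
  exact: le_trans (coord_le_enorm u j) u1.
by do 2!apply: sumr_ge0 => ? _.
Qed.

Lemma specnorm_ge0 A : 0 <= specnorm A.
Proof.
apply: ub_le_sup; first exact: specnorm_has_ubound.
by exists 0; rewrite /= ?enorm0// mul0mx enorm0.
Qed.

Lemma enorm_mulmx_le u A : enorm (u *m A) <= specnorm A * enorm u.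
Proof.
have [->|u0] := eqVneq u 0; first by rewrite mul0mx enorm0 mulr0.
have u1 : 0 < enorm u by rewrite lt_def enorm_eq0 u0 enorm_ge0.
have : enorm (((enorm u)^-1 *: u) *m A) <= specnorm A.
  apply: ub_le_sup; first exact: specnorm_has_ubound.
  exists ((enorm u)^-1 *: u) => //=.
  by rewrite enormZ normfV ger0_norm ?enorm_ge0// mulVf// gt_eqF.
by rewrite -scalemxAl enormZ normfV ger0_norm ?enorm_ge0// ler_pdivrMl// mulrC.
Qed.

Lemma coord_le_specnorm A i j : `|A i j| <= specnorm A.
Proof.
have /(le_trans (coord_le_enorm _ j)) := enorm_mulmx_le (delta_mx 0 i) A.
rewrite -rowE mxE => /le_trans; apply.
suff -> : enorm (delta_mx 0 i : 'rV[R]_d) = 1 by rewrite mulr1.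
rewrite /enorm -[RHS]sqrtr1; congr Num.sqrt.
rewrite (bigD1 i)//= big1 ?mxE ?eqxx ?expr1n ?addr0// => k /negPf ki.
by rewrite !mxE ki andbF expr0n.
Qed.

End EuclideanNorm.

(** * Taylor bounds *)

Section RealTaylor.
Context {R : realType}.
Implicit Types phi dphi ddphi : R -> R.

Lemma mean_value phi dphi b : (forall t : R, is_derive t 1 phi (dphi t)) -> 0 < b ->
  exists2 t, 0 < t < b & phi b - phi 0 = dphi t * b.
Proof.
move=> dphiP b0.
have phi_cont : {within `[0, b], continuous phi}.
  apply: continuous_subspaceT => s; apply: differentiable_continuous.
  by apply/derivable1_diffP; have [] := dphiP s.
have [t tb ->] := MVT b0 (fun t _ => dphiP t) phi_cont.
by exists t; rewrite ?subr0//; move: tb; rewrite in_itv.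
Qed.

(** Subtracting the quadratic with slope [dphi 0] at 0 and second derivative [C] leaves a function
    whose derivative is nonpositive on the open unit interval. *)
Lemma taylor1_le phi dphi C : (forall t : R, is_derive t 1 phi (dphi t)) ->
  (forall t, 0 < t < 1 -> dphi t - dphi 0 <= C * t) ->
  phi 1 - phi 0 - dphi 0 <= C / 2.
Proof.
move=> dphiP dphiC.
have [|t t01] := @mean_value (fun t => phi t - (t * dphi 0 + t ^+ 2 * (C / 2)))
  (fun t => dphi t - (dphi 0 + t * C)) 1 _ ltr01.
  move=> t; apply: is_deriveB; apply: is_derive_eq.
  by rewrite /GRing.scale/=; field.
by have := dphiC _ t01; lra.
Qed.

Lemma taylor1_norm phi dphi C : (forall t : R, is_derive t 1 phi (dphi t)) ->
  (forall t, 0 < t < 1 -> `|dphi t - dphi 0| <= C * t) ->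
  `|phi 1 - phi 0 - dphi 0| <= C / 2.
Proof.
move=> dphiP dphiC; rewrite ler_norml; apply/andP; split.
  suff : - phi 1 - - phi 0 - - dphi 0 <= C / 2 by lra.
  apply: (@taylor1_le (fun t => - phi t) (fun t => - dphi t)) => t t01.
  by have := dphiC _ t01; rewrite ler_norml; lra.
by apply: (taylor1_le dphiP) => t t01; exact: le_trans (ler_norm _) (dphiC _ t01).
Qed.

(** The mean value theorem is applied twice, to [phi] minus a cubic and then to [dphi]. This gives
    [M / 3] in place of the sharp [M / 6], still below the 1/2 in front of the curvature term. *)
Lemma taylor2_le phi dphi ddphi M : (forall t : R, is_derive t 1 phi (dphi t)) ->
  (forall t : R, is_derive t 1 dphi (ddphi t)) -> 0 <= M ->
  (forall t, 0 < t < 1 -> ddphi t - ddphi 0 <= M * t) ->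
  phi 1 - phi 0 - dphi 0 - ddphi 0 / 2 <= M / 3.
Proof.
move=> dphiP ddphiP M0 ddphiM.
have [|t t01] := @mean_value
  (fun t => phi t - (t * dphi 0 + t ^+ 2 * (ddphi 0 / 2) + t ^+ 3 * (M / 3)))
  (fun t => dphi t - (dphi 0 + t * ddphi 0 + t ^+ 2 * M)) 1 _ ltr01.
  move=> t; apply: is_deriveB; apply: is_derive_eq.
  by rewrite /GRing.scale/=; field.
have [t0 t1] := andP t01; have [s /andP[s0 st] dphist] := mean_value ddphiP t0.
have s01 : 0 < s < 1 by rewrite s0 (lt_trans st).
have : t * (ddphi s - ddphi 0) <= t * (M * t).
  by rewrite ler_pM2l// (le_trans (ddphiM _ s01))// ler_wpM2l// ltW.
by move: dphist; set a := dphi t; lra.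
Qed.

End RealTaylor.

Section VectorTaylor.
Context {R : realType} {d : nat}.
Implicit Types (g : 'rV[R]_d -> R) (x v : 'rV[R]_d).

Lemma is_derive_line (W : normedModType R) (h : 'rV[R]_d -> W) x v t :
  differentiable h (x + t *: v) ->
  is_derive t 1 (fun s : R => h (x + s *: v)) ('d h (x + t *: v) v).
Proof.
move=> dh.
have E : (fun k : R => k^-1 *:
      (((fun s : R => h (x + s *: v)) \o shift t) (k *: 1) - h (x + t *: v))) =
    (fun k : R => k^-1 *: ((h \o shift (x + t *: v)) (k *: v) - h (x + t *: v))).
  apply/funext => k /=; congr (_ *: (h _ - _)).
  by rewrite [_ *: 1]mulr1 scalerDl addrCA.
apply: DeriveDef; first by rewrite /derivable E; exact: diff_derivable.
by rewrite /derive E -deriveE.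
Qed.

Lemma diff_grad g x v : differentiable g x -> 'd g x v = dotp v (grad g x).
Proof.
move=> dg; rewrite {1}(row_sum_delta v) linear_sum; apply: eq_bigr => i _.
by rewrite linearZ mxE deriveE.
Qed.

Lemma is_derive_grad_line g x v t j : differentiable (grad g) (x + t *: v) ->
  is_derive t 1 (fun s : R => grad g (x + s *: v) 0 j)
    ((v *m hess g (x + t *: v)) 0 j).
Proof.
move=> dg.
have dc : differentiable (fun y => grad g y 0 j) (x + t *: v).
  exact: (@differentiable_comp _ _ _ _ (grad g) (fun M : 'rV[R]_d => M 0 j) _
    dg (differentiable_coord _ 0 j)).
suff <- : 'd (fun y => grad g y 0 j) (x + t *: v) v =
    (v *m hess g (x + t *: v)) 0 j.
  exact: (@is_derive_line _ (fun y => grad g y 0 j)).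
rewrite mul_rV_lin1.
have -> : (fun y => grad g y 0 j) = (fun M : 'rV[R]_d => M 0 j) \o grad g by [].
rewrite (diff_comp dg (differentiable_coord _ 0 j)) /=.
have cc : continuous (fun M : 'rV[R]_d => M 0 j) by exact: coord_continuous.
have cl : linear (fun M : 'rV[R]_d => M 0 j) by move=> ? ? ?; rewrite !mxE.
pose cL := HB.pack_for {linear 'rV[R]_d -> R} (fun M : 'rV[R]_d => M 0 j)
  (GRing.isLinear.Build _ _ _ _ _ cl).
by rewrite (@diff_lin _ _ _ cL).
Qed.

Lemma line_dist x v (t : R) : 0 < t -> enorm (x + t *: v - (x + 0 *: v)) = t * enorm v.
Proof. by move=> t0; rewrite scale0r addr0 addrAC subrr add0r enormZ gtr0_norm. Qed.

Section Smooth.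
Variables (g : 'rV[R]_d -> R) (L1 L2 : R).
Hypotheses (L1_ge0 : 0 <= L1) (L2_ge0 : 0 <= L2) (g2 : twice_differentiable g)
  (g_grad : forall x y, enorm (grad g x - grad g y) <= L1 * enorm (x - y))
  (g_hess : forall x y, specnorm (hess g x - hess g y) <= L2 * enorm (x - y)).

Lemma smooth_expansion x v :
  `|g (x + v) - g x - dotp v (grad g x)| <= L1 / 2 * enorm v ^+ 2.
Proof.
have := @taylor1_norm _ (fun t => g (x + t *: v))
  (fun t => dotp v (grad g (x + t *: v))) (L1 * enorm v ^+ 2).
rewrite scale1r scale0r addr0 mulrAC; apply => [t|t /andP[t0 t1]].
  rewrite -diff_grad; last exact: (g2 _).1.
  by apply: is_derive_line; exact: (g2 _).1.
rewrite -dotpNr -dotpDr (le_trans (norm_dotp_le _ _))//.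
have := g_grad (x + t *: v) (x + 0 *: v); rewrite line_dist// scale0r addr0.
by move/(ler_wpM2l (enorm_ge0 v)); lra.
Qed.

Lemma grad_expansion x v j :
  `|grad g (x + v) 0 j - grad g x 0 j - (v *m hess g x) 0 j| <=
    L2 / 2 * enorm v ^+ 2.
Proof.
have := @taylor1_norm _ (fun t => grad g (x + t *: v) 0 j)
  (fun t => (v *m hess g (x + t *: v)) 0 j) (L2 * enorm v ^+ 2).
rewrite scale1r scale0r addr0 mulrAC; apply => [t|t /andP[t0 t1]].
  by apply: is_derive_grad_line; exact: (g2 _).2.
have -> : (v *m hess g (x + t *: v)) 0 j - (v *m hess g x) 0 j =
    (v *m (hess g (x + t *: v) - hess g (x + 0 *: v))) 0 j.
  by rewrite mulmxBr coordB scale0r addr0.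
rewrite (le_trans (coord_le_enorm _ _))// (le_trans (enorm_mulmx_le _ _))//.
have := g_hess (x + t *: v) (x + 0 *: v); rewrite line_dist//.
by move/(ler_wpM2r (enorm_ge0 v)); lra.
Qed.

Lemma cubic_upper_bound x v :
  g (x + v) <= g x + dotp v (grad g x) + dotp (v *m hess g x) v / 2 +
    L2 / 3 * enorm v ^+ 3.
Proof.
have := @taylor2_le _ (fun t => g (x + t *: v))
  (fun t => dotp v (grad g (x + t *: v)))
  (fun t => dotp (v *m hess g (x + t *: v)) v) (L2 * enorm v ^+ 3).
rewrite scale1r scale0r addr0 mulrAC => h.
suff : g (x + v) - g x - dotp v (grad g x) - dotp (v *m hess g x) v / 2 <=
  L2 / 3 * enorm v ^+ 3 by lra.
apply: h => [t|t||t /andP[t0 t1]].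
- rewrite -diff_grad; last exact: (g2 _).1.
  by apply: is_derive_line; exact: (g2 _).1.
- rewrite /dotp.
  have -> : (fun t0 : R => \sum_(i < d) v 0 i * grad g (x + t0 *: v) 0 i) =
      \sum_(i < d) (fun t0 : R => v 0 i * grad g (x + t0 *: v) 0 i).
    by apply/funext => s; rewrite fct_sumE.
  apply: is_derive_sum => i; rewrite mulrC.
  apply: (@is_deriveZ _ _ _ (fun t0 : R => grad g (x + t0 *: v) 0 i)).
  by apply: is_derive_grad_line; exact: (g2 _).2.
- by rewrite mulr_ge0// exprn_ge0// enorm_ge0.
- rewrite -dotpNl -dotpDl -mulmxBr (le_trans (dotp_le _ _))//.
  have := enorm_mulmx_le v (hess g (x + t *: v) - hess g x).
  have := g_hess (x + t *: v) (x + 0 *: v).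
  rewrite line_dist// scale0r addr0 => /(ler_wpM2r (enorm_ge0 v)) h1 h2.
  have := ler_wpM2r (enorm_ge0 v) (le_trans h2 h1).
  by lra.
Qed.

End Smooth.
End VectorTaylor.

(** * Differentiation under the expectation *)

Section RealIntegral.
Context {R : realType} {dX : measure_display} {X : measurableType dX}
  (P : probability X R).
Implicit Types h : X -> R.
Local Notation intg h := (P.-integrable setT (EFin \o h)).
Local Notation "'E h" := (\int[P]_xi h xi) (at level 8, h at level 8).

Lemma intg_measurable h : intg h -> measurable_fun setT h.
Proof. by move=> /integrableP[/measurable_EFinP]. Qed.

Lemma intg_cst (k : R) : intg (fun=> k).
Proof. exact: finite_measure_integrable_cst. Qed.

Lemma intg_dom h1 h2 : measurable_fun setT h1 -> (forall x, `|h1 x| <= h2 x) ->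
  intg h2 -> intg h1.
Proof.
move=> mh1 h12; apply: le_integrable => // [|x _]; first exact/measurable_EFinP.
by rewrite /= lee_fin (le_trans (h12 x))// ler_norm.
Qed.

Lemma intg_bounded h (k : R) : measurable_fun setT h ->
  (forall x, `|h x| <= k) -> intg h.
Proof. by move=> mh hk; apply: (intg_dom mh hk); exact: intg_cst. Qed.

Lemma intgD h1 h2 : intg h1 -> intg h2 -> intg (fun x => h1 x + h2 x).
Proof. by move=> i1 i2; exact: (integrableD _ i1 i2). Qed.

Lemma intgZ k h : intg h -> intg (fun x => k * h x).
Proof. by move=> i; exact: (integrableZl _ k i). Qed.

Lemma intgB h1 h2 : intg h1 -> intg h2 -> intg (fun x => h1 x - h2 x).
Proof. by move=> i1 i2; exact: (integrableB _ i1 i2). Qed.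

Lemma Rint_cst (k : R) : 'E (fun=> k) = k.
Proof. by rewrite Rintegral_cst//= probability_setT mulr1. Qed.

Lemma Rint_norm_le h (k : R) : intg h -> (forall x, `|h x| <= k) -> `|'E h| <= k.
Proof.
move=> ih hk; apply: (le_trans (le_normr_Rintegral _ ih)) => //.
rewrite -[leRHS]Rint_cst; apply: le_Rintegral => //; last exact: intg_cst.
exact: integrable_norm.
Qed.

Lemma Rint_sum (I : Type) (s : seq I) (h : I -> X -> R) :
  (forall i, intg (h i)) -> intg (fun x => \sum_(i <- s) h i x) /\
  'E (fun x => \sum_(i <- s) h i x) = \sum_(i <- s) 'E (h i).
Proof.
move=> ih; elim: s => [|i s [IHi IHE]].
  under eq_fun do rewrite big_nil; rewrite big_nil Rint_cst; split => //.
  exact: intg_cst.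
under eq_fun do rewrite big_cons; split; first exact: intgD.
by rewrite big_cons RintegralD// IHE.
Qed.

Lemma Rint_dotp d (v : 'rV[R]_d) (h : X -> 'rV[R]_d) :
  (forall i, intg (fun x => h x 0 i)) -> intg (fun x => dotp v (h x)) /\
  'E (fun x => dotp v (h x)) = dotp v (\row_i 'E (fun x => h x 0 i)).
Proof.
move=> ih; have [|i1 ->] := @Rint_sum _ (index_enum 'I_d)
  (fun i x => v 0 i * h x 0 i); first by move=> i; exact: intgZ.
by split=> //; apply: eq_bigr => i _; rewrite mxE RintegralZl.
Qed.

(** Meant for derivatives in the point, which are uniform limits of the difference quotients of step
    1/(n+1). *)
Lemma measurable_fun_approx h (hn : nat -> X -> R) (k : R) :
  (forall n, measurable_fun setT (hn n)) ->
  (forall n x, `|hn n x - h x| <= k / n.+1%:R) -> measurable_fun setT h.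
Proof.
move=> mhn hnk; apply: (@measurable_fun_cvg _ _ _ setT hn) => // x _.
apply/cvgrPdist_le => /= e e0; near=> n.
rewrite distrC (le_trans (hnk n x))// ler_pdivrMr// mulrC -ler_pdivrMr//.
rewrite ltW// -natr1 ltr_wpDr//; near: n; exact: nbhs_infty_gtr.
Unshelve. all: by end_near. Qed.

End RealIntegral.

(** * Derivatives read off from quadratic remainders *)

Section DerivativeFromExpansion.
Context {R : realType} {d : nat}.

(** This is how derivatives of expectations are found: the remainder bound of each sample is
    integrated, so no limit is exchanged with an integral. *)
Lemma derive_expansion (g : 'rV[R]_d -> R) x v m C :
  (forall h : R, `|g (h *: v + x) - g x - h * m| <= C * h ^+ 2) -> 'D_v g x = m.
Proof.
move=> gC; rewrite /derive; apply/cvg_lim => //.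
have C0 : 0 <= C by have := gC 1; rewrite expr1n mulr1; exact: le_trans.
apply/cvgrPdist_le => /= e e0; near=> h.
have h0 : h != 0 by near: h; exact: nbhs_dnbhs_neq.
have -> : m - h^-1 * (g (h *: v + x) - g x) =
    - (h^-1 * (g (h *: v + x) - g x - h * m)).
  by field.
rewrite normrN normrM normfV ler_pdivrMl ?normr_gt0// (le_trans (gC h))//.
have : `|h| < e / (C + 1).
  by near: h; apply: dnbhs0_lt; rewrite divr_gt0// ltr_wpDl.
rewrite ltr_pdivlMr ?ltr_wpDl// -(real_normK (num_real h)).
by have := normr_ge0 h; nra.
Unshelve. all: by end_near. Qed.

Lemma grad_expansionE (g : 'rV[R]_d -> R) x m C :
  (forall v, `|g (x + v) - g x - dotp v m| <= C * enorm v ^+ 2) -> grad g x = m.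
Proof.
move=> gC; apply/rowP => i; rewrite mxE.
apply: (@derive_expansion _ _ _ _ (C * enorm (delta_mx 0 i : 'rV[R]_d) ^+ 2)) => h.
have := gC (h *: delta_mx 0 i); rewrite addrC dotpZl enormZ exprMn.
rewrite real_normK ?num_real// mulrCA [X in _ <= X -> _]mulrC.
suff -> : dotp (delta_mx 0 i) m = m 0 i by rewrite addrC [x + _]addrC.
rewrite /dotp (bigD1 i)//= big1 ?mxE ?eqxx ?mul1r ?addr0// => j /negPf ji.
by rewrite mxE ji andbF mul0r.
Qed.

(** [hess] is a Jacobian and so refers to the full differential, which is identified by its
    uniqueness; for [grad] directional derivatives were enough. *)
Lemma hess_expansionE (g : 'rV[R]_d -> R) x (A : 'M[R]_d) C :
  (forall v j, `|grad g (x + v) 0 j - grad g x 0 j - (v *m A) 0 j| <=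
    C * enorm v ^+ 2) -> hess g x = A.
Proof.
move=> gC; have Ac : continuous (mulmxr A : 'rV[R]_d -> 'rV[R]_d).
  apply/linear_bounded_continuous/linear_boundedP; near=> r => v.
  rewrite (le_trans (norm_le_enorm _))// (le_trans (enorm_mulmx_le _ _))//.
  rewrite (@le_trans _ _ (specnorm A * (d%:R * `|v|)))//.
    by rewrite ler_wpM2l ?specnorm_ge0// enorm_le_norm.
  rewrite mulrA ler_wpM2r//; near: r; exact: nbhs_pinfty_ge.
suff dE : 'd (grad g) x = mulmxr A :> ('rV[R]_d -> 'rV[R]_d).
  by apply/row_matrixP => i; rewrite !rowE mul_rV_lin1 dE.
apply: diff_unique => //; apply/eqaddoP => _/posnumP[e].
(* The cube pays for norm comparisons: one factor for the vector of [d] remainders, two for the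
   square of [enorm v]. Using [d.+1] keeps it positive when [d] is 0. *)
have C1 : 0 < (`|C| + 1) * d.+1%:R ^+ 3 by rewrite mulr_gt0// ltr_wpDl.
have vsmall : \forall v \near (0 : 'rV[R]_d),
    `|v| < e%:num / ((`|C| + 1) * d.+1%:R ^+ 3).
  exact/pseudometric_normed_Zmodule.nbhs0_lt/divr_gt0.
apply: filterS vsmall => v /= /ltW; rewrite ler_pdivlMr// => vsmall.
rewrite (le_trans (norm_le_enorm _))//.
apply: (@le_trans _ _ (d%:R * ((`|C| + 1) * enorm v ^+ 2))).
  apply: enorm_le_coord => [|i]; first by rewrite mulr_ge0 ?addr_ge0 ?sqr_ge0.
  change (`|(grad g (v + x) - (grad g x + v *m A)) 0 i| <=
    (`|C| + 1) * enorm v ^+ 2).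
  rewrite coordB coordD opprD addrA [v + x]addrC (le_trans (gC v i))//.
  by rewrite ler_wpM2r ?sqr_ge0// (le_trans (ler_norm C)) ?lerDl.
have := enorm_le_norm v.
have d0 : 0 <= d%:R :> R by [].
have d1 : d.+1%:R = d%:R + 1 :> R by rewrite -natr1.
move: vsmall; rewrite d1 => vsmall ev.
have ev2 : enorm v ^+ 2 <= (d%:R * `|v|) ^+ 2 by rewrite ler_pXn2r ?nnegrE ?mulr_ge0 ?enorm_ge0.
apply: (@le_trans _ _ (d%:R * ((`|C| + 1) * (d%:R * `|v|) ^+ 2))).
  by rewrite ler_wpM2l// ler_wpM2l// addr_ge0.
apply: (@le_trans _ _ (`|v| * ((`|C| + 1) * (d%:R + 1) ^+ 3) * `|v|)); last by rewrite ler_wpM2r.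
rewrite (_ : _ * (_ * _) = (`|C| + 1) * `|v| ^+ 2 * d%:R ^+ 3); last by ring.
rewrite (_ : _ * _ * `|v| = (`|C| + 1) * `|v| ^+ 2 * (d%:R + 1) ^+ 3); last by ring.
rewrite ler_wpM2l ?mulr_ge0 ?sqr_ge0 ?addr_ge0//.
by rewrite ler_pXn2r ?nnegrE ?addr_ge0// lerDl.
Unshelve. all: by end_near. Qed.

End DerivativeFromExpansion.

(** * Gradient, Hessian and Taylor bounds of the expected objective *)

Section ExpectedObjective.
Context {R : realType} {d : nat} {dX : measure_display}
  {X : measurableType dX} (P : probability X R) (f : 'rV[R]_d -> X -> R).
Variables (L1 L2 Delta G V : R) (x1 : 'rV[R]_d).
Hypotheses (L1_ge0 : 0 <= L1) (L2_ge0 : 0 <= L2)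
  (fP : problem P f L1 L2 Delta G V x1).
Implicit Types (x y v : 'rV[R]_d) (xi : X).
Local Notation F := (objective P f).
Local Notation intg h := (P.-integrable setT (EFin \o h)).
Local Notation "'E h" := (\int[P]_xi h xi) (at level 8, h at level 8).
Local Notation H x xi := (hess (f ^~ xi) x).

Lemma objectiveE x : F x = 'E (f x).
Proof. by rewrite /objective unlock. Qed.

Lemma intg_objective x : intg (f x).
Proof. exact: (problem_integrable fP). Qed.

Lemma sample_expansion x v xi :
  `|f (x + v) xi - f x xi - dotp v (sgrad f x xi)| <= L1 / 2 * enorm v ^+ 2.
Proof.
exact: (smooth_expansion (problem_smooth fP xi) (problem_grad_lip fP xi)).
Qed.

Lemma sgrad_expansion x v xi j :
  `|sgrad f (x + v) xi 0 j - sgrad f x xi 0 j - (v *m H x xi) 0 j| <=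
    L2 / 2 * enorm v ^+ 2.
Proof.
exact: (grad_expansion (problem_smooth fP xi) (problem_hess_lip fP xi)).
Qed.

Lemma dotp_delta (t : R) i v : dotp (t *: delta_mx 0 i) v = t * v 0 i.
Proof.
rewrite dotpZl /dotp (bigD1 i)//= big1 ?mxE ?eqxx ?mul1r ?addr0// => j /negPf ji.
by rewrite mxE ji andbF mul0r.
Qed.

Lemma mulmx_delta (t : R) i j (A : 'M[R]_d) :
  ((t *: delta_mx 0 i : 'rV[R]_d) *m A) 0 j = t * A i j.
Proof. by rewrite -scalemxAl -rowE !mxE. Qed.

Lemma norm_le_dist (a b c : R) : `|a - b| <= c -> `|b| <= `|a| + c.
Proof.
by rewrite distrC => h; rewrite -(subrK a b) addrC (le_trans (ler_normD _ _))// lerD2l.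
Qed.

Lemma difference_quotient_le (a b c : R) n :
  `|a - n.+1%:R^-1 * b| <= c * n.+1%:R^-1 ^+ 2 ->
  `|n.+1%:R * a - b| <= c / n.+1%:R.
Proof.
move=> h; have n0 : (0 : R) < n.+1%:R by [].
rewrite (_ : _ - _ = n.+1%:R * (a - n.+1%:R^-1 * b)); last by field.
rewrite normrM gtr0_norm// -ler_pdivlMl//.
by apply: le_trans h _; rewrite le_eqVlt; apply/orP; left; apply/eqP; field.
Qed.

Lemma measurable_sgrad x i : measurable_fun setT (fun xi => sgrad f x xi 0 i).
Proof.
pose e := delta_mx 0 i : 'rV[R]_d.
apply: (@measurable_fun_approx _ _ _ _ (fun n xi =>
  n.+1%:R * (f (x + n.+1%:R^-1 *: e) xi - f x xi)) (L1 / 2 * enorm e ^+ 2)).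
  move=> n; apply: measurable_funM => //; apply: measurable_funB;
    exact: intg_measurable (intg_objective _).
move=> n xi; apply: difference_quotient_le.
have := sample_expansion x (n.+1%:R^-1 *: e) xi.
rewrite dotp_delta enormZ exprMn [`|n.+1%:R^-1|]ger0_norm ?invr_ge0//.
by rewrite mulrA mulrAC.
Qed.

(** Dominated by the difference of [f] over a unit step, which is integrable, plus the constant
    Taylor remainder of that step. *)
Lemma intg_sgrad x i : intg (fun xi => sgrad f x xi 0 i).
Proof.
pose e := delta_mx 0 i : 'rV[R]_d.
apply: (@intg_dom _ _ _ _ _ (fun xi =>
  `|f (x + 1 *: e) xi - f x xi| + L1 / 2 * enorm (1 *: e) ^+ 2)).
- exact: measurable_sgrad.
- move=> xi; have := sample_expansion x (1 *: e) xi; rewrite dotp_delta mul1r.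
  exact: norm_le_dist.
- apply: intgD; last exact: intg_cst.
  by apply: integrable_norm; apply: intgB; exact: intg_objective.
Qed.

Lemma measurable_shess x i j : measurable_fun setT (fun xi => H x xi i j).
Proof.
pose e := delta_mx 0 i : 'rV[R]_d.
apply: (@measurable_fun_approx _ _ _ _ (fun n xi =>
  n.+1%:R * (sgrad f (x + n.+1%:R^-1 *: e) xi 0 j - sgrad f x xi 0 j))
  (L2 / 2 * enorm e ^+ 2)).
  move=> n; apply: measurable_funM => //; apply: measurable_funB;
    exact: measurable_sgrad.
move=> n xi; apply: difference_quotient_le.
have := sgrad_expansion x (n.+1%:R^-1 *: e) xi j.
rewrite mulmx_delta enormZ exprMn [`|n.+1%:R^-1|]ger0_norm ?invr_ge0//.
by rewrite mulrA mulrAC.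
Qed.

(** Here the domination is by a constant, because the difference of gradients over a unit step is
    bounded by the Lipschitz condition. *)
Lemma intg_shess x i j : intg (fun xi => H x xi i j).
Proof.
pose e := delta_mx 0 i : 'rV[R]_d.
apply: (@intg_bounded _ _ _ _ _
  (L1 * enorm (x + 1 *: e - x) + L2 / 2 * enorm (1 *: e) ^+ 2)).
  exact: measurable_shess.
move=> xi; have := sgrad_expansion x (1 *: e) xi j; rewrite mulmx_delta mul1r.
have := le_trans (coord_le_enorm _ j) (problem_grad_lip fP xi (x + 1 *: e) x).
rewrite coordB => ha /norm_le_dist /le_trans; apply.
by rewrite lerD2r.
Qed.

Lemma Rint_mulmx v x j : intg (fun xi => (v *m H x xi) 0 j) /\
  'E (fun xi => (v *m H x xi) 0 j) =
  (v *m (\matrix_(i, k) 'E (fun xi => H x xi i k))) 0 j.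
Proof.
have [|i1 i2] := @Rint_sum _ _ _ P _ (index_enum 'I_d)
  (fun i xi => v 0 i * H x xi i j); first by move=> i; apply: intgZ; exact: intg_shess.
rewrite (_ : (fun xi => _) = fun xi => \sum_i v 0 i * H x xi i j); last first.
  by apply/funext => xi; rewrite mxE.
split=> //; rewrite i2 mxE; apply: eq_bigr => i _; rewrite mxE RintegralZl//.
exact: intg_shess.
Qed.

Lemma grad_objective x : grad F x = \row_i 'E (fun xi => sgrad f x xi 0 i).
Proof.
apply: (@grad_expansionE _ _ _ _ _ (L1 / 2)) => v; rewrite !objectiveE.
have [i1 <-] := @Rint_dotp _ _ _ P d v (sgrad f x) (intg_sgrad x).
rewrite -RintegralB//; try exact: intg_objective.
rewrite -RintegralB//; last by apply: intgB; exact: intg_objective.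
apply: Rint_norm_le => [|xi]; last exact: sample_expansion.
by apply: intgB => //; apply: intgB; exact: intg_objective.
Qed.

Lemma grad_objectiveE x i : grad F x 0 i = 'E (fun xi => sgrad f x xi 0 i).
Proof. by rewrite grad_objective mxE. Qed.

Lemma objective_expansion x v :
  `|F (x + v) - F x - dotp v (grad F x)| <= L1 / 2 * enorm v ^+ 2.
Proof.
rewrite grad_objective !objectiveE.
have [i1 <-] := @Rint_dotp _ _ _ P d v (sgrad f x) (intg_sgrad x).
rewrite -RintegralB//; try exact: intg_objective.
rewrite -RintegralB//; last by apply: intgB; exact: intg_objective.
apply: Rint_norm_le => [|xi]; last exact: sample_expansion.
by apply: intgB => //; apply: intgB; exact: intg_objective.
Qed.

Lemma hess_objective x : hess F x = \matrix_(i, j) 'E (fun xi => H x xi i j).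
Proof.
apply: (@hess_expansionE _ _ _ _ _ (L2 / 2)) => v j; rewrite !grad_objectiveE.
have [i1 <-] := Rint_mulmx v x j.
rewrite -RintegralB//; try exact: intg_sgrad.
rewrite -RintegralB//; last by apply: intgB; exact: intg_sgrad.
apply: Rint_norm_le => [|xi]; last exact: sgrad_expansion.
by apply: intgB => //; apply: intgB; exact: intg_sgrad.
Qed.

Lemma hess_objectiveE x i j : hess F x i j = 'E (fun xi => H x xi i j).
Proof. by rewrite hess_objective mxE. Qed.

(** The inequality of each sample is integrated; its linear and quadratic terms are linear in the
    gradient and the Hessian, whose expectations are those of [F]. *)
Lemma objective_cubic_upper_bound x v :
  F (x + v) <= F x + dotp v (grad F x) + dotp (v *m hess F x) v / 2 +
    L2 / 3 * enorm v ^+ 3.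
Proof.
rewrite grad_objective hess_objective !objectiveE.
have [i1 <-] := @Rint_dotp _ _ _ P d v (sgrad f x) (intg_sgrad x).
have [|i2 E2] := @Rint_dotp _ _ _ P d v (fun xi => v *m H x xi).
  by move=> j; exact: (Rint_mulmx v x j).1.
rewrite (_ : dotp (v *m _) v = 'E (fun xi => dotp v (v *m H x xi))); last first.
  rewrite E2 dotpC; congr dotp; apply/rowP => j.
  by rewrite -(Rint_mulmx v x j).2 [in RHS]mxE.
rewrite mulrC -RintegralZl// -RintegralD//; last exact: intg_objective.
have i3 := intgZ 2^-1 i2; have i0 := intg_objective x.
rewrite -RintegralD//; last exact: intgD.
rewrite -[X in _ <= _ + X](Rint_cst P) -RintegralD//; last 2 first.
- by apply: intgD => //; exact: intgD.
- exact: intg_cst.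
apply: le_Rintegral => //.
- exact: intg_objective.
- by apply: intgD; [apply: intgD => //; exact: intgD|exact: intg_cst].
move=> xi _; rewrite [2^-1 * _]mulrC (dotpC v (v *m _)).
exact: (cubic_upper_bound L2_ge0 (problem_smooth fP xi) (problem_hess_lip fP xi)).
Qed.

Lemma grad_objective_lip x y i :
  `|grad F x 0 i - grad F y 0 i| <= L1 * enorm (x - y).
Proof.
rewrite !grad_objectiveE -RintegralB//; try exact: intg_sgrad.
apply: Rint_norm_le => [|xi]; first by apply: intgB; exact: intg_sgrad.
by rewrite -coordB (le_trans (coord_le_enorm _ i))// (problem_grad_lip fP).
Qed.

(** An entrywise statement suffices, as it serves the measurability of the Hessian in the point. *)
Lemma hess_objective_lip x y i j :
  `|hess F x i j - hess F y i j| <= L2 * enorm (x - y).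
Proof.
have ix := intg_shess x i j; have iy := intg_shess y i j.
have -> : hess F x i j - hess F y i j = 'E (fun xi => H x xi i j - H y xi i j).
  rewrite (RintegralB measurableT ix iy).
  congr (_ - _); exact: hess_objectiveE.
apply: Rint_norm_le => [|xi]; first exact: (intgB ix iy).
rewrite -mxcoordB (le_trans (coord_le_specnorm _ i j))//.
exact: (problem_hess_lip fP xi x y).
Qed.

End ExpectedObjective.

(** * Measurability *)

Section MeasurableSets.
Context {dT : measure_display} {T : measurableType dT}.

Lemma bigcup_countType_measurable (I : countType) (A : I -> set T) :
  (forall i, measurable (A i)) -> measurable (\bigcup_i A i).
Proof.
move=> mA.
rewrite (_ : \bigcup_i A i = \bigcup_n (if unpickle n is Some i then A i else set0)).
  by apply: bigcupT_measurable => n; case: unpickle.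
apply/seteqP; split=> [t [i _ Ait]|t [n _]].
  by exists (pickle i) => //; rewrite pickleK.
by case: unpickle => // i Ait; exists i.
Qed.

Lemma set_measurable (b : T -> bool) :
  measurable_fun setT b -> measurable [set t | b t].
Proof.
move=> mb; rewrite -[X in measurable X]setTI.
exact: (mb measurableT [set true] I).
Qed.

Lemma measurable_set_bool (b : T -> bool) :
  measurable [set t | b t] -> measurable_fun setT b.
Proof. by move=> mb; apply: (measurable_fun_bool true); rewrite setTI. Qed.

End MeasurableSets.

Section BorelMeasurability.
Context {R : realType} {d : nat} {dT : measure_display} {T : measurableType dT}.
Local Notation rV := (borel_rV R d).

Lemma rational_approx (x : 'rV[R]_d) (e : R) : 0 < e ->
  exists q : 'rV[rat]_d, forall i, `|x 0 i - ratr (q 0 i)| < e.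
Proof.
move=> e0; have xq i : exists q : rat, `|x 0 i - ratr q| < e.
  have [|q] := @rat_in_itvoo R (x 0 i - e) (x 0 i + e).
    by rewrite ltrBlDr -addrA ltrDl addr_gt0.
  by rewrite in_itv /= => /andP[q1 q2]; exists q; rewrite ltr_norml; apply/andP; split; lra.
exists (\row_i projT1 (cid (xq i))) => i; rewrite mxE.
exact: (projT2 (cid (xq i))).
Qed.

Lemma measurable_coord_rV i : measurable_fun setT (fun x : rV => (x : 'rV[R]_d) 0 i).
Proof.
apply: (measurability _ (RGenOpens.measurableE R)).
move=> _ [_ [a [b ->] <-]]; rewrite setTI; apply: sub_sigma_algebra.
have /continuousP := @coord_continuous R 1 d 0 i.
by apply; exact: interval_open.
Qed.

Lemma continuous_borel (g : 'rV[R]_d -> R) : continuous g ->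
  measurable_fun setT (g : rV -> R).
Proof.
move=> /continuousP cg; apply: (measurability _ (RGenOpens.measurableE R)).
move=> _ [_ [a [b ->] <-]]; rewrite setTI; apply: sub_sigma_algebra.
by apply: cg; exact: interval_open.
Qed.

(** An open set is the union of the countably many rational boxes that it contains, and the preimage
    of a box is a finite intersection of conditions on coordinates. *)
Lemma measurable_fun_rV (h : T -> 'rV[R]_d) :
  (forall i, measurable_fun setT (fun t => h t 0 i)) ->
  measurable_fun setT (h : T -> rV).
Proof.
move=> mh; apply: (@measurability _ _ _ (borel_rV R d) setT h (@open 'rV[R]_d) erefl).
move=> _ [U oU <-]; rewrite setTI.
pose B (p : 'rV[rat]_d * nat) : set 'rV[R]_d :=
  [set x | forall i, `|x 0 i - ratr (p.1 0 i)| < p.2.+1%:R^-1].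
pose A p := if `[< B p `<=` U >] then h @^-1` (B p) else set0.
rewrite (_ : h @^-1` U = \bigcup_p A p).
  apply: bigcup_countType_measurable => p; rewrite /A; case: ifP => // _.
  rewrite (_ : _ @^-1` _ = \bigcap_(i in [set: 'I_d])
      [set t | `|h t 0 i - ratr (p.1 0 i)| < p.2.+1%:R^-1]); last first.
    by apply/seteqP; split=> [t Bt i _|t Bt i]; exact: Bt.
  apply: fin_bigcap_measurable => // i _; apply: set_measurable.
  apply: measurable_fun_ltr => //; apply: measurableT_comp => //.
  exact: measurable_funB.
apply/seteqP; split=> t; last by move=> [p _]; rewrite /A; case: asboolP => // pU /pU.
move=> Ut; have /nbhs_ballP[e /= e0 eU] : nbhs (h t) U by exact: open_nbhs_nbhs.
have [n ne] : exists n, n.+1%:R^-1 < e / 2.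
  exists (Num.truncn (2 / e)); rewrite -ltf_pV2 ?posrE ?invr_gt0 ?divr_gt0// invf_div invrK.
  exact: truncnS_gt.
have [q hq] := @rational_approx (h t) n.+1%:R^-1 ltac:(by rewrite invr_gt0).
exists (q, n) => //; rewrite /A; case: asboolP => [_|[]]; first exact: hq.
move=> x Bx; apply: eU; split=> // j i; rewrite /ball/= (ord1 j).
rewrite (splitr e) (le_lt_trans (ler_distD (ratr (q 0 i)) _ _))// ltrD//.
  exact: lt_trans (hq i) ne.
by rewrite distrC (lt_trans (Bx i)).
Qed.

Lemma measurable_rV_coord (h : T -> 'rV[R]_d) i :
  measurable_fun setT (h : T -> rV) -> measurable_fun setT (fun t => h t 0 i).
Proof. by move=> mh; exact: measurableT_comp (measurable_coord_rV i) mh. Qed.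

Lemma measurable_dotp (h1 h2 : T -> 'rV[R]_d) :
  measurable_fun setT (h1 : T -> rV) -> measurable_fun setT (h2 : T -> rV) ->
  measurable_fun setT (fun t => dotp (h1 t) (h2 t)).
Proof.
move=> m1 m2; apply: measurable_sum => i.
by apply: measurable_funM; exact: measurable_rV_coord.
Qed.

Lemma measurable_enorm (h : T -> 'rV[R]_d) :
  measurable_fun setT (h : T -> rV) -> measurable_fun setT (fun t => enorm (h t)).
Proof.
move=> mh; rewrite (_ : (fun t => _) = fun t => Num.sqrt (dotp (h t) (h t))).
  apply: measurableT_comp; last exact: measurable_dotp.
  by apply: continuous_measurable_fun; exact: sqrt_continuous.
by apply/funext => t; rewrite -enorm_sqr sqrtr_sqr ger0_norm ?enorm_ge0.
Qed.

Lemma measurable_rVZ (k : T -> R) (h : T -> 'rV[R]_d) :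
  measurable_fun setT k -> measurable_fun setT (h : T -> rV) ->
  measurable_fun setT ((fun t => k t *: h t) : T -> rV).
Proof.
move=> m1 m2; apply: measurable_fun_rV => i; under eq_fun do rewrite mxE.
by apply: measurable_funM => //; exact: measurable_rV_coord.
Qed.

Lemma measurable_rVB (h1 h2 : T -> 'rV[R]_d) :
  measurable_fun setT (h1 : T -> rV) -> measurable_fun setT (h2 : T -> rV) ->
  measurable_fun setT ((fun t => h1 t - h2 t) : T -> rV).
Proof.
move=> m1 m2; apply: measurable_fun_rV => i; under eq_fun do rewrite coordB.
by apply: measurable_funB; exact: measurable_rV_coord.
Qed.

Lemma measurable_rV_eq0 (h : T -> 'rV[R]_d) :
  measurable_fun setT (h : T -> rV) -> measurable_fun setT (fun t => h t == 0).
Proof.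
move=> mh; rewrite (_ : (fun t => _) = fun t => enorm (h t) == 0).
  by apply: measurable_fun_eqr => //; exact: measurable_enorm.
by apply/funext => t; rewrite enorm_eq0.
Qed.

Lemma measurable_enormV (h : T -> 'rV[R]_d) :
  measurable_fun setT (h : T -> rV) ->
  measurable_fun setT (fun t => (enorm (h t))^-1).
Proof.
move=> mh; rewrite (_ : (fun t => _) = fun t => enorm (h t) `^ (-1)).
  apply: (@measurableT_comp _ _ _ _ _ _ (@powR R ^~ (-1)) _ (fun t => enorm (h t))).
    exact: measurable_powR.
  exact: measurable_enorm.
by apply/funext => t; rewrite powR_inv1 ?enorm_ge0.
Qed.

Lemma measurable_normalize (h : T -> 'rV[R]_d) :
  measurable_fun setT (h : T -> rV) ->
  measurable_fun setT ((fun t => (enorm (h t))^-1 *: h t) : T -> rV).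
Proof. by move=> mh; apply: measurable_rVZ => //; exact: measurable_enormV. Qed.

(** [g] exceeds [a] at (x, t) exactly when, for some rational point q within 1/(n+1) of x in each
    coordinate, [g] at (q, t) exceeds [a] by more than the Lipschitz error. This is a countable
    union of sets built from the measurable maps [g q]. *)
Lemma measurable_lipschitz_pair (g : 'rV[R]_d -> T -> R) (k : R) : 0 <= k ->
  (forall x, measurable_fun setT (g x)) ->
  (forall t x y, `|g x t - g y t| <= k * enorm (x - y)) ->
  measurable_fun setT (fun w : rV * T => g w.1 w.2).
Proof.
move=> k0 mg gk; apply: (measurability _ (RGenOInfty.measurableE R)).
move=> _ [_ [a ->] <-]; rewrite setTI.
pose q2x (q : 'rV[rat]_d) : 'rV[R]_d := map_mx ratr q.
pose A (p : 'rV[rat]_d * nat) : set (rV * T) :=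
  [set w | forall i, `|(w.1 : 'rV[R]_d) 0 i - ratr (p.1 0 i)| < p.2.+1%:R^-1] `&`
  [set w | a < g (q2x p.1) w.2 - k * (d%:R * p.2.+1%:R^-1)].
have near_dist (x : 'rV[R]_d) (q : 'rV[rat]_d) n :
    (forall i, `|x 0 i - ratr (q 0 i)| < n.+1%:R^-1) ->
    enorm (x - q2x q) <= d%:R * n.+1%:R^-1.
  move=> xq; apply: enorm_le_coord => [|i]; first by rewrite invr_ge0.
  by rewrite coordB [X in _ - X]mxE ltW.
rewrite (_ : _ @^-1` _ = \bigcup_p A p).
  apply: bigcup_countType_measurable => p; apply: measurableI.
    rewrite (_ : [set w | _] = \bigcap_(i in [set: 'I_d]) [set w : rV * T |
        `|(w.1 : 'rV[R]_d) 0 i - ratr (p.1 0 i)| < p.2.+1%:R^-1]); last first.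
      by apply/seteqP; split=> [w Aw i _|w Aw i]; exact: Aw.
    apply: fin_bigcap_measurable => // i _.
    have m1 : measurable_fun setT (fun w : rV * T => (w.1 : 'rV[R]_d) 0 i).
      exact: (measurableT_comp (measurable_coord_rV i) measurable_fst).
    apply: set_measurable; apply: measurable_fun_ltr => //.
    by apply: measurableT_comp => //; exact: measurable_funB.
  apply: set_measurable; apply: measurable_fun_ltr => //.
  apply: measurable_funB => //.
  exact: (measurableT_comp (mg _) measurable_snd).
apply/seteqP; split=> [[x t] /=|[x t] [[q n] _ [/= xq h]]].
  rewrite in_itv /= andbT => ag.
  (* The Lipschitz error is paid twice, from x to q and in the definition of [A], hence the factor
     2; the added 1 prevents a zero denominator. *)
  pose e := (g x t - a) / (2 * (k * d%:R + 1)).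
  have kd : 0 < k * d%:R + 1 by rewrite ltr_wpDl// mulr_ge0.
  have e0 : 0 < e by rewrite divr_gt0 ?subr_gt0 ?mulr_gt0.
  have [n ne] : exists n, n.+1%:R^-1 < e.
    exists (Num.truncn e^-1); rewrite -ltf_pV2 ?posrE ?invr_gt0// invrK.
    exact: truncnS_gt.
  have [q xq] := @rational_approx x n.+1%:R^-1 ltac:(by rewrite invr_gt0).
  exists (q, n) => //; split => //=.
  have := gk t x (q2x q); have := ler_wpM2l k0 (near_dist _ _ _ xq).
  rewrite ler_norml; set r := n.+1%:R^-1 in ne *.
  move=> h1 /andP[_ h2].
  have : e * (2 * (k * d%:R + 1)) = g x t - a by rewrite divfK// gt_eqF// mulr_gt0.
  have r0 : 0 < r by rewrite invr_gt0.
  have : r * (k * d%:R + 1) < e * (k * d%:R + 1) by rewrite ltr_pM2r.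
  lra.
rewrite in_itv /= andbT (lt_le_trans h)//.
have := gk t x (q2x q); have := ler_wpM2l k0 (near_dist _ _ _ xq).
by rewrite ler_norml; set r := n.+1%:R^-1 in h * => ? /andP[]; lra.
Qed.

End BorelMeasurability.

(** * Concentration of sums of independent variables *)

Section ExponentialInequalities.
Context {R : realType}.
Implicit Types x y : R.

Lemma expR_le_invB x : x < 1 -> expR x <= (1 - x)^-1.
Proof.
move=> x1; rewrite -[x in leLHS]opprK expRN lef_pV2 ?posrE ?expR_gt0 ?subr_gt0//.
exact: expR_ge1Dx.
Qed.

Lemma expR1_le4 : expR 1 <= 4 :> R.
Proof.
have -> : expR 1 = expR 2^-1 * expR 2^-1 :> R by rewrite -expRD; congr expR; lra.
rewrite (_ : 4 = 2 * 2); last by lra.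
have h : expR (2^-1 : R) <= 2.
  by apply: le_trans (expR_le_invB _) _; [lra|rewrite (_ : 1 - 2^-1 = 2^-1) ?invrK//; lra].
by apply: ler_pM => //; exact: expR_ge0.
Qed.

(** The form without constant term is chosen because the linear term vanishes for a centred
    variable. Above 1/2, x is at most 2 x^2; below, 1/(1 - x) is at most 1 + x + 2 x^2. *)
Lemma expR_le_sqr x : expR x <= x + expR (2 * x ^+ 2).
Proof.
have [x2|x2] := lerP x 2^-1; last first.
  rewrite -[leLHS]add0r lerD//; first by lra.
  by rewrite ler_expR; nra.
apply: (@le_trans _ _ (1 + x + 2 * x ^+ 2)); last first.
  by have := expR_ge1Dx (2 * x ^+ 2); lra.
apply: le_trans (expR_le_invB _) _; first by lra.
by rewrite -div1r ler_pdivrMr; [nra|lra].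
Qed.

(** Convexity: the tangent at [theta * y] is evaluated at [y] and at 0, and the two bounds are
    combined with weights [theta] and [1 - theta]. *)
Lemma expR_mul_le theta y : 0 <= theta <= 1 ->
  expR (theta * y) <= 1 + theta * (expR y - 1).
Proof.
move=> /andP[t0 t1]; set u := expR (theta * y).
have u0 : 0 < u by exact: expR_gt0.
have h1 : u * (1 + (1 - theta) * y) <= expR y.
  rewrite [y in leRHS](_ : y = theta * y + (1 - theta) * y); last by ring.
  by rewrite expRD ler_pM2l// expR_ge1Dx.
have h2 : u * (1 - theta * y) <= 1.
  rewrite -[leRHS]expR0 -(subrr (theta * y)) expRD ler_pM2l//.
  exact: expR_ge1Dx.
have := ler_wpM2l t0 h1; have t1' : 0 <= 1 - theta by rewrite subr_ge0.
by have := ler_wpM2l t1' h2; lra.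
Qed.

(** Turns exponential moments of both signs into a second moment. *)
Lemma sqr_le_expR x : x ^+ 2 <= 4 * (expR x + expR (- x)).
Proof.
wlog x0 : x / 0 <= x => [h|].
  have [|x0] := leP 0 x; first exact: h.
  by have := h (- x); rewrite sqrrN opprK addrC; apply; rewrite oppr_ge0 ltW.
have h := expR_ge1Dx (x / 2); have h2 := expR_ge0 (- x).
have -> : expR x = expR (x / 2) ^+ 2 by rewrite -expRM_natr; congr expR; field.
have : (x / 2) ^+ 2 <= expR (x / 2) ^+ 2.
  by rewrite ler_pXn2r ?nnegrE ?expR_ge0 ?divr_ge0//; lra.
by rewrite exprMn; lra.
Qed.

End ExponentialInequalities.

(** * Subgaussian sums by exponential moments *)

Section SampleLaw.
Context {R : realType} {dX : measure_display} {X : measurableType dX}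
  (P : probability X R).
Local Open Scope ereal_scope.

Lemma integral_le_measure d (T : measurableType d) (mu : {measure set T -> \bar R})
    (A : set T) (g : T -> \bar R) : measurable A -> measurable_fun setT g ->
  (forall t, 0 <= g t) -> (forall t, A t -> 1 <= g t) -> mu A <= \int[mu]_t g t.
Proof.
move=> mA mg g0 g1; rewrite -[A in mu A]setIT -integral_indic//.
apply: ge0_le_integral => //.
- by apply/measurable_EFinP; exact: measurable_indic.
- move=> t _; rewrite indicE; case: (boolP (t \in A)) => [|_]; last exact: g0.
  by rewrite inE; exact: g1.
Qed.

Lemma measurable_tuple_sum (Z : X -> R) n : measurable_fun setT Z ->
  measurable_fun setT (fun S : n.-tuple X => \sum_(i < n) Z (tnth S i))%R.
Proof.
move=> mZ; apply: measurable_sum => i.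
exact: (measurableT_comp mZ (measurable_tnth i)).
Qed.

Lemma sample_lawS n (g : n.+1.-tuple X -> \bar R) : measurable_fun setT g ->
  (forall S, 0 <= g S) ->
  \int[sample_law P n.+1]_S g S =
  \int[P]_x \int[sample_law P n]_S g (tuple_cons (x, S)).
Proof.
move=> mg g0; rewrite /= ge0_integral_distribution//.
rewrite fubini_tonelli1//; last by move=> ?; exact: g0.
by apply: measurableT_comp => //; exact: measurable_tuple_cons.
Qed.

Lemma tnth_tuple_cons0 n x (S : n.-tuple X) : tnth (tuple_cons (x, S)) ord0 = x.
Proof. by []. Qed.

Lemma tnth_tuple_consS n x (S : n.-tuple X) i :
  tnth (tuple_cons (x, S)) (lift ord0 i) = tnth S i.
Proof. by rewrite tnthS. Qed.

Lemma integral_sample_expR_sum (Z : X -> R) n : measurable_fun setT Z ->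
  \int[sample_law P n]_S (expR (\sum_(i < n) Z (tnth S i)))%:E =
  (\int[P]_x (expR (Z x))%:E) ^+ n.
Proof.
move=> mZ; have mexp m : measurable_fun setT
    (fun S : m.-tuple X => (expR (\sum_(i < m) Z (tnth S i)))%:E).
  apply/measurable_EFinP; apply: measurableT_comp; first exact: measurable_expR.
  exact: measurable_tuple_sum.
elim: n => [|n IHn].
  under eq_integral do rewrite big_ord0 expR0.
  rewrite integral_cst// mul1e; exact: (@probability_setT _ _ _ (sample_law P 0)).
rewrite sample_lawS//.
have inner x : \int[sample_law P n]_S
    (expR (\sum_(i < n.+1) Z (tnth (tuple_cons (x, S)) i)))%:E =
    (\int[P]_x (expR (Z x))%:E) ^+ n * (expR (Z x))%:E.
  rewrite -IHn muleC -ge0_integralZl//; last exact: mexp.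
  apply: eq_integral => S _.
  rewrite big_ord_recl tnth_tuple_cons0 expRD EFinM; congr (_ * (expR _)%:E).
  by apply: eq_bigr => i _; rewrite tnth_tuple_consS.
under eq_integral do rewrite inner.
rewrite ge0_integralZl//.
- by rewrite expeS muleC.
- by apply/measurable_EFinP; exact: measurableT_comp (@measurable_expR R) mZ.
- by rewrite expe_ge0// integral_ge0// => x _; rewrite lee_fin expR_ge0.
Qed.

Lemma lee_expe (a b : \bar R) n : 0 <= a -> a <= b -> a ^+ n <= b ^+ n.
Proof.
move=> a0 ab; elim: n => [//|n IHn].
by rewrite !expeS lee_pmul// expe_ge0.
Qed.

Section SubGaussian.
Variables (Z : X -> R) (G : R).
Hypotheses (G_gt0 : (0 < G)%R) (Z_int : P.-integrable setT (EFin \o Z))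
  (Z_mean : (\int[P]_x Z x = 0)%R)
  (Z_exp : \int[P]_x (expR (Z x ^+ 2 / G ^+ 2))%:E <= (expR 1)%:E).

Let mZ : measurable_fun setT Z := intg_measurable Z_int.

(** By [expR_le_sqr] the integrand is at most its linear part, of mean 0, plus
    [expR (theta * (Z ^+ 2 / G ^+ 2))] with [theta = 2 * lam ^+ 2 * G ^+ 2]. As [theta] is at most
    1, convexity brings in the assumed moment, bounded by 4, and 1 + 3 theta is at most the
    exponential of 3 theta. *)
Lemma subgaussian_mgf (lam : R) : (2 * lam ^+ 2 * G ^+ 2 <= 1)%R ->
  \int[P]_x (expR (lam * Z x))%:E <= (expR (6 * lam ^+ 2 * G ^+ 2))%:E.
Proof.
move=> lamG; set theta := (2 * lam ^+ 2 * G ^+ 2)%R in lamG *.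
have theta0 : (0 <= theta)%R by apply: mulr_ge0; [apply: mulr_ge0|]; rewrite ?sqr_ge0.
have intE : P.-integrable setT (EFin \o (fun x => expR (Z x ^+ 2 / G ^+ 2))).
  apply/integrableP; split.
    apply/measurable_EFinP; apply: measurableT_comp; first exact: measurable_expR.
    by apply: measurable_funM => //; exact: measurable_funX.
  under eq_integral do rewrite /= ger0_norm ?expR_ge0//.
  by rewrite (le_lt_trans Z_exp)// ltry.
have intB : P.-integrable setT
    (EFin \o (fun x => lam * Z x + (1 - theta + theta * expR (Z x ^+ 2 / G ^+ 2)))%R).
  apply: intgD; first exact: intgZ.
  by apply: intgD; [exact: intg_cst|exact: intgZ].
apply: (@le_trans _ _ (\int[P]_x (lam * Z x +
    (1 - theta + theta * expR (Z x ^+ 2 / G ^+ 2)))%:E)).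
  apply: ge0_le_integral => //.
  - apply/measurable_EFinP; apply: measurableT_comp; first exact: measurable_expR.
    exact: measurable_funM.
  - by case/integrableP: intB.
  move=> x _; rewrite lee_fin (le_trans (expR_le_sqr _))// lerD2l.
  rewrite (_ : 2 * (lam * Z x) ^+ 2 = theta * (Z x ^+ 2 / G ^+ 2))%R; last first.
    by rewrite /theta; field; rewrite gt_eqF.
  apply: (le_trans (@expR_mul_le _ theta _ _)); first by rewrite theta0.
  by rewrite le_eqVlt; apply/orP; left; apply/eqP; ring.
have -> : \int[P]_x (lam * Z x + (1 - theta + theta * expR (Z x ^+ 2 / G ^+ 2)))%:E =
    (\int[P]_x (lam * Z x + (1 - theta + theta * expR (Z x ^+ 2 / G ^+ 2))))%R%:E.
  by rewrite fineK//; exact: integrable_fin_num.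
have i1 := intgZ lam Z_int; have i2 := intgZ theta intE.
rewrite RintegralD//; last by apply: intgD => //; exact: intg_cst.
rewrite RintegralD//; last exact: intg_cst.
rewrite Rint_cst !RintegralZl// Z_mean mulr0 add0r lee_fin.
have h : (\int[P]_x expR (Z x ^+ 2 / G ^+ 2) <= 4)%R.
  rewrite -lee_fin fineK; last exact: integrable_fin_num.
  by rewrite (le_trans Z_exp)// lee_fin expR1_le4.
have h3 := expR_ge1Dx (3 * theta).
rewrite (_ : (6 * lam ^+ 2 * G ^+ 2 = 3 * theta)%R); last by rewrite /theta; ring.
by apply: le_trans h3; have := ler_wpM2l theta0 h; lra.
Qed.

Lemma sample_mgf n (lam : R) : (2 * lam ^+ 2 * G ^+ 2 <= 1)%R ->
  \int[sample_law P n]_S (expR (lam * \sum_(i < n) Z (tnth S i)))%:E <=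
  (expR (n%:R * (6 * lam ^+ 2 * G ^+ 2)))%:E.
Proof.
move=> lamG; under eq_integral do rewrite mulr_sumr.
rewrite (@integral_sample_expR_sum (fun x => lam * Z x)%R); last first.
  exact: measurable_funM.
rewrite expRM_natl EFin_expe; have := subgaussian_mgf lamG.
have : 0 <= \int[P]_x (expR (lam * Z x))%:E.
  by apply: integral_ge0 => x _; rewrite lee_fin expR_ge0.
exact: lee_expe.
Qed.

Lemma sample_tail n (t : R) : (0 <= t <= 8 * G)%R ->
  sample_law P n [set S | (n%:R * t <= \sum_(i < n) Z (tnth S i))%R] <=
  (expR (- (n%:R * (t ^+ 2 / (24 * G ^+ 2)))))%:E.
Proof.
(* This [lam] minimizes [6 * lam ^+ 2 * G ^+ 2 - lam * t]. The moment bound then requires t^2 to be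
   at most 72 G^2, whence the range up to [8 * G]. *)
move=> /andP[t0 tG]; pose lam := (t / (12 * G ^+ 2))%R.
have lamG : (2 * lam ^+ 2 * G ^+ 2 <= 1)%R.
  rewrite (_ : _ * _ = t ^+ 2 / (72 * G ^+ 2))%R; last by rewrite /lam; field; rewrite gt_eqF.
  by rewrite ler_pdivrMr ?mulr_gt0 ?exprn_gt0// mul1r; nra.
have lam0 : (0 <= lam)%R by rewrite divr_ge0// mulr_ge0// sqr_ge0.
have mS := @measurable_tuple_sum Z n mZ.
apply: (@le_trans _ _ (\int[sample_law P n]_S ((expR (- (lam * (n%:R * t))))%:E *
    (expR (lam * \sum_(i < n) Z (tnth S i)))%:E))).
  apply: integral_le_measure.
  - by apply: set_measurable; exact: measurable_fun_ler.
  - apply/measurable_EFinP; apply: measurable_funM => //.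
    apply: measurableT_comp; first exact: measurable_expR.
    exact: measurable_funM.
  - by move=> S; rewrite mule_ge0// lee_fin expR_ge0.
  - move=> S /= h; rewrite -EFinM lee_fin -expRD -[leLHS]expR0 ler_expR.
    by rewrite addrC subr_ge0 ler_wpM2l.
rewrite ge0_integralZl//.
- apply: (@le_trans _ _ ((expR (- (lam * (n%:R * t))))%:E *
    (expR (n%:R * (6 * lam ^+ 2 * G ^+ 2)))%:E)).
    by rewrite lee_wpmul2l ?lee_fin ?expR_ge0//; exact: sample_mgf.
  rewrite -EFinM lee_fin -expRD ler_expR le_eqVlt; apply/orP; left; apply/eqP.
  by rewrite /lam; field; rewrite gt_eqF.
- apply/measurable_EFinP; apply: measurableT_comp; first exact: measurable_expR.
  exact: measurable_funM.
Qed.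

Lemma sample_second_moment n : (0 < n)%N ->
  \int[sample_law P n]_S ((\sum_(i < n) Z (tnth S i)) ^+ 2)%:E <=
  (192 * n%:R * G ^+ 2)%:E.
Proof.
move=> n0; have n0' : (0 < n%:R :> R)%R by rewrite ltr0n.
(* With this [lam] the exponential moment of the sum is at most [expR 1], hence 4 for either sign;
   192 is 6 * 4 * (4 + 4). *)
pose lam := ((Num.sqrt (6 * n%:R * G ^+ 2))^-1)%R.
have sG : (0 < 6 * n%:R * G ^+ 2)%R by rewrite !mulr_gt0 ?exprn_gt0.
have lam0 : (0 < lam)%R by rewrite invr_gt0 sqrtr_gt0.
have lam2 : (lam ^+ 2 = (6 * n%:R * G ^+ 2)^-1)%R.
  by rewrite /lam exprVn sqr_sqrtr// ltW.
have lamG : (2 * lam ^+ 2 * G ^+ 2 <= 1)%R.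
  rewrite lam2 (_ : _ * _ = (3 * n%:R)^-1)%R; last by field; rewrite !gt_eqF.
  by rewrite invf_le1 ?mulr_gt0// -[leLHS]mul1r ler_pM// ?ler1n//; lra.
have mlamG : (2 * (- lam) ^+ 2 * G ^+ 2 <= 1)%R by rewrite sqrrN.
have mS := @measurable_tuple_sum Z n mZ.
have mE (s : R) : measurable_fun setT
    (fun S : n.-tuple X => (expR (s * \sum_(i < n) Z (tnth S i)))%:E).
  apply/measurable_EFinP; apply: measurableT_comp; first exact: measurable_expR.
  exact: measurable_funM.
apply: (@le_trans _ _ (\int[sample_law P n]_S ((4 / lam ^+ 2)%:E *
   ((expR (lam * \sum_(i < n) Z (tnth S i)))%:E +
    (expR (- lam * \sum_(i < n) Z (tnth S i)))%:E)))).
  apply: ge0_le_integral => //.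
  - by move=> S _; rewrite lee_fin sqr_ge0.
  - by apply/measurable_EFinP; exact: measurable_funX.
  - by apply: emeasurable_funM => //; exact: emeasurable_funD.
  move=> S _; rewrite -EFinD -EFinM lee_fin.
  have := sqr_le_expR (lam * \sum_(i < n) Z (tnth S i)).
  rewrite exprMn -mulNr mulrC -ler_pdivlMr ?exprn_gt0// => /le_trans; apply.
  by rewrite mulrAC.
rewrite ge0_integralZl//; last 3 first.
- exact: emeasurable_funD.
- by move=> S _; rewrite adde_ge0// lee_fin expR_ge0.
- by rewrite lee_fin divr_ge0// sqr_ge0.
rewrite ge0_integralD//; try by move=> S _; rewrite lee_fin expR_ge0.
apply: (@le_trans _ _ ((4 / lam ^+ 2)%:E * (4%:E + 4%:E))).
  apply: lee_wpmul2l; first by rewrite lee_fin divr_ge0// sqr_ge0.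
  have e1 : (expR (n%:R * (6 * lam ^+ 2 * G ^+ 2)) <= 4)%R.
    rewrite lam2 (_ : _ * _ = 1)%R ?expR1_le4//; by field; rewrite !gt_eqF.
  apply: leeD; [apply: le_trans (sample_mgf n lamG) _|
    apply: le_trans (sample_mgf n mlamG) _]; by rewrite lee_fin ?sqrrN.
rewrite -EFinD -EFinM lee_fin lam2 invrK le_eqVlt; apply/orP; left; apply/eqP.
by ring.
Qed.

End SubGaussian.
End SampleLaw.

(** * Mini-batches *)

Section Programs.
Context {R : realType} {d n : nat}.

Lemma run_bind (A B : Type) (oracle : 'rV[R]_d -> 'I_n -> R * 'rV[R]_d)
    (p : prog R d n A) (h : A -> prog R d n B) :
  run oracle (bind p h) = ((run oracle (h (run oracle p).1)).1,
    (run oracle p).2 + (run oracle (h (run oracle p).1)).2)%N.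
Proof.
elim: p => [a|x i k IHk] /=; first by case: (run _ (h a)).
by rewrite IHk.
Qed.

Context {dX : measure_display} {X : measurableType dX} (f : 'rV[R]_d -> X -> R).

Definition batch_mean (x : 'rV[R]_d) (S : n.-tuple X) : 'rV[R]_d :=
  n%:R^-1 *: \sum_(i < n) sgrad f x (tnth S i).

Lemma output_batch_grad x (S : n.-tuple X) :
  output f (batch_grad x) S = batch_mean x S.
Proof. by rewrite /output run_batch_grad. Qed.

Lemma ifo_batch_grad x (S : n.-tuple X) : ifo f (batch_grad x) S = n.
Proof. by rewrite /ifo run_batch_grad. Qed.

Lemma output_msgd L1 x (S : n.-tuple X) :
  output f (msgd L1 x) S = (x, x - L1^-1 *: batch_mean x S).
Proof. by rewrite /output /msgd run_bind run_batch_grad. Qed.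

Lemma ifo_msgd L1 x (S : n.-tuple X) : ifo f (msgd L1 x) S = n.
Proof. by rewrite /ifo /msgd run_bind run_batch_grad addn0. Qed.

End Programs.

Section FiniteUnion.
Context {R : realType} {dT : measure_display} {T : measurableType dT}
  (mu : {measure set T -> \bar R}).
Local Open Scope ereal_scope.

Lemma measure_bigcup_fin_le (I : finType) (A : I -> set T) (b : R) :
  (forall i, measurable (A i)) -> (forall i, mu (A i) <= b%:E) ->
  mu (\bigcup_i A i) <= (#|I|%:R * b)%:E.
Proof.
move=> mA Ab.
have -> : \bigcup_i A i = \big[setU/set0]_(i <- enum I) A i.
  rewrite -bigcup_seq; apply/seteqP; split=> [t [i _ Ait]|t [i /= _ Ait]];
    by exists i => //=; rewrite ?mem_enum.
have mB (s : seq I) : measurable (\big[setU/set0]_(i <- s) A i).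
  exact: bigsetU_measurable.
rewrite cardE; elim: (enum I) => [|i s IHs]; first by rewrite big_nil measure0 mul0r.
rewrite big_cons /= -natr1 mulrDl mul1r addrC EFinD.
apply: (@le_trans _ _ (mu (A i) + mu (\big[setU/set0]_(j <- s) A j))).
  exact: measureU2.
exact: leeD.
Qed.

End FiniteUnion.

Section Batches.
Context {R : realType} {d : nat} {dX : measure_display}
  {X : measurableType dX} (P : probability X R) (f : 'rV[R]_d -> X -> R).
Variables (L1 L2 Delta G V : R) (x1 : 'rV[R]_d).
Hypotheses (L1_gt0 : 0 < L1) (L2_gt0 : 0 < L2) (G_gt0 : 0 < G)
  (fP : problem P f L1 L2 Delta G V x1).
Implicit Types (x y v : 'rV[R]_d) (xi : X).
Local Notation F := (objective P f).
Local Notation rV := (borel_rV R d).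
Local Notation intg h := (P.-integrable setT (EFin \o h)).

Let L1_ge0 : 0 <= L1 := ltW L1_gt0.
Let L2_ge0 : 0 <= L2 := ltW L2_gt0.

Lemma near_norm (x : 'rV[R]_d) (r : R) : 0 < r ->
  \forall y \near x, `|y - x| < r.
Proof.
by move=> r0; apply/nbhs_ballP; exists r => //= y; rewrite -ball_normE /= distrC.
Qed.

Lemma continuous_objective : continuous F.
Proof.
move=> x; apply/(@cvgrPdist_le _ _ _ _ (nbhs_filter x)) => e e0.
pose a := enorm (grad F x); have a0 : 0 <= a := enorm_ge0 _.
have d0 : 0 <= d%:R :> R by [].
pose M := d%:R * a + L1 / 2 * d%:R ^+ 2 + 1.
have M0 : 0 < M by rewrite ltr_wpDl// addr_ge0 ?mulr_ge0 ?divr_ge0 ?sqr_ge0.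
near=> y.
have yx1 : `|y - x| < 1.
  near: y; exact: near_norm.
have yxe : `|y - x| < e / M.
  near: y; apply: near_norm; exact: divr_gt0.
have := objective_expansion fP x (y - x).
rewrite subrKC => h; have h2 := norm_dotp_le (y - x) (grad F x).
have h3 := enorm_le_norm (y - x); have h4 := enorm_ge0 (y - x).
set r := `|y - x| in yx1 yxe h3; set E := enorm (y - x) in h h2 h3 h4.
have r0 : 0 <= r := normr_ge0 _.
rewrite distrC (_ : F y - F x = (F y - F x - dotp (y - x) (grad F x)) +
  dotp (y - x) (grad F x)); last by ring.
rewrite (le_trans (ler_normD _ _))//.
apply: (@le_trans _ _ (L1 / 2 * E ^+ 2 + E * a)); first exact: lerD.
have E2 : E ^+ 2 <= (d%:R * r) ^+ 2 by rewrite ler_pXn2r ?nnegrE ?mulr_ge0.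
have r2 : r ^+ 2 <= r by rewrite expr2 ler_piMl// ltW.
apply: (@le_trans _ _ (M * r)); last by rewrite mulrC -ler_pdivlMr// ltW.
have h5 : L1 / 2 * E ^+ 2 <= L1 / 2 * d%:R ^+ 2 * r.
  rewrite -[leRHS]mulrA ler_wpM2l ?divr_ge0// (le_trans E2)// exprMn.
  by rewrite ler_wpM2l ?sqr_ge0.
have h6 : E * a <= d%:R * a * r by rewrite mulrAC ler_wpM2r.
by rewrite /M; lra.
Unshelve. all: by end_near. Qed.

Lemma measurable_objective : measurable_fun setT (F : rV -> R).
Proof. exact: continuous_borel continuous_objective. Qed.

Lemma lipschitz_measurable (g : 'rV[R]_d -> R) k : 0 <= k ->
  (forall x y, `|g x - g y| <= k * enorm (x - y)) ->
  measurable_fun setT (g : rV -> R).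
Proof.
move=> k0 gk.
have m : measurable_fun setT (fun w : rV * rV => g w.1).
  by apply: (@measurable_lipschitz_pair R d _ rV (fun x _ => g x) k).
rewrite (_ : g = (fun w : rV * rV => g w.1) \o (fun x : rV => (x, x)))//.
by apply: measurableT_comp => //; exact: measurable_fun_pair.
Qed.

Lemma measurable_grad_objective : measurable_fun setT (grad F : rV -> rV).
Proof.
apply: measurable_fun_rV => i; apply: (@lipschitz_measurable _ L1) => // x y.
exact: (grad_objective_lip fP).
Qed.

Lemma measurable_hess_objective i j :
  measurable_fun setT ((fun x => hess F x i j) : rV -> R).
Proof.
apply: (@lipschitz_measurable _ L2) => // x y.
exact: (hess_objective_lip fP).
Qed.

Lemma measurable_sgrad_pair i :
  measurable_fun setT (fun w : rV * X => sgrad f w.1 w.2 0 i).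
Proof.
apply: (@measurable_lipschitz_pair R d _ X (fun x xi => sgrad f x xi 0 i) L1) => //.
  by move=> x; exact: (measurable_sgrad fP).
move=> xi x y; rewrite -coordB (le_trans (coord_le_enorm _ _))//.
exact: (problem_grad_lip fP).
Qed.

Lemma coord_batch_mean n x (S : n.-tuple X) i : batch_mean f x S 0 i =
  n%:R^-1 * \sum_(j < n) sgrad f x (tnth S j) 0 i.
Proof. by rewrite mxE summxE. Qed.

Lemma measurable_batch_mean n :
  measurable_fun setT ((fun w : rV * n.-tuple X => batch_mean f w.1 w.2) : _ -> rV).
Proof.
apply: measurable_fun_rV => i; under eq_fun do rewrite coord_batch_mean.
apply: measurable_funM => //; apply: measurable_sum => j.
apply: (measurableT_comp (measurable_sgrad_pair i)
  (measurable_fun_pair measurable_fst _)).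
exact: (measurableT_comp (measurable_tnth j) measurable_snd).
Qed.

Lemma measurable_batch_mean1 n x :
  measurable_fun setT ((fun S : n.-tuple X => batch_mean f x S) : _ -> rV).
Proof.
rewrite (_ : (fun S => _) = (fun w : rV * n.-tuple X => batch_mean f w.1 w.2 : rV)
  \o (fun S => (x : rV, S)))//.
apply: measurableT_comp; first exact: measurable_batch_mean.
by apply: measurable_fun_pair.
Qed.

(** The sign lets an upper tail bound serve for both tails; the pairs of a coordinate and a sign
    index the union bound in [batch_tail]. *)
Definition grad_noise (s : bool) x i xi : R :=
  (-1) ^+ s * (sgrad f x xi 0 i - grad F x 0 i).

Lemma intg_grad_noise s x i : intg (grad_noise s x i).
Proof.
apply: intgZ; apply: intgB; last exact: intg_cst.
exact: (intg_sgrad fP).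
Qed.

Lemma mean_grad_noise s x i : \int[P]_xi grad_noise s x i xi = 0.
Proof.
have i1 := intg_sgrad fP x i.
rewrite /grad_noise RintegralZl//; last by apply: intgB => //; exact: intg_cst.
rewrite RintegralB//; last exact: intg_cst.
by rewrite Rint_cst (grad_objectiveE fP) subrr mulr0.
Qed.

(** The scale is enlarged from [G] to [G + 1] so that every deviation needed for [eps <= 1] lies in
    the range [8 * (G + 1)] of the tail bound, however small [G] is. *)
Lemma exp_grad_noise s x i :
  (\int[P]_xi (expR (grad_noise s x i xi ^+ 2 / (G + 1) ^+ 2))%:E <= (expR 1)%:E)%E.
Proof.
apply: le_trans (problem_subgaussian fP x); rewrite unlock.
have mn : measurable_fun setT (grad_noise s x i).
  exact: intg_measurable (intg_grad_noise _ _ _).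
have ms : measurable_fun setT ((sgrad f x : X -> 'rV[R]_d) : X -> rV).
  by apply: measurable_fun_rV => j; exact: (measurable_sgrad fP).
apply: ge0_le_integral => //.
- apply/measurable_EFinP; apply: measurableT_comp; first exact: measurable_expR.
  by apply: measurable_funM => //; exact: measurable_funX.
- apply/measurable_EFinP; apply: measurableT_comp; first exact: measurable_expR.
  apply: measurable_funM => //; apply: measurable_funX; apply: measurable_enorm.
  exact: measurable_rVB.
move=> xi _; rewrite lee_fin ler_expR ler_pM ?sqr_ge0 ?invr_ge0 ?sqr_ge0//.
  rewrite /grad_noise exprMn sqrr_sign mul1r -coordB -real_normK ?num_real//.
  by rewrite ler_pXn2r ?nnegrE ?enorm_ge0// coord_le_enorm.
by rewrite lef_pV2 ?posrE ?exprn_gt0 ?addr_gt0// ler_pXn2r ?nnegrE ?ltW ?addr_gt0// ltrDl.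
Qed.

Lemma batch_error_coord n x (S : n.-tuple X) s i : (0 < n)%N ->
  \sum_(j < n) grad_noise s x i (tnth S j) =
  n%:R * ((-1) ^+ s * (batch_mean f x S - grad F x) 0 i).
Proof.
move=> n0; rewrite -mulr_sumr big_split/= sumr_const card_ord coordB coord_batch_mean.
rewrite mulrCA; congr (_ * _); rewrite mulrBr mulVKf ?pnatr_eq0 -?lt0n//.
by rewrite mulNrn mulr_natl.
Qed.

(** A Euclidean error above [d%:R * t] forces a coordinate to exceed [t] in absolute value, which is
    one of 2 d signed events. *)
Lemma batch_tail n x (t : R) : (0 < n)%N -> 0 <= t <= 8 * (G + 1) ->
  (sample_law P n [set S | (d%:R * t < enorm (batch_mean f x S - grad F x))%R] <=
  (d%:R * 2 * expR (- (n%:R * (t ^+ 2 / (24 * (G + 1) ^+ 2)))))%:E)%E.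
Proof.
move=> n0 tG; have t0 : 0 <= t by case/andP: tG.
have n0' : 0 < n%:R :> R by rewrite ltr0n.
pose A (p : 'I_d * bool) := [set S : n.-tuple X |
  n%:R * t <= \sum_(j < n) grad_noise p.2 x p.1 (tnth S j)].
have mA p : measurable (A p).
  apply: set_measurable; apply: measurable_fun_ler => //.
  apply: measurable_tuple_sum; exact: intg_measurable (intg_grad_noise _ _ _).
apply: (@le_trans _ _ (sample_law P n (\bigcup_p A p))).
  apply: le_measure.
  - rewrite inE; apply: set_measurable; apply: measurable_fun_ltr => //.
    apply: measurable_enorm; apply: measurable_rVB => //.
    exact: measurable_batch_mean1.
  - by rewrite inE; exact: bigcup_countType_measurable.
  move=> S /=; rewrite ltNge => /negP h.
  have [//|nA] := pselect ((\bigcup_p A p) S).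
  exfalso; apply: h; apply: enorm_le_coord => // i.
  have nAp p : \sum_(j < n) grad_noise p.2 x p.1 (tnth S j) < n%:R * t.
    by rewrite ltNge; apply/negP => Ap; apply: nA; exists p.
  have := nAp (i, false); have := nAp (i, true).
  rewrite !batch_error_coord//= !ltr_pM2l// expr0 expr1 mul1r mulN1r => h1 h2.
  by rewrite ler_norml; apply/andP; split; lra.
rewrite -[d%:R * 2](_ : #|{: 'I_d * bool}|%:R = _); last first.
  by rewrite card_prod card_ord card_bool natrM.
apply: measure_bigcup_fin_le => // p.
apply: (@sample_tail _ _ _ _ _ (G + 1)) => //.
- by rewrite addr_gt0.
- exact: intg_grad_noise.
- exact: mean_grad_noise.
- exact: exp_grad_noise.
Qed.

Lemma batch_second_moment n x : (0 < n)%N ->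
  (\int[sample_law P n]_S (enorm (batch_mean f x S - grad F x) ^+ 2)%:E <=
  (192 * d%:R * (G + 1) ^+ 2 / n%:R)%:E)%E.
Proof.
move=> n0; have n0' : 0 < n%:R :> R by rewrite ltr0n.
under eq_integral => S _.
  rewrite enorm_sqr (_ : dotp _ _ = \sum_(i < d) n%:R^-2 *
    (\sum_(j < n) grad_noise false x i (tnth S j)) ^+ 2); last first.
    apply: eq_bigr => i _; rewrite batch_error_coord// expr0 mul1r.
    by field; rewrite gt_eqF.
  rewrite -sumEFin; over.
have mS i : measurable_fun setT
    (fun S : n.-tuple X => \sum_(j < n) grad_noise false x i (tnth S j)).
  apply: measurable_tuple_sum; exact: intg_measurable (intg_grad_noise _ _ _).
rewrite ge0_integral_sum//; last 2 first.
- move=> i; apply/measurable_EFinP; apply: measurable_funM => //.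
  exact: measurable_funX.
- by move=> i S _; rewrite lee_fin mulr_ge0// ?invr_ge0 sqr_ge0.
apply: (@le_trans _ _ (\sum_(i < d) (192 * (G + 1) ^+ 2 / n%:R)%:E)%E).
  apply: lee_sum => i _; under eq_integral do rewrite EFinM.
  rewrite ge0_integralZl//; last 2 first.
  - by apply/measurable_EFinP; exact: measurable_funX.
  - by move=> S _; rewrite lee_fin sqr_ge0.
  apply: (@le_trans _ _ ((n%:R ^- 2)%:E * (192 * n%:R * (G + 1) ^+ 2)%:E)%E).
    apply: lee_wpmul2l; first by rewrite lee_fin invr_ge0 sqr_ge0.
    apply: sample_second_moment => //.
    + by rewrite addr_gt0.
    + exact: intg_grad_noise.
    + exact: mean_grad_noise.
    + exact: exp_grad_noise.
  rewrite -EFinM lee_fin le_eqVlt; apply/orP; left; apply/eqP.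
  by field; rewrite gt_eqF.
rewrite sumEFin lee_fin sumr_const card_ord -mulr_natl le_eqVlt.
by apply/orP; left; apply/eqP; ring.
Qed.

(** For the step length 1/L1 the linear and quadratic terms of the expansion complete a square, so
    the error enters only through its squared norm. *)
Lemma sgd_step_descent x g :
  F (x - L1^-1 *: g) <= F x - enorm (grad F x) ^+ 2 / (2 * L1) +
    enorm (g - grad F x) ^+ 2 / (2 * L1).
Proof.
have := objective_expansion fP x (- (L1^-1 *: g)).
rewrite ler_norml => /andP[_]; rewrite enormN enormZ exprMn normfV gtr0_norm//.
rewrite !enorm_sqr dotpNl dotpZl !(dotpDl, dotpDr, dotpNl, dotpNr) (dotpC (grad F x) g).
set a := dotp g g; set b := dotp g _; set c := dotp _ _ => h.
suff E : - (L1^-1 * b) + L1 / 2 * (L1^-1 ^+ 2 * a) =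
    - (c / (2 * L1)) + (a - b + (- b - - c)) / (2 * L1) by lra.
by field; rewrite gt_eqF.
Qed.

(** A crude two-sided bound, for the integrability of the change of [F]. *)
Lemma sgd_step_change_norm x g :
  `|F (x - L1^-1 *: g) - F x| <= 3 * enorm (grad F x) ^+ 2 / L1 +
    2 * enorm (g - grad F x) ^+ 2 / L1.
Proof.
have := objective_expansion fP x (- (L1^-1 *: g)).
have gg := dotpp_ge0 (g - 2 *: grad F x).
rewrite enormN enormZ exprMn normfV [`|L1|]gtr0_norm//.
have := dotpp_ge0 (g - grad F x); have := dotpp_ge0 (g + grad F x).
move: gg; rewrite !enorm_sqr dotpNl dotpZl.
rewrite !(dotpDl, dotpDr, dotpNl, dotpNr, dotpZl, dotpZr) (dotpC (grad F x) g).
have := dotpp_ge0 g; have := dotpp_ge0 (grad F x).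
set a := dotp g g; set b := dotp g _; set c := dotp _ _ => c0 a0 h1 h2 h3.
have -> : L1 / 2 * (L1^-1 ^+ 2 * a) = a / 2 / L1 by field; rewrite gt_eqF.
rewrite (mulrC L1^-1 b) !ler_norml => /andP[l u].
have iL : 0 < L1^-1 by rewrite invr_gt0.
have mono p q : p <= q -> p / L1 <= q / L1 by move=> pq; rewrite ler_wpM2r// ltW.
set D := F _ - F x in l u *.
have e1 : (- b - a / 2) / L1 <= D by move: l; rewrite mulrBl mulNr; lra.
have e2 : D <= (- b + a / 2) / L1 by move: u; rewrite mulrDl mulNr; lra.
rewrite -mulrDl; apply/andP; split.
  by rewrite -mulNr; apply: le_trans e1; apply: mono; lra.
by apply: (le_trans e2); apply: mono; lra.
Qed.

Lemma intg_batch_error n x : (0 < n)%N ->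
  (sample_law P n).-integrable setT
    (EFin \o (fun S => enorm (batch_mean f x S - grad F x) ^+ 2)).
Proof.
move=> n0; apply/integrableP; split.
  apply/measurable_EFinP; apply: measurable_funX; apply: measurable_enorm.
  by apply: measurable_rVB => //; exact: measurable_batch_mean1.
under eq_integral do rewrite /= ger0_norm ?sqr_ge0//.
by rewrite (le_lt_trans (batch_second_moment _ n0))// ltry.
Qed.

(** The mean square error of the batch is at most [eps ^+ 2 / 2], so the noise gives back at most
    half of the decrease [eps ^+ 2 / (2 * L1)] of an exact step. *)
Lemma msgd_decrease n (eps : R) : (0 < n)%N -> 0 < eps ->
  192 * d%:R * (G + 1) ^+ 2 / n%:R <= eps ^+ 2 / 2 ->
  decrease_guarantee P f (msgd L1 : _ -> prog R d n _) eps (eps ^+ 2 / (4 * L1)).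
Proof.
move=> n0 eps0 neps x xeps change.
(* The premise on the gradient is quantified over samples; one exists because [sample_law] has total
   mass 1. *)
have [S0 _] : exists S : n.-tuple X, True.
  have : sample_law P n setT != 0%E by rewrite probability_setT.
  have [->|/set0P[S _]] := eqVneq (setT : set (n.-tuple X)) set0.
    by rewrite measure0 eqxx.
  by exists S.
have geps : eps <= enorm (grad F x) by have := xeps S0; rewrite output_msgd.
have changeE S : change S = F (x - L1^-1 *: batch_mean f x S) - F x.
  by rewrite /change output_msgd.
have int_e := intg_batch_error x n0.
set e := fun S : n.-tuple X => enorm (batch_mean f x S - grad F x) ^+ 2 in int_e.
have mchange : measurable_fun setT change.
  rewrite (_ : change = fun S => F (x - L1^-1 *: batch_mean f x S) - F x); last first.
    exact/funext.
  apply: measurable_funB => //.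
  apply: (measurableT_comp measurable_objective).
  apply: measurable_rVB => //; apply: measurable_rVZ => //.
  exact: measurable_batch_mean1.
have int_change : (sample_law P n).-integrable setT (EFin \o change).
  apply: (intg_dom mchange (h2 := fun S =>
    3 * enorm (grad F x) ^+ 2 / L1 + 2 / L1 * e S)).
    move=> S; rewrite changeE (le_trans (sgd_step_change_norm _ _))//.
    by rewrite lerD2l mulrAC.
  by apply: intgD; [exact: intg_cst|exact: intgZ].
split=> //; rewrite unlock.
rewrite -[leLHS]fineK; last exact: integrable_fin_num.
rewrite lee_fin -/(Rintegral _ _ _).
have int_bound : (sample_law P n).-integrable setT
    (EFin \o (fun S => - (eps ^+ 2 / (2 * L1)) + (2 * L1)^-1 * e S)).
  by apply: intgD; [exact: intg_cst|exact: intgZ].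
apply: (@le_trans _ _ (\int[sample_law P n]_S
    (- (eps ^+ 2 / (2 * L1)) + (2 * L1)^-1 * e S))).
  apply: le_Rintegral => // S _; rewrite -[leLHS]/(change S) changeE.
  have := sgd_step_descent x (batch_mean f x S).
  rewrite -/(e S) [e S / _]mulrC.
  have : eps ^+ 2 / (2 * L1) <= enorm (grad F x) ^+ 2 / (2 * L1).
    rewrite ler_wpM2r ?invr_ge0 ?mulr_ge0//.
    by rewrite ler_pXn2r ?nnegrE ?enorm_ge0// ltW.
  by lra.
rewrite RintegralD//; [|exact: intg_cst|exact: intgZ].
rewrite Rint_cst RintegralZl//.
have : \int[sample_law P n]_S e S <= eps ^+ 2 / 2.
  rewrite -lee_fin fineK; last exact: integrable_fin_num.
  by rewrite (le_trans (batch_second_moment _ n0))// lee_fin.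
move/(ler_wpM2l (_ : 0 <= (2 * L1)^-1)); rewrite invr_ge0 mulr_ge0// => /(_ isT).
suff E : (2 * L1)^-1 * (eps ^+ 2 / 2) =
  - (eps ^+ 2 / (4 * L1)) + eps ^+ 2 / (2 * L1) by lra.
by field; rewrite gt_eqF.
Qed.

End Batches.

(** * Independent seeds and stopped chains *)

Section IidSampleLaw.
Context {R : realType} {dW dO : measure_display} {W : measurableType dW}
  {O : measurableType dO} (Q : probability W R) (Pr : probability O R).
Local Open Scope ereal_scope.

Definition tuple_box n (B : nat -> set W) : set (n.-tuple W) :=
  [set t | forall i : 'I_n, B i (tnth t i)].

Lemma measurable_tuple_box n B : (forall j, measurable (B j)) ->
  measurable (tuple_box B : set (n.-tuple W)).
Proof.
move=> mB; rewrite (_ : tuple_box B = \bigcap_(i in [set: 'I_n])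
    ((fun t : n.-tuple W => tnth t i) @^-1` B i)); last first.
  by apply/seteqP; split=> [t Bt i _|t Bt i]; exact: Bt.
apply: fin_bigcap_measurable => // i _; rewrite -[X in measurable X]setTI.
exact: measurable_tnth.
Qed.

Lemma measurable_tuple_boxE n : @measurable _ (n.-tuple W) =
  <<s [set A | exists2 B, (forall j, measurable (B j)) & A = tuple_box B] >>.
Proof.
apply/seteqP; split; last first.
  apply: smallest_sub; first exact: sigma_algebra_measurable.
  by move=> _ [B mB ->]; exact: measurable_tuple_box.
apply: smallest_sub; first exact: smallest_sigma_algebra.
move=> A; rewrite -bigcup_seq => -[i _ [C mC <-]]; apply: sub_sigma_algebra.
exists (fun j : nat => if j == i then C else setT).
  by move=> j; case: ifP.
rewrite setTI; apply/seteqP; split=> [t Ct j|t /(_ i)]; rewrite /tuple_box /=.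
  by case: eqP => // /val_inj ->.
by rewrite eqxx.
Qed.

Lemma sample_law_box n B : (forall j, measurable (B j)) ->
  sample_law Q n (tuple_box B) = \big[*%E/1]_(j < n) Q (B j).
Proof.
elim: n B => [|n IHn] B mB.
  rewrite big_ord0 (_ : tuple_box B = setT); first exact: probability_setT.
  by apply/seteqP; split=> // t _ [].
rewrite big_ord_recl -(IHn (fun j => B j.+1))//=.
rewrite -product_measure1E//; last exact: measurable_tuple_box.
rewrite /distribution /pushforward; congr (_ _).
apply/seteqP; split=> [[x S] /= h|[x S] /= [hx hS] i].
  split; first exact: (h ord0).
  by move=> i; have := h (lift ord0 i); rewrite tnthS.
case: (unliftP ord0 i) => [j ->|->] //=.
by rewrite tnthS; exact: hS.
Qed.

Variable w : nat -> O -> W.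
Hypothesis w_iid : iid Pr Q w.

Definition first_samples n (o : O) : n.-tuple W := [tuple w i o | i < n].

Lemma measurable_first_samples n : measurable_fun setT (first_samples n).
Proof.
apply/measurable_fun_tnthP => i.
rewrite (_ : _ \o _ = w i); first exact: (w_iid.1 i).
by apply/funext => o /=; rewrite tnth_mktuple.
Qed.

(** [iid] prescribes the probabilities of boxes only. Boxes are stable under intersection and
    generate the product sigma-algebra, so they determine the joint law. *)
Lemma iid_sample_law n (A : set (n.-tuple W)) : measurable A ->
  Pr (first_samples n @^-1` A) = sample_law Q n A.
Proof.
pose mf := isMeasurableFun.Build _ _ _ _ _ (@measurable_first_samples n).
pose fs : {mfun O >-> n.-tuple W} := HB.pack (first_samples n) mf.
move=> mA; rewrite -[LHS]/(distribution Pr fs A).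
apply: (measure_unique _ (fun=> setT) (measurable_tuple_boxE n)) => //.
- move=> _ _ [B mB ->] [C mC ->]; exists (fun j => B j `&` C j).
    by move=> j; exact: measurableI.
  by apply/seteqP; split=> [t [Bt Ct] i|t BCt]; [|split=> i; case: (BCt i)].
- move=> _; exists (fun=> setT) => //; exact/seteqP.
- by rewrite bigcup_const.
- move=> _ [B mB ->]; apply: etrans (esym (sample_law_box n mB)).
  rewrite -(w_iid.2 n B mB).
  change (Pr (first_samples n @^-1` tuple_box B) =
    Pr (\bigcap_(j in `I_n) (w j @^-1` B j))); congr (Pr _).
  apply/seteqP; split=> [t h j /= jn|t h i].
    by have := h (Ordinal jn); rewrite tnth_mktuple.
  by rewrite tnth_mktuple; apply: h => /=.
- by move=> _; rewrite (le_lt_trans (probability_le1 _ _))// ltry.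
Qed.

End IidSampleLaw.

(* A run is bad when it fails before it stops or, if u is true, does neither. *)
Fixpoint bad_run (Z W : Type) (next : Z -> W -> Z) (fail stop : Z -> W -> bool)
    (u : bool) (z : Z) (s : seq W) : bool :=
  if s is a :: s' then
    fail z a || ~~ stop z a && bad_run next fail stop u (next z a) s'
  else u.

Section StoppedChain.
Context {R : realType} {dZ dW : measure_display} {Z : measurableType dZ}
  {W : measurableType dW} (Q : probability W R).
Variables (next : Z -> W -> Z) (fail stop : Z -> W -> bool) (u : bool).
Hypotheses
  (m_next : measurable_fun setT (fun p : Z * W => next p.1 p.2))
  (m_fail : measurable_fun setT (fun p : Z * W => fail p.1 p.2))
  (m_stop : measurable_fun setT (fun p : Z * W => stop p.1 p.2)).
Local Open Scope ereal_scope.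

Local Notation bad_run := (bad_run next fail stop u).

Lemma measurable_bad_run n :
  measurable_fun setT (fun p : Z * n.-tuple W => bad_run p.1 p.2).
Proof.
elim: n => [|n IHn].
  rewrite (_ : (fun p => _) = cst u); first exact: measurable_cst.
  by apply/funext => -[z S] /=; rewrite tuple0.
pose h (p : Z * n.+1.-tuple W) := (p.1, tnth p.2 ord0).
have mh : measurable_fun setT h.
  apply: measurable_fun_pair => //.
  exact: (measurableT_comp (measurable_tnth ord0) measurable_snd).
rewrite (_ : (fun p => _) = fun p : Z * n.+1.-tuple W =>
    fail (h p).1 (h p).2 || ~~ stop (h p).1 (h p).2 &&
    bad_run (next (h p).1 (h p).2) [tuple of behead p.2]); last first.
  by apply/funext => -[z S] /=; rewrite [S in LHS]tuple_eta.
apply: measurable_or; first exact: (measurableT_comp m_fail mh).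
apply: measurable_and.
  by apply: measurable_neg; exact: (measurableT_comp m_stop mh).
apply: (measurableT_comp (f := fun p : Z * n.-tuple W => bad_run p.1 p.2)
  (g := fun p : Z * n.+1.-tuple W =>
    (next (h p).1 (h p).2, [tuple of behead p.2]))) => //.
apply: measurable_fun_pair; first exact: (measurableT_comp m_next mh).
apply: (measurableT_comp (f := fun x : n.+1.-tuple W => [tuple of behead x])) => //.
exact: measurable_behead.
Qed.

Lemma measurable_bad_run1 n z : measurable [set S : n.-tuple W | bad_run z S].
Proof.
apply: set_measurable.
rewrite (_ : (fun S => _) =
  (fun p : Z * n.-tuple W => bad_run p.1 p.2) \o (fun S => (z, S)))//.
by apply: measurableT_comp; [exact: measurable_bad_run|exact: measurable_fun_pair].
Qed.

Variables (N : nat) (Phi : nat -> Z -> R) (pf : R).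
Hypotheses (pf_ge0 : (0 <= pf)%R) (Phi_ge0 : forall j z, (0 <= Phi j z)%R)
  (m_Phi : forall j, measurable_fun setT (Phi j))
  (Phi_end : u -> forall z, (1 <= Phi N z)%R)
  (fail_le : forall z, Q [set a | fail z a] <= pf%:E)
  (Phi_step : forall j z, \int[Q]_a (if fail z a || stop z a then 0%R
     else Phi j.+1 (next z a))%:E <= (Phi j z)%:E).

(** Induction on the number of remaining steps: a failure now has probability at most [pf], a stop
    leaves nothing bad, and otherwise the bound holds from the next state, where the potential
    killed on failing or stopping has mean at most its present value. *)
Lemma bad_run_le n j z : (j + n)%N = N ->
  sample_law Q n [set S : n.-tuple W | bad_run z S] <= (n%:R * pf + Phi j z)%:E.
Proof.
have m_pair (z0 : Z) : measurable_fun setT (fun a : W => (z0, a)).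
  exact: measurable_fun_pair.
have m_fail1 z0 : measurable_fun setT (fail z0) by exact: (measurableT_comp m_fail (m_pair z0)).
have m_stop1 z0 : measurable_fun setT (stop z0) by exact: (measurableT_comp m_stop (m_pair z0)).
have m_next1 z0 : measurable_fun setT (next z0) by exact: (measurableT_comp m_next (m_pair z0)).
elim: n j z => [|n IHn] j z jN.
  rewrite mul0r add0r; have [ut|/negPf uf] : u \/ ~~ u by case: (u); [left|right].
    have h : sample_law Q 0 [set S : 0.-tuple W | bad_run z S] <= 1.
      by apply: probability_le1; exact: measurable_bad_run1.
    apply: (le_trans h).
    by rewrite lee_fin; move: jN; rewrite addn0 => ->; exact: Phi_end.
  rewrite (_ : [set S | _] = set0) ?measure0 ?lee_fin//.
  by apply/seteqP; split=> // S /=; rewrite tuple0 /= uf.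
rewrite -[X in sample_law _ _ X]setIT -integral_indic//; last first.
  exact: measurable_bad_run1.
rewrite sample_lawS//; last first.
  by apply/measurable_EFinP/measurable_indic; exact: measurable_bad_run1.
pose G a := (if fail z a || stop z a then 0%R else Phi j.+1 (next z a)).
have G0 a : (0 <= G a)%R by rewrite /G; case: ifP.
have mG : measurable_fun setT G.
  apply: measurable_fun_ifT => //; first exact: measurable_or.
  exact: (measurableT_comp (m_Phi _)).
have mfail : measurable [set a | fail z a] by exact: set_measurable.
apply: (@le_trans _ _ (\int[Q]_a ((\1_[set a | fail z a] a)%:E +
   ((n%:R * pf)%:E + (G a)%:E)))).
  apply: ge0_le_integral => //.
  - by move=> a _; apply: integral_ge0 => S _; rewrite lee_fin.
  - pose g (p : W * n.-tuple W) : \bar R :=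
      (\1_[set S : n.+1.-tuple W | bad_run z S] (tuple_cons p))%:E.
    apply: (measurable_fun_fubini_tonelli_F (m2 := sample_law Q n) g);
      last by move=> p; rewrite lee_fin.
    apply/measurable_EFinP; apply: measurableT_comp.
      apply: measurable_indic; exact: measurable_bad_run1.
    exact: measurable_tuple_cons.
  - apply: emeasurable_funD; first exact/measurable_EFinP/measurable_indic.
    by apply: emeasurable_funD => //; exact/measurable_EFinP.
  move=> a _; have inF : (a \in [set a0 | fail z a0]) = fail z a.
    by apply/idP/idP; rewrite inE.
  rewrite /G indicE inF.
  have -> : \int[sample_law Q n]_S (\1_[set S : n.+1.-tuple W | bad_run z S] (tuple_cons (a, S)))%:E =
      sample_law Q n [set S : n.-tuple W |
        fail z a || ~~ stop z a && bad_run (next z a) S].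
    rewrite -[X in sample_law _ _ X]setIT -integral_indic//.
    apply: set_measurable; apply: measurable_or => //; apply: measurable_and => //.
    by apply: measurable_set_bool; exact: measurable_bad_run1.
  case: (boolP (fail z a)) => [fa|_] /=.
    rewrite -!EFinD; apply: (@le_trans _ _ 1).
      have -> : [set _ : n.-tuple W | true] = setT by apply/seteqP; split.
      exact: (@probability_le1 _ _ _ (sample_law Q n) _ measurableT).
    by rewrite lee_fin lerDl addr0 mulr_ge0.
  case: (boolP (stop z a)) => [sa|_] /=.
    have -> : [set _ : n.-tuple W | false] = set0 by apply/seteqP; split.
    by rewrite measure0 -!EFinD lee_fin add0r addr0 mulr_ge0.
  by rewrite -!EFinD add0r; apply: IHn; rewrite addSnnS.
rewrite ge0_integralD//; last 3 first.
- by apply/measurable_EFinP/measurable_indic.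
- by move=> a _; rewrite adde_ge0// lee_fin ?mulr_ge0.
- by apply: emeasurable_funD => //; exact/measurable_EFinP.
rewrite ge0_integralD//; last 3 first.
- by move=> a _; rewrite lee_fin mulr_ge0.
- by move=> a _; rewrite lee_fin.
- exact/measurable_EFinP.
rewrite integral_indic// setIT integral_cst//= probability_setT mule1.
apply: (@le_trans _ _ (pf%:E + ((n%:R * pf)%:E + (Phi j z)%:E))).
  apply: leeD; first exact: fail_le.
  by apply: leeD; [exact: lexx|exact: Phi_step].
by rewrite -!EFinD lee_fin -natr1 mulrDl mul1r addrCA addrA.
Qed.

End StoppedChain.

(** * Runs of NEON-MSGD *)

Section NeonRuns.
Context {R : realType} {d : nat} {dX : measure_display}
  {X : measurableType dX} {T : Type} {n1 nc n2 : nat}.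
Variables (f : 'rV[R]_d -> X -> R) (L1 L2 eps gam c : R)
  (neon : 'rV[R]_d -> T -> prog R d n2 'rV[R]_d).
Implicit Types (x : 'rV[R]_d) (s : seed n1 nc n2 X T)
  (w : nat -> seed n1 nc n2 X T).
Local Notation alg := (msgd L1 : _ -> prog R d n1 _).
Local Notation neonA := (neonA f L2 eps gam c alg neon).
Local Notation neonA_step := (neonA_step f L2 eps gam c alg neon).

Definition first_order_met x s : bool := enorm (batch_mean f x s.1.1.2) <= eps.

Definition direction x s : 'rV[R]_d := output f (neon x s.1.2.2) s.1.2.1.

Definition neon_move x s : 'rV[R]_d :=
  x - (c * gam * (-1) ^+ s.2 / L2) *: ((enorm (direction x s))^-1 *: direction x s).

(** Total, as the chain requires: on a zero direction it stays at [x], where the chain has stopped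
    anyway. *)
Definition next_point x s : 'rV[R]_d :=
  if first_order_met x s then neon_move x s
  else x - L1^-1 *: batch_mean f x s.1.1.1.

Definition returns_now x s : bool := first_order_met x s && (direction x s == 0).

Lemma neonA_step_status x s : (neonA_step x s).1 =
  if returns_now x s then Returned x else Running (next_point x s).
Proof.
case: s => [[[S1 Sc] [S2 t]] b].
rewrite /neonA_step /returns_now /next_point /first_order_met /=.
by rewrite output_msgd output_batch_grad; case: ifP => //= _; case: ifP.
Qed.

Lemma neonA_step_cost Tn x s : (forall y t S, (ifo f (neon y t) S <= Tn)%N) ->
  ((neonA_step x s).2 <= n1 + nc + Tn)%N.
Proof.
move=> neonT; case: s => [[[S1 Sc] [S2 t]] b]; rewrite /neonA_step.
rewrite output_msgd ifo_msgd ifo_batch_grad.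
by case: ifP => _ /=; [rewrite leq_add2l; exact: neonT|exact: leq_addr].
Qed.

Lemma neonA_cost Tn x w N : (forall y t S, (ifo f (neon y t) S <= Tn)%N) ->
  ((neonA x w N).2 <= N * (n1 + nc + Tn))%N.
Proof.
move=> neonT; elim: N => // N IHN /=; case: (neonA x w N) IHN => -[y|y] cost /= IHN.
  case E : (neonA_step y (w N)) => [st k] /=; rewrite mulSn addnC leq_add//.
  by rewrite -[k]/((st, k).2) -E; exact: neonA_step_cost.
by rewrite (leq_trans IHN)// leq_mul2r leqnSn orbT.
Qed.

(** [neonA] appends its last iteration whereas [bad_run] recurses on the first; this unfolding
    reconciles them. *)
Lemma neonA_cons x w N : (neonA x w N.+1).1 =
  if returns_now x (w 0%N) then Returned x
  else (neonA (next_point x (w 0%N)) (fun i => w i.+1) N).1.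
Proof.
elim: N => [|N IHN].
  rewrite /= -neonA_step_status; by case: (neonA_step x (w 0%N)).
rewrite -[neonA x w N.+2]/(let: (st, cost) := neonA x w N.+1 in
    match st with
    | Running x => let: (st', k) := neonA_step x (w N.+1) in (st', (cost + k)%N)
    | Returned y => (st, cost)
    end).
case: (neonA x w N.+1) IHN => st cost /= ->.
case: ifP => // _; case: (neonA _ _ N) => -[y|y] k //=.
by case: (neonA_step y (w N.+1)).
Qed.

Lemma neonA_returned x w j N y : (j <= N)%N ->
  (neonA x w j).1 = Returned y -> (neonA x w N).1 = Returned y.
Proof.
move=> jN jy; rewrite -(subnKC jN); elim: (N - j)%N => [|k IHk]; first by rewrite addn0.
by rewrite addnS /=; case: (neonA x w (j + k)%N) IHk => st cost /= ->.
Qed.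

Lemma neonA_stepS x w j y : (neonA x w j).1 = Running y ->
  (neonA x w j.+1).1 = (neonA_step y (w j)).1.
Proof.
by move=> /=; case: (neonA x w j) => st cost /= ->; case: (neonA_step y (w j)).
Qed.

Variables (fail stop : 'rV[R]_d -> seed n1 nc n2 X T -> bool).
Hypothesis returns_stop : forall x s, returns_now x s -> stop x s.

Lemma mkseqS (A : Type) (h : nat -> A) N :
  mkseq h N.+1 = h 0%N :: mkseq (fun i => h i.+1) N.
Proof. by rewrite /mkseq /= (iotaDl 1 0) -map_comp. Qed.

Lemma run_reaches_stop x w N :
  ~~ bad_run next_point fail stop true x (mkseq w N) ->
  exists j y, [/\ (j < N)%N, (neonA x w j).1 = Running y,
    ~~ fail y (w j) & stop y (w j)].
Proof.
elim: N x w => [//|N IHN] x w; rewrite mkseqS /= negb_or => /andP[nf].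
have [st _|ns] := boolP (stop x (w 0%N)); first by exists 0%N, x.
move=> /IHN[j [y [jN jy jf js]]].
exists j.+1, y; split => //; rewrite neonA_cons; case: ifP => // r.
by rewrite (returns_stop r) in ns.
Qed.

(** With [u] false, running on to the end is not bad, so what is excluded is a failure before or at
    the return. *)
Lemma run_returns_safely x w N y :
  ~~ bad_run next_point fail returns_now false x (mkseq w N) ->
  (neonA x w N).1 = Returned y ->
  exists s, ~~ fail y s && returns_now y s.
Proof.
elim: N x w => [//|N IHN] x w; rewrite neonA_cons mkseqS /= negb_or => /andP[nf].
have [r _ [<-]|nr] := boolP (returns_now x (w 0%N)); last exact: IHN.
by exists (w 0%N); rewrite nf.
Qed.

End NeonRuns.

(** * Failures of one iteration *)

Section ProductMarginals.
Context {R : realType} {d1 d2 : measure_display} {T1 : measurableType d1}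
  {T2 : measurableType d2} (P1 : probability T1 R) (P2 : probability T2 R).
Local Open Scope ereal_scope.

Lemma product_measure_fst (A : set T1) : measurable A ->
  (P1 \x P2) [set p | A p.1] = P1 A.
Proof.
move=> mA; rewrite (_ : [set p | _] = A `*` setT); last first.
  by apply/seteqP; split=> [p|p []].
by rewrite product_measure1E//= probability_setT mule1.
Qed.

Lemma product_measure_snd (A : set T2) : measurable A ->
  (P1 \x P2) [set p | A p.2] = P2 A.
Proof.
move=> mA; rewrite (_ : [set p | _] = setT `*` A); last first.
  by apply/seteqP; split=> [p|p []].
by rewrite product_measure1E//= probability_setT mul1e.
Qed.

End ProductMarginals.

Section NeonMsgdStep.
Context {R : realType} {d : nat} {dX dT : measure_display}
  {X : measurableType dX} {T : measurableType dT} {n1 nc n2 : nat}.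
Variables (P : probability X R) (f : 'rV[R]_d -> X -> R)
  (L1 L2 Delta G V : R) (x1 : 'rV[R]_d).
Hypotheses (L1_gt0 : 0 < L1) (L2_gt0 : 0 < L2) (G_gt0 : 0 < G)
  (fP : problem P f L1 L2 Delta G V x1).
Variables (eps gam c pfail : R) (mu : probability T R)
  (neon : 'rV[R]_d -> T -> prog R d n2 'rV[R]_d) (Tn : nat) (certify : bool).
Hypotheses (eps_gt0 : 0 < eps) (gam_gt0 : 0 < gam) (c_gt0 : 0 < c)
  (pfail_ge0 : 0 <= pfail)
  (neonP : neon_spec P f mu neon Tn gam c pfail)
  (certP : certify -> neon_certifies P f mu neon gam c pfail).
Local Notation F := (objective P f).
Local Notation rV := (borel_rV R d).
Local Notation W := (seed n1 nc n2 X T).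
Implicit Types (x : 'rV[R]_d) (s : W) (q : n2.-tuple X * T).
Local Notation neon_law := (sample_law P n2 \x mu)%E.
Local Notation batch_law := (sample_law P n1 \x sample_law P nc)%E.
Local Notation first_order_met := (first_order_met f eps).
Local Notation direction := (direction f neon).
Local Notation next_point := (next_point f L1 L2 eps gam c neon).
Local Notation returns_now := (returns_now f eps neon).

Let L1_ge0 : 0 <= L1 := ltW L1_gt0.
Let L2_ge0 : 0 <= L2 := ltW L2_gt0.

Definition seed_prob : probability W R :=
  (batch_law \x neon_law \x bernoulli_prob 2^-1)%E.

Definition neon_curvature x q : R := rayleigh (hess F x) (output f (neon x q.2) q.1).

Definition certified x q : bool :=
  (output f (neon x q.2) q.1 != 0) && (neon_curvature x q <= - (c * gam)).

(* Contains the points where the Hessian has an eigenvalue at most - gam, and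
   is measurable for free. *)
Definition saddle x : bool :=
  ((1 - pfail)%:E <= neon_law [set q | certified x q])%E.

(** At a saddle every output that is not certified is a failure. Elsewhere an uncertified nonzero
    output is one only under [certify], since otherwise nothing bounds its probability. *)
Definition neon_fails x q : bool :=
  (saddle x || certify) && (output f (neon x q.2) q.1 != 0) &&
    (- (c * gam) < neon_curvature x q) ||
  saddle x && (output f (neon x q.2) q.1 == 0).

Definition batch_fails n x (S : n.-tuple X) : bool :=
  eps / 4 < enorm (batch_mean f x S - grad F x).

Definition step_fails x s : bool :=
  [|| batch_fails x s.1.1.1, batch_fails x s.1.1.2 | neon_fails x s.1.2].

(** Without [certify] the chain also stops at a point that meets the first-order condition and is no
    saddle: the point is already good, but the move NEON makes there may increase [F]. *)
Definition step_stops x s : bool :=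
  first_order_met x s && ((direction x s == 0) || ~~ certify && ~~ saddle x).

Lemma returns_now_stops x s : returns_now x s -> step_stops x s.
Proof. by rewrite /step_stops => /andP[-> ->]. Qed.

Section Measurability.

Lemma measurable_output_neon : measurable_fun setT
  (fun w : rV * (n2.-tuple X * T) => output f (neon w.1 w.2.2) w.2.1 : rV).
Proof. exact: (neon_measurable neonP). Qed.

Lemma measurable_neon_curvature : measurable_fun setT
  (fun w : rV * (n2.-tuple X * T) => neon_curvature w.1 w.2).
Proof.
have mu_ := measurable_output_neon.
rewrite (_ : (fun w => _) = fun w : rV * (n2.-tuple X * T) =>
  let u := output f (neon w.1 w.2.2) w.2.1 in
  dotp (u *m hess F w.1) u * ((enorm u)^-1) ^+ 2); last first.
  apply/funext => w /=; rewrite /neon_curvature /rayleigh mulmxE_dotp.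
  by rewrite exprVn.
apply: measurable_funM; last by apply: measurable_funX; exact: measurable_enormV.
apply: measurable_dotp => //; apply: measurable_fun_rV => j.
under eq_fun do rewrite mxE.
apply: measurable_sum => i; apply: measurable_funM; first exact: measurable_rV_coord.
exact: (measurableT_comp (measurable_hess_objective L2_gt0 fP i j) measurable_fst).
Qed.

Lemma measurable_certified : measurable_fun setT
  (fun w : rV * (n2.-tuple X * T) => certified w.1 w.2).
Proof.
apply: measurable_and.
  by apply: measurable_neg; exact: measurable_rV_eq0 measurable_output_neon.
by apply: measurable_fun_ler => //; exact: measurable_neon_curvature.
Qed.

Lemma measurable_saddle : measurable_fun setT (saddle : rV -> bool).
Proof.
apply: measurable_fun_lee => //.
have := measurable_fun_xsection (neon_law : probability _ R)
  (set_measurable measurable_certified).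
congr (measurable_fun _ _); apply/funext => x; congr (neon_law _).
by apply/seteqP; split=> q; rewrite /xsection /= inE.
Qed.

Lemma measurable_neon_fails : measurable_fun setT
  (fun w : rV * (n2.-tuple X * T) => neon_fails w.1 w.2).
Proof.
have ms : measurable_fun setT (fun w : rV * (n2.-tuple X * T) => saddle w.1).
  exact: (measurableT_comp measurable_saddle measurable_fst).
have m0 := measurable_rV_eq0 measurable_output_neon.
apply: measurable_or; last exact: measurable_and.
apply: measurable_and; first apply: measurable_and.
- by apply: measurable_or.
- exact: measurable_neg.
by apply: measurable_fun_ltr => //; exact: measurable_neon_curvature.
Qed.

Lemma measurable_batch_fails n : measurable_fun setT
  (fun w : rV * n.-tuple X => batch_fails w.1 w.2).
Proof.
apply: measurable_fun_ltr => //; apply: measurable_enorm; apply: measurable_rVB.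
  exact: (measurable_batch_mean L1_gt0 fP).
exact: (measurableT_comp (measurable_grad_objective L1_gt0 fP) measurable_fst).
Qed.

Let m_S1 : measurable_fun setT (fun w : rV * W => (w.1, w.2.1.1.1)).
Proof.
apply: measurable_fun_pair => //.
do 3!(apply: measurableT_comp => //).
Qed.

Let m_Sc : measurable_fun setT (fun w : rV * W => (w.1, w.2.1.1.2)).
Proof.
apply: measurable_fun_pair => //.
do 3!(apply: measurableT_comp => //).
Qed.

Let m_q : measurable_fun setT (fun w : rV * W => (w.1, w.2.1.2)).
Proof.
apply: measurable_fun_pair => //.
do 2!(apply: measurableT_comp => //).
Qed.

Let m_mean n : measurable_fun setT
  ((fun w : rV * n.-tuple X => batch_mean f w.1 w.2) : _ -> rV).
Proof. exact: (measurable_batch_mean L1_gt0 fP). Qed.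

Lemma measurable_step_fails :
  measurable_fun setT (fun w : rV * W => step_fails w.1 w.2).
Proof.
apply: measurable_or; first exact: (measurableT_comp (@measurable_batch_fails n1) m_S1).
apply: measurable_or; first exact: (measurableT_comp (@measurable_batch_fails nc) m_Sc).
exact: (measurableT_comp measurable_neon_fails m_q).
Qed.

Lemma measurable_first_order_met :
  measurable_fun setT (fun w : rV * W => first_order_met w.1 w.2).
Proof.
apply: measurable_fun_ler => //; apply: measurable_enorm.
exact: (measurableT_comp (@m_mean nc) m_Sc).
Qed.

Lemma measurable_direction :
  measurable_fun setT (fun w : rV * W => direction w.1 w.2 : rV).
Proof. exact: (measurableT_comp measurable_output_neon m_q). Qed.

Lemma measurable_step_stops :
  measurable_fun setT (fun w : rV * W => step_stops w.1 w.2).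
Proof.
apply: measurable_and; first exact: measurable_first_order_met.
apply: measurable_or; first exact: measurable_rV_eq0 measurable_direction.
apply: measurable_and => //; apply: measurable_neg.
exact: (measurableT_comp measurable_saddle measurable_fst).
Qed.

Lemma measurable_returns_now :
  measurable_fun setT (fun w : rV * W => returns_now w.1 w.2).
Proof.
apply: measurable_and; first exact: measurable_first_order_met.
exact: measurable_rV_eq0 measurable_direction.
Qed.

Lemma measurable_next_point :
  measurable_fun setT (fun w : rV * W => next_point w.1 w.2 : rV).
Proof.
apply: measurable_fun_ifT; first exact: measurable_first_order_met.
  apply: measurable_rVB => //; apply: measurable_rVZ; last first.
    by apply: measurable_normalize; exact: measurable_direction.
  apply: measurable_funM => //; apply: measurable_funM => //.
  rewrite (_ : (fun w => _) = (fun w : rV * W => if w.2.2 then -1 else 1 : R)).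
    apply: measurable_fun_ifT => //; apply: (measurableT_comp measurable_snd).
    exact: measurable_snd.
  by apply/funext => w; case: w.2.2; rewrite ?expr1 ?expr0.
apply: measurable_rVB => //; apply: measurable_rVZ => //.
exact: (measurableT_comp (@m_mean n1) m_S1).
Qed.

End Measurability.

(** At a saddle a failure lies in the complement of [certified], small by the definition of
    [saddle]; elsewhere it is the event of [neon_certifies], or empty. *)
Lemma neon_fails_le x : (neon_law [set q | neon_fails x q] <= pfail%:E)%E.
Proof.
have m_pair : measurable_fun setT (fun q => (x : rV, q)).
  exact: measurable_fun_pair.
have mfails : measurable [set q | neon_fails x q].
  by apply: set_measurable; exact: (measurableT_comp measurable_neon_fails m_pair).
have mcert : measurable [set q | certified x q].
  by apply: set_measurable; exact: (measurableT_comp measurable_certified m_pair).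
have [sx|nsx] : saddle x \/ ~~ saddle x by case: (saddle x); [left|right].
  apply: (@le_trans _ _ (neon_law (~` [set q | certified x q]))).
    apply: le_measure; rewrite ?inE//; first exact: measurableC.
    move=> q; rewrite /neon_fails /certified /= sx /=.
    by case: eqVneq => //= _; rewrite orbF ltNge => /negP.
  rewrite (@probability_setC _ _ _ neon_law)// leeBlDl//.
    by rewrite -leeBlDr// -EFinB.
  by rewrite fin_num_measure.
have [/certP cP|ncert] : certify \/ ~~ certify by case: (certify); [left|right].
  apply: le_trans (cP x); apply: le_measure; rewrite ?inE//.
    rewrite (_ : [set q | _] = [set q | (output f (neon x q.2) q.1 != 0) &&
        (- (c * gam) < neon_curvature x q)]); last first.
      by apply/seteqP; split=> q /= => [[-> ->]|/andP[]].
    apply: set_measurable; apply: measurable_and.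
      apply: measurable_neg.
      exact: (measurableT_comp (measurable_rV_eq0 measurable_output_neon) m_pair).
    apply: measurable_fun_ltr => //.
    exact: (measurableT_comp measurable_neon_curvature m_pair).
  by move=> q; rewrite /neon_fails (negPf nsx) /= orbF => /andP[/andP[_ ->] ->].
rewrite (_ : [set q | _] = set0) ?measure0 ?lee_fin//.
by apply/seteqP; split=> // q; rewrite /neon_fails /= (negPf nsx) (negPf ncert).
Qed.

Lemma batch_fails_le n x : (0 < n)%N -> eps <= 1 ->
  (sample_law P n [set S | batch_fails x S] <=
  (d.+1%:R * 2 * expR (- (n%:R * eps ^+ 2 /
    (384 * d.+1%:R ^+ 2 * (G + 1) ^+ 2))))%:E)%E.
Proof.
move=> n0 eps1; have d0 : 0 < d.+1%:R :> R by [].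
have G1 : 0 < G + 1 by rewrite addr_gt0.
(* Chosen so that [d.+1%:R * t] is [eps / 4]; the constant 384 is 24 * 4^2, and [d.+1] avoids a
   division by zero. *)
pose t := eps / (4 * d.+1%:R).
have t0 : 0 <= t by rewrite divr_ge0 ?mulr_ge0 ?ltW.
have dt : d.+1%:R * t = eps / 4 by rewrite /t; field.
have t1 : t <= 8 * (G + 1).
  apply: (@le_trans _ _ (d.+1%:R * t)); first by rewrite ler_peMl// ler1n.
  by rewrite dt; have := G_gt0; lra.
have tt : 0 <= t <= 8 * (G + 1) by rewrite t0.
apply: (@le_trans _ _ (sample_law P n
    [set S | d%:R * t < enorm (batch_mean f x S - grad F x)])).
  apply: le_measure; rewrite ?inE.
  + by apply: set_measurable; exact: (measurable_fun_pair2 _ (@measurable_batch_fails n)).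
  + apply: set_measurable; apply: measurable_fun_ltr => //.
    apply: measurable_enorm; apply: measurable_rVB => //.
    exact: (measurable_batch_mean1 L1_gt0 fP).
  move=> S; rewrite /batch_fails /= -dt; apply: le_lt_trans.
  by rewrite ler_wpM2r// ler_nat.
apply: (le_trans (batch_tail L1_gt0 G_gt0 fP x n0 tt)).
rewrite lee_fin; apply: ler_pM; rewrite ?mulr_ge0 ?expR_ge0//.
  by rewrite ler_wpM2r// ler_nat.
rewrite ler_expR le_eqVlt; apply/orP; left; apply/eqP; rewrite /t.
by field; rewrite !gt_eqF.
Qed.

Lemma step_fails_le x pg :
  (sample_law P n1 [set S | batch_fails x S] <= pg%:E)%E ->
  (sample_law P nc [set S | batch_fails x S] <= pg%:E)%E ->
  (seed_prob [set s | step_fails x s] <= (2 * pg + pfail)%:E)%E.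
Proof.
move=> h1 hc.
have mb n : measurable [set S : n.-tuple X | batch_fails x S].
  by apply: set_measurable; exact: (measurable_fun_pair2 _ (@measurable_batch_fails n)).
have mn : measurable [set q | neon_fails x q].
  by apply: set_measurable; exact: (measurable_fun_pair2 _ measurable_neon_fails).
pose Y := ((n1.-tuple X * nc.-tuple X) * (n2.-tuple X * T))%type.
pose A1 := [set p : Y | batch_fails x p.1.1].
pose A2 := [set p : Y | batch_fails x p.1.2].
pose A3 := [set p : Y | neon_fails x p.2].
have mb1 n : measurable_fun setT (fun S : n.-tuple X => batch_fails x S).
  exact: (measurable_fun_pair2 _ (@measurable_batch_fails n)).
have m1 : measurable A1.
  apply: set_measurable; apply: (measurableT_comp (mb1 n1)).
  exact: measurableT_comp measurable_fst.
have m2 : measurable A2.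
  apply: set_measurable; apply: (measurableT_comp (mb1 nc)).
  exact: measurableT_comp measurable_fst.
have m3 : measurable A3.
  apply: set_measurable; apply: measurableT_comp measurable_snd.
  exact: (measurable_fun_pair2 _ measurable_neon_fails).
rewrite (_ : [set s | _] = [set s | (A1 `|` (A2 `|` A3)) s.1]); last first.
  apply/seteqP; split=> s /=; rewrite /step_fails.
    by case/or3P; [left|right; left|right; right].
  by case=> [h|[h|h]]; apply/or3P; [exact: Or31|exact: Or32|exact: Or33].
have mA : measurable (A1 `|` (A2 `|` A3)) by do !apply: measurableU.
rewrite [leLHS](product_measure_fst (batch_law \x neon_law)%E (bernoulli_prob 2^-1) mA).
apply: (@le_trans _ _ ((batch_law \x neon_law) A1 +
    ((batch_law \x neon_law) A2 + (batch_law \x neon_law) A3)))%E.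
  apply: le_trans (measureU2 _ _ _) _ => //; first exact: measurableU.
  by apply: leeD => //; apply: measureU2.
have mb_1 : measurable [set p : n1.-tuple X * nc.-tuple X | batch_fails x p.1].
  by apply: set_measurable; exact: (measurableT_comp (mb1 n1)).
have mb_2 : measurable [set p : n1.-tuple X * nc.-tuple X | batch_fails x p.2].
  by apply: set_measurable; exact: (measurableT_comp (mb1 nc)).
have -> : ((batch_law \x neon_law) A1 = sample_law P n1 [set S | batch_fails x S])%E.
  rewrite [LHS](product_measure_fst batch_law neon_law mb_1).
  exact: (product_measure_fst (sample_law P n1) (sample_law P nc) (mb n1)).
have -> : ((batch_law \x neon_law) A2 = sample_law P nc [set S | batch_fails x S])%E.
  rewrite [LHS](product_measure_fst batch_law neon_law mb_2).
  exact: (product_measure_snd (sample_law P n1) (sample_law P nc) (mb nc)).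
have -> : ((batch_law \x neon_law) A3 = neon_law [set q | neon_fails x q])%E.
  exact: (product_measure_snd batch_law neon_law mn).
rewrite mulrDl mul1r -addrA !EFinD; apply: leeD => //; apply: leeD => //.
exact: neon_fails_le.
Qed.

(** A stop without failure is never at a saddle, because a zero output there is a failure. Since
    [neon_negative_curvature] makes every point with an eigenvalue bound of at most [- gam] a
    saddle, the conclusion holds with [gam] itself. The gradient is at most eps + eps/4. *)
Lemma step_stops_stationary x s : ~~ step_fails x s -> step_stops x s ->
  second_order_stationary F (3 / 2 * eps) gam x.
Proof.
rewrite !negb_or => /and3P[_ nb nn] /andP[fo st].
split.
  have := enormB_ge (grad F x) (batch_mean f x s.1.1.2).
  rewrite -[enorm (grad F x - _)]enormN opprB.
  move: nb fo; rewrite /batch_fails /first_order_met -leNgt => h1 h2 h3.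
  by have := eps_gt0; lra.
have nsx : ~~ saddle x.
  case/orP: st => [|/andP[_]//]; rewrite /direction => u0.
  apply/negP => sx; move: nn; rewrite /neon_fails sx /= => /andP[_].
  by rewrite u0.
rewrite leNgt; apply: contra nsx => /ltW /(neon_negative_curvature neonP).
congr (_ <= neon_law _)%E; apply/seteqP; split=> q /=.
  by move=> [h1 h2]; apply/andP.
by move=> /andP.
Qed.

End NeonMsgdStep.

(** * Decrease of the potential *)

Lemma integral_probability_cst {R : realType} {dT : measure_display}
  {T : measurableType dT} (Q : probability T R) (r : R) :
  (\int[Q]_t r%:E = r%:E)%E.
Proof. by rewrite integral_cst//= probability_setT mule1. Qed.

Section NeonMsgdDescent.
Context {R : realType} {d : nat} {dX dT : measure_display}
  {X : measurableType dX} {T : measurableType dT} {n1 nc n2 : nat}.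
Variables (P : probability X R) (f : 'rV[R]_d -> X -> R)
  (L1 L2 Delta G V : R) (x1 : 'rV[R]_d).
Hypotheses (L1_gt0 : 0 < L1) (L2_gt0 : 0 < L2) (G_gt0 : 0 < G)
  (fP : problem P f L1 L2 Delta G V x1).
Variables (eps gam c pfail : R) (mu : probability T R)
  (neon : 'rV[R]_d -> T -> prog R d n2 'rV[R]_d) (Tn : nat) (certify : bool).
Hypotheses (eps_gt0 : 0 < eps) (gam_gt0 : 0 < gam) (c_gt0 : 0 < c)
  (neonP : neon_spec P f mu neon Tn gam c pfail).
Local Notation F := (objective P f).
Local Notation rV := (borel_rV R d).
Local Notation W := (seed n1 nc n2 X T).
Implicit Types (x : 'rV[R]_d) (s : W).
Local Notation first_order_met := (first_order_met f eps).
Local Notation direction := (direction f neon).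
Local Notation next_point := (next_point f L1 L2 eps gam c neon).
Local Notation step_fails := (step_fails P f eps gam c pfail mu neon certify).
Local Notation step_stops := (step_stops P f eps gam c pfail mu neon certify).
Local Notation seed_prob := (seed_prob P mu : probability W R).

Lemma gradient_error x s : ~~ step_fails x s ->
  [/\ enorm (batch_mean f x s.1.1.1 - grad F x) <= eps / 4,
      enorm (grad F x) <= enorm (batch_mean f x s.1.1.2) + eps / 4 &
      enorm (batch_mean f x s.1.1.2) <= enorm (grad F x) + eps / 4].
Proof.
rewrite !negb_or -!leNgt => /and3P[h1 h2 _].
have := enormB_ge (grad F x) (batch_mean f x s.1.1.2).
have := enormB_ge (batch_mean f x s.1.1.2) (grad F x).
rewrite -[enorm (grad F x - _)]enormN opprB => h3 h4.
by split; [exact: h1|move: h2; lra|move: h2; lra].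
Qed.

(** The gradient is at least 3/4 eps and the error at most eps/4; (9 - 1)/16 = 1/2 gives, pathwise,
    the decrease that [msgd_decrease] gives in mean. *)
Lemma sgd_move_le x s : ~~ step_fails x s -> ~~ first_order_met x s ->
  F (next_point x s) <= F x - eps ^+ 2 / (4 * L1).
Proof.
move=> /gradient_error[e1 e2 e3] nm; rewrite /next_point (negPf nm).
apply: (le_trans (sgd_step_descent L1_gt0 fP _ _)).
move: nm; rewrite /first_order_met -ltNge => m.
set a := enorm (_ - _) in e1 *; set b := enorm (grad F x) in e2 e3 *.
have a0 : 0 <= a := enorm_ge0 _.
have b34 : 3 / 4 * eps <= b by lra.
have a2 : a ^+ 2 <= (eps / 4) ^+ 2.
  by rewrite ler_pXn2r ?nnegrE// divr_ge0// ltW.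
have b2 : (3 / 4 * eps) ^+ 2 <= b ^+ 2.
  by rewrite ler_pXn2r ?nnegrE ?enorm_ge0// mulr_ge0 ?ltW// ltW.
have iL : 0 <= (4 * L1)^-1 by rewrite invr_ge0 mulr_ge0 ?ltW.
suff : (b ^+ 2 * 2 - a ^+ 2 * 2) / (4 * L1) >= eps ^+ 2 / (4 * L1).
  have -> : (b ^+ 2 * 2 - a ^+ 2 * 2) / (4 * L1) =
    b ^+ 2 / (2 * L1) - a ^+ 2 / (2 * L1) by field; rewrite gt_eqF.
  by lra.
rewrite ler_wpM2r//; move: a2 b2; rewrite !exprMn; lra.
Qed.

(** First-order term of a NEON step without its sign; it does not depend on the sign bit of the
    seed, and so cancels in the average over both signs. *)
Definition slope x s : R :=
  - (c * gam / L2) * dotp ((enorm (direction x s))^-1 *: direction x s) (grad F x).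

(** For the step length c gam / L2 the curvature term and the cubic remainder are both multiples of
    c^3 gam^3 / L2^2, with factors -1/2 and 1/3, whence the 1/6. *)
Lemma neon_move_le x s : ~~ step_fails x s -> ~~ step_stops x s ->
  first_order_met x s ->
  F (next_point x s) <=
    F x - c ^+ 3 * gam ^+ 3 / (6 * L2 ^+ 2) + (-1) ^+ s.2 * slope x s /\
  `|slope x s| <= c * gam / L2 * (3 / 2 * eps).
Proof.
move=> nf ns m; have [_ e2 _] := gradient_error nf.
have t0 : 0 < c * gam / L2 by rewrite divr_gt0// mulr_gt0.
move: ns; rewrite /step_stops m /= negb_or negb_and !negbK => /andP[u0 sc].
set u := direction x s in u0 *.
have eu : 0 < enorm u by rewrite lt_neqAle enorm_ge0 eq_sym enorm_eq0 u0.
pose v := (enorm u)^-1 *: u.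
have ev : enorm v = 1.
  by rewrite enormZ ger0_norm ?invr_ge0 ?enorm_ge0// mulVf// gt_eqF.
have curv : dotp (v *m hess F x) v <= - (c * gam).
  have : neon_curvature P f neon x s.1.2 <= - (c * gam).
    move: nf; rewrite !negb_or => /and3P[_ _]; rewrite /neon_fails.
    rewrite -/(direction x s) -/u u0 andbT.
    rewrite orbC sc /= => /andP[]; by rewrite -leNgt.
  congr (_ <= _); rewrite /neon_curvature /rayleigh mulmxE_dotp.
  rewrite -/(direction x s) -/u -scalemxAl dotpZl dotpZr.
  by rewrite mulrC mulrA -expr2 exprVn.
have E : next_point x s = x + (- (c * gam * (-1) ^+ s.2 / L2)) *: v.
  by rewrite /next_point m scaleNr.
have sl : slope x s = - (c * gam / L2) * dotp v (grad F x) by [].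
rewrite {}sl; clearbody v.
split; last first.
  rewrite normrM normrN (gtr0_norm t0); apply: ler_wpM2l; first exact: ltW.
  apply: (le_trans (norm_dotp_le _ _)); rewrite ev mul1r.
  by move: m; rewrite /first_order_met; have := eps_gt0; lra.
rewrite E; apply: (le_trans (objective_cubic_upper_bound (ltW L2_gt0) fP _ _)).
rewrite -scalemxAl !dotpZl dotpZr enormZ ev mulr1.
set a := dotp v (grad F x); set b := dotp (v *m _) v in curv *.
set sg := (-1) ^+ s.2.
have sg2 : sg * sg = 1 by rewrite -expr2 sqrr_sign.
have -> : `|- (c * gam * sg / L2)| = c * gam / L2.
  rewrite normrN mulrAC normrM (gtr0_norm t0) normr_sign mulr1//.
have -> : - (c * gam * sg / L2) * (- (c * gam * sg / L2) * b) =
    (c * gam / L2) ^+ 2 * b.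
  rewrite mulrA mulrNN (_ : _ * (c * gam * sg / L2) = (c * gam / L2) ^+ 2 * (sg * sg)).
    by rewrite sg2 mulr1.
  by ring.
have h : (c * gam / L2) ^+ 2 * b <= (c * gam / L2) ^+ 2 * - (c * gam).
  by rewrite ler_wpM2l ?sqr_ge0.
have E2 : (c * gam / L2) ^+ 2 * - (c * gam) / 2 + L2 / 3 * (c * gam / L2) ^+ 3 =
  - (c ^+ 3 * gam ^+ 3 / (6 * L2 ^+ 2)) by field; rewrite gt_eqF.
have E3 : - (c * gam * sg / L2) * a = sg * (- (c * gam / L2) * a) by ring.
rewrite E3; lra.
Qed.

Variables (psi : R -> R) (D : R) (N : nat).
Hypotheses (psi_ge0 : forall y, 0 <= y -> 0 <= psi y)
  (psi_mono : {homo psi : y z / y <= z})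
  (m_psi : measurable_fun setT psi) (D_ge0 : 0 <= D)
  (D_sgd : D <= eps ^+ 2 / (4 * L1))
  (psi_sign : forall y sg, `|sg| <= c * gam / L2 * (3 / 2 * eps) ->
    psi (y - c ^+ 3 * gam ^+ 3 / (6 * L2 ^+ 2) + D + sg) +
    psi (y - c ^+ 3 * gam ^+ 3 / (6 * L2 ^+ 2) + D - sg) <= 2 * psi y)
  (psi_N : 0 < psi (N%:R * D)).

(** [F x1 - Delta] is the lower bound of [F]. The normalization makes the value at the horizon [N]
    at least 1, so the initial value bounds the probability of surviving until then. *)
Definition potential (j : nat) x : R :=
  psi (F x - (F x1 - Delta) + j%:R * D) / psi (N%:R * D).

Let gap_ge0 x j : 0 <= F x - (F x1 - Delta) + j%:R * D.
Proof.
by rewrite addr_ge0 ?mulr_ge0//; have := problem_gap fP x; lra.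
Qed.

Lemma potential_ge0 j x : 0 <= potential j x.
Proof. by apply: divr_ge0; [exact/psi_ge0/gap_ge0|exact: ltW]. Qed.

Lemma potential_end x : 1 <= potential N x.
Proof.
rewrite ler_pdivlMr// mul1r psi_mono// lerDr.
by have := problem_gap fP x; lra.
Qed.

Lemma measurable_potential j : measurable_fun setT (potential j : rV -> R).
Proof.
apply: measurable_funM => //; apply: (measurableT_comp m_psi).
apply: measurable_funD => //; apply: measurable_funB => //.
exact: measurable_objective L1_gt0 fP.
Qed.

(** All randomness but the sign is fixed in [p]. Failing and stopping ignore the sign, so both
    branches are killed together or both survive. *)
Let next_psi x (p : n1.-tuple X * nc.-tuple X * (n2.-tuple X * T)) j (g : bool -> R) :
  (forall b, g b = if step_fails x (p, b) || step_stops x (p, b) then 0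
     else psi (F (next_point x (p, b)) - (F x1 - Delta) + j.+1%:R * D)) ->
  g true + g false <= 2 * psi (F x - (F x1 - Delta) + j%:R * D).
Proof.
have y0 := gap_ge0 x j; have p0 := psi_ge0 y0.
set y := F x - _ + _ in y0 p0 *; move=> gE.
have shift a q r : a <= F x - q + r ->
    a - (F x1 - Delta) + j.+1%:R * D <= y - q + D + r.
  rewrite /y -[j.+1%:R]natr1 mulrDl mul1r; move: (F x1) (j%:R * D) (F x) => F1 jD Fx.
  by lra.
have cf b : step_fails x (p, b) = step_fails x (p, true) by [].
have cs b : step_stops x (p, b) = step_stops x (p, true) by [].
rewrite !gE (cf false) (cs false).
have [_|] := boolP (step_fails x (p, true) || step_stops x (p, true)).
  by rewrite addr0 mulr_ge0.
rewrite negb_or => /andP[nf ns].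
have [m|nm] := boolP (first_order_met x (p, true)); last first.
  have h b : psi (F (next_point x (p, b)) - (F x1 - Delta) + j.+1%:R * D) <= psi y.
    apply: psi_mono; apply: (le_trans (shift _ _ 0 _)); last first.
      by rewrite addr0 -addrA gerDl addrC subr_le0; exact: D_sgd.
    by rewrite addr0; exact: (@sgd_move_le x (p, b) nf nm).
  by rewrite mulrDl mul1r lerD.
have [h1 hs] := @neon_move_le x (p, true) nf ns m.
have [h2 _] := @neon_move_le x (p, false) nf ns m.
have sE : slope x (p, false) = slope x (p, true) by [].
move: h1 h2; rewrite sE expr1 expr0 mul1r mulN1r => h1 h2.
apply: le_trans (psi_sign y hs); rewrite addrC.
by apply: lerD; apply: psi_mono; exact: shift.
Qed.

Lemma potential_step j x :
  (\int[seed_prob]_s (if step_fails x s || step_stops x s then 0%R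
     else potential j.+1 (next_point x s))%:E <= (potential j x)%:E)%E.
Proof.
have m_pair : measurable_fun setT (fun s : W => (x : rV, s)) by exact: measurable_fun_pair.
have mf : measurable_fun setT (step_fails x : W -> bool).
  exact: (measurableT_comp (measurable_step_fails L1_gt0 L2_gt0 fP eps certify neonP) m_pair).
have ms : measurable_fun setT (step_stops x : W -> bool).
  exact: (measurableT_comp (measurable_step_stops L1_gt0 L2_gt0 fP eps certify neonP) m_pair).
have mn : measurable_fun setT (next_point x : W -> rV).
  exact: (measurableT_comp (measurable_next_point L1_gt0 fP eps neonP) m_pair).
pose g s : R := if step_fails x s || step_stops x s then 0
     else potential j.+1 (next_point x s).
have g0 s : 0 <= g s by rewrite /g; case: ifP => // _; exact: potential_ge0.
have mg : measurable_fun setT (EFin \o g).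
  apply/measurable_EFinP; apply: measurable_fun_ifT => //; first exact: measurable_or.
  exact: (measurableT_comp (measurable_potential j.+1) mn).
pose Qp : probability _ R :=
  ((sample_law P n1 \x sample_law P nc) \x (sample_law P n2 \x mu))%E.
rewrite -(integral_probability_cst Qp (potential j x)).
(* Tonelli with the sign innermost, so that [next_psi] applies for each value of the other
   components. *)
rewrite [leLHS](fubini_tonelli1 _ mg); last by move=> s; rewrite lee_fin.
apply: ge0_le_integral => //.
- by move=> p _; apply: integral_ge0 => b _; rewrite lee_fin.
- exact: measurable_fun_fubini_tonelli_F.
move=> p _; rewrite /fubini_F integral_bernoulli_prob; last 2 first.
- lra.
- by move=> b; rewrite lee_fin.
rewrite /= -!EFinM -EFinD lee_fin.
have iN : 0 <= (psi (N%:R * D))^-1 by rewrite invr_ge0 ltW.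
have := @next_psi x p j _ (fun b => erefl); move/(ler_wpM2r iN).
rewrite mulrDl /unstable.onem.
have gE b : (if step_fails x (p, b) || step_stops x (p, b) then 0
    else psi (F (next_point x (p, b)) - (F x1 - Delta) + j.+1%:R * D)) /
    psi (N%:R * D) = g (p, b) by rewrite /g; case: ifP; rewrite ?mul0r.
rewrite !gE -mulrA -/(potential j x).
by move: (g (p, true)) (g (p, false)) (potential j x) => g1 g2 r; lra.
Qed.

End NeonMsgdDescent.

(** * Success probability *)

Definition bad_event (Z W O : Type) (next : Z -> W -> Z)
    (fail stop : Z -> W -> bool) (u : bool) (N : nat) (w : nat -> O -> W)
    (z : Z) : set O :=
  [set o | bad_run next fail stop u z (mkseq (w ^~ o) N)].

Section IidStoppedChain.
Context {R : realType} {dZ dW dO : measure_display} {Z : measurableType dZ}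
  {W : measurableType dW} {O : measurableType dO} (Q : probability W R)
  (Pr : probability O R).
Variables (next : Z -> W -> Z) (fail stop : Z -> W -> bool) (u : bool)
  (N : nat) (Phi : nat -> Z -> R) (pf : R) (w : nat -> O -> W) (z : Z).

Hypotheses (w_iid : iid Pr Q w)
  (m_next : measurable_fun setT (fun p : Z * W => next p.1 p.2))
  (m_fail : measurable_fun setT (fun p : Z * W => fail p.1 p.2))
  (m_stop : measurable_fun setT (fun p : Z * W => stop p.1 p.2)).
Local Open Scope ereal_scope.

Local Notation bad_event := (bad_event next fail stop u N w z).

Let bad_eventE : bad_event = first_samples w N @^-1`
  [set S : N.-tuple W | bad_run next fail stop u z S].
Proof.
apply/funext => o; rewrite /bad_event /preimage /=.
congr (is_true (bad_run _ _ _ _ _ _)).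
by rewrite /first_samples /= /mkseq -val_enum_ord -map_comp.
Qed.

Lemma measurable_bad_event : measurable bad_event.
Proof.
rewrite bad_eventE -[X in measurable X]setTI.
by apply: (measurable_first_samples w_iid) => //; exact: measurable_bad_run1.
Qed.

Lemma bad_event_le : (0 <= pf)%R -> (forall j z, (0 <= Phi j z)%R) ->
  (forall j, measurable_fun setT (Phi j)) ->
  (u -> forall z, (1 <= Phi N z)%R) ->
  (forall z, Q [set a | fail z a] <= pf%:E) ->
  (forall j z, \int[Q]_a (if fail z a || stop z a then 0%R
     else Phi j.+1 (next z a))%:E <= (Phi j z)%:E) ->
  Pr bad_event <= (N%:R * pf + Phi 0%N z)%:E.
Proof.
move=> pf0 Phi0 mPhi Phi_end fail_le Phi_step.
rewrite bad_eventE (iid_sample_law w_iid); last exact: measurable_bad_run1.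
exact: (bad_run_le m_next m_fail m_stop pf0 Phi0 mPhi Phi_end fail_le Phi_step).
Qed.

End IidStoppedChain.

Section NeonMsgdRuns.
Context {R : realType} {d : nat} {dX dT dO : measure_display}
  {X : measurableType dX} {T : measurableType dT} {O : measurableType dO}
  {n1 nc n2 : nat}.
Variables (P : probability X R) (f : 'rV[R]_d -> X -> R)
  (L1 L2 Delta G V : R) (x1 : 'rV[R]_d).
Hypotheses (L1_gt0 : 0 < L1) (L2_gt0 : 0 < L2) (G_gt0 : 0 < G)
  (fP : problem P f L1 L2 Delta G V x1).
Variables (eps gam c pfail : R) (mu : probability T R)
  (neon : 'rV[R]_d -> T -> prog R d n2 'rV[R]_d) (Tn : nat).
Hypotheses (eps_gt0 : 0 < eps) (gam_gt0 : 0 < gam) (c_gt0 : 0 < c)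
  (pfail_ge0 : 0 <= pfail)
  (neonP : neon_spec P f mu neon Tn gam c pfail).
Local Notation F := (objective P f).
Local Notation rV := (borel_rV R d).
Local Notation W := (seed n1 nc n2 X T).
Variables (Pr : probability O R) (w : nat -> O -> W).
Hypothesis w_iid : iid Pr (seed_law P mu) w.
Variables (psi : R -> R) (D : R) (N : nat) (pg delta C : R).
Hypotheses (psi_ge0 : forall y, 0 <= y -> 0 <= psi y)
  (psi_mono : {homo psi : y z / y <= z})
  (m_psi : measurable_fun setT psi) (D_ge0 : 0 <= D)
  (D_sgd : D <= eps ^+ 2 / (4 * L1))
  (psi_sign : forall y sg, `|sg| <= c * gam / L2 * (3 / 2 * eps) ->
    psi (y - c ^+ 3 * gam ^+ 3 / (6 * L2 ^+ 2) + D + sg) +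
    psi (y - c ^+ 3 * gam ^+ 3 / (6 * L2 ^+ 2) + D - sg) <= 2 * psi y)
  (psi_N : 0 < psi (N%:R * D))
  (pg_ge0 : 0 <= pg)
  (batch1 : forall x, (sample_law P n1 [set S | batch_fails P f eps x S] <= pg%:E)%E)
  (batchc : forall x, (sample_law P nc [set S | batch_fails P f eps x S] <= pg%:E)%E)
  (delta_ge : N%:R * (2 * pg + pfail) * 2 + psi Delta / psi (N%:R * D) <= delta)
  (cost_le : (N * (n1 + nc + Tn))%:R <= C).
Local Notation next_point := (next_point f L1 L2 eps gam c neon).
Local Notation returns_now := (returns_now f eps neon).
Local Notation step_fails := (step_fails P f eps gam c pfail mu neon).
Local Notation step_stops := (step_stops P f eps gam c pfail mu neon).
Local Notation alg := (msgd L1 : _ -> prog R d n1 _).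
Local Notation neonA := (neonA f L2 eps gam c alg neon x1).
Local Notation ssp := (second_order_stationary F (3 / 2 * eps) gam).
Local Notation stop_event certify := (bad_event next_point
  (step_fails certify) (step_stops certify) true N w x1 : set O).
Local Notation return_event := (bad_event next_point
  (step_fails false) returns_now false N w x1 : set O).

Let pf_ge0 : 0 <= 2 * pg + pfail.
Proof. by rewrite addr_ge0 ?mulr_ge0. Qed.

Let cost_bound o : (neonA (w ^~ o) N).2%:R <= C.
Proof.
apply: le_trans cost_le; rewrite ler_nat; apply: neonA_cost.
exact: (neon_ifo neonP).
Qed.

Let m_next : measurable_fun setT (fun p : rV * W => next_point p.1 p.2 : rV).
Proof. exact: (measurable_next_point L1_gt0 fP eps neonP). Qed.

Let m_fail certify : measurable_fun setT
  (fun p : rV * W => step_fails certify p.1 p.2).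
Proof. exact: (measurable_step_fails L1_gt0 L2_gt0 fP eps certify neonP). Qed.

Let m_stop certify : measurable_fun setT
  (fun p : rV * W => step_stops certify p.1 p.2).
Proof. exact: (measurable_step_stops L1_gt0 L2_gt0 fP eps certify neonP). Qed.

Let m_returns : measurable_fun setT (fun p : rV * W => returns_now p.1 p.2).
Proof. exact: (measurable_returns_now L1_gt0 fP eps neonP). Qed.

Let certify_false : false -> neon_certifies P f mu neon gam c pfail.
Proof. by []. Qed.

Lemma measurable_stop_event certify : measurable (stop_event certify).
Proof.
exact: (measurable_bad_event (Z := rV) (Q := seed_prob P mu) _ _ _ w_iid).
Qed.

Lemma stop_event_le (certify : bool) :
  (certify -> neon_certifies P f mu neon gam c pfail) ->
  (Pr (stop_event certify) <=
    (N%:R * (2 * pg + pfail) + psi Delta / psi (N%:R * D))%:E)%E.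
Proof.
move=> certP.
have -> : psi Delta / psi (N%:R * D) =
    potential P f Delta x1 psi D N 0 x1.
  by rewrite /potential mul0r addr0 opprB addrC subrK.
apply: (bad_event_le (Z := rV) (Q := seed_prob P mu)) => //.
- by move=> j x; apply: (potential_ge0 fP).
- by move=> j; apply: (measurable_potential L1_gt0 fP).
- by move=> _ x; apply: (potential_end fP).
- move=> x; apply: (step_fails_le L1_gt0 L2_gt0 fP pfail_ge0 neonP certP) => //.
- by move=> j x; apply: (potential_step L1_gt0 L2_gt0 fP certify eps_gt0 gam_gt0 c_gt0 neonP).
Qed.

(** The zero potential is admissible because the end of the horizon is not bad here; only failures
    count. *)
Lemma return_event_le :
  (Pr return_event <= (N%:R * (2 * pg + pfail))%:E)%E.
Proof.
rewrite -[X in X%:E]addr0.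
apply: (bad_event_le (Z := rV) (Q := seed_prob P mu) (Phi := fun _ _ => 0)) => //.
- move=> x; apply: (step_fails_le L1_gt0 L2_gt0 fP pfail_ge0 neonP certify_false) => //.
- move=> j x; rewrite integral0_eq// => s _; by case: ifP.
Qed.

(** A stop at a point that is no saddle does not end the algorithm, which may go on and return a
    later point. That point must be good as well, so failures before the return are excluded by a
    second event; this is the factor 2 in [delta_ge]. *)
Lemma neon_msgd_finds : with_probability Pr (1 - delta)
  [set o | neonA_finds f L2 eps gam c alg neon x1 (w ^~ o) N ssp /\
    (neonA (w ^~ o) N).2%:R <= C].
Proof.
have ms := measurable_stop_event false.
have mr : measurable return_event.
  exact: (measurable_bad_event (Z := rV) (Q := seed_prob P mu) _ _ _ w_iid).
exists (~` (stop_event false `|` return_event)); split.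
- by apply: measurableC; exact: measurableU.
- move=> o /= /not_orP[/negP h1 /negP h2]; split; last exact: cost_bound.
  rewrite /neonA_finds; case E : (neonA (w ^~ o) N).1 => [x|y].
    have [j [y [jN jy nf st]]] := run_reaches_stop
      (@returns_now_stops _ _ _ _ _ _ _ _ _ P f eps gam c pfail mu neon false) h1.
    exists j, y; split=> //.
      by exists y => //; rewrite output_msgd.
    exact: (step_stops_stationary eps_gt0 neonP nf st).
  have [s /andP[nf st]] := run_returns_safely h2 E.
  apply: (step_stops_stationary eps_gt0 neonP nf).
  exact: returns_now_stops.
rewrite probability_setC; last exact: measurableU.
rewrite EFinB; apply: leeB => //.
apply: (le_trans (measureU2 _ ms mr)).
apply: (le_trans (leeD (stop_event_le certify_false) return_event_le)).
rewrite -EFinD lee_fin; move: delta_ge; lra.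
Qed.

(** Under [certify] stopping is the same as returning, so one event suffices. *)
Lemma neon_msgd_returns : neon_certifies P f mu neon gam c pfail ->
  with_probability Pr (1 - delta)
  [set o | neonA_returns f L2 eps gam c alg neon x1 (w ^~ o) N ssp /\
    (neonA (w ^~ o) N).2%:R <= C].
Proof.
move=> cert; have ms := measurable_stop_event true.
exists (~` (stop_event true)); split.
- exact: measurableC.
- move=> o /= /negP h; split; last exact: cost_bound.
  have [j [y [jN jy nf st]]] := run_reaches_stop
    (@returns_now_stops _ _ _ _ _ _ _ _ _ P f eps gam c pfail mu neon true) h.
  exists y; last exact: (step_stops_stationary eps_gt0 neonP nf st).
  apply: (neonA_returned jN); rewrite (neonA_stepS jy) neonA_step_status.
  move: st; rewrite /step_stops /= orbF => st.
  by rewrite /returns_now st.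
rewrite probability_setC// EFinB; apply: leeB => //.
apply: (le_trans (stop_event_le (fun _ => cert))).
rewrite lee_fin; apply: le_trans delta_ge; rewrite lerD2r.
by rewrite ler_peMr ?mulr_ge0// ler1n.
Qed.

End NeonMsgdRuns.

(** * Choice of the constants *)

Section Potentials.
Context {R : realType}.
Implicit Types (m dec D y lam : R) (psi : R -> R).

(* Until it stops or fails, the process either gains [D] or gains [dec] up to a
   symmetric error bounded by [m]. *)
Definition drift_potential m dec D psi : Prop :=
  [/\ forall y, 0 <= y -> 0 <= psi y, {homo psi : y z / y <= z},
      measurable_fun setT psi &
      forall y sg, `|sg| <= m ->
        psi (y - dec + D + sg) + psi (y - dec + D - sg) <= 2 * psi y].

Lemma id_potential m dec D : D <= dec -> drift_potential m dec D id.
Proof. by move=> Ddec; split=> // y sg _ /=; lra. Qed.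

(** Averaging over the sign produces a hyperbolic cosine, at most [expR (2 * (lam * m) ^+ 2)], and
    the net drift contributes [expR (- (lam * (dec - D)))]; the hypothesis on [lam] says that their
    product is at most 1. *)
Lemma expR_potential m dec D lam : 0 < lam -> 2 * lam * m ^+ 2 <= dec - D ->
  drift_potential m dec D (fun y => expR (lam * y)).
Proof.
move=> l0 lm; split=> [y _|y z yz||y sg sgm]; first exact: expR_ge0.
- by rewrite ler_expR ler_pM2l.
- apply: measurableT_comp; first exact: measurable_expR.
  exact: measurable_funM.
have cosh_le (t : R) : expR t + expR (- t) <= 2 * expR (2 * t ^+ 2).
  by have := expR_le_sqr t; have := expR_le_sqr (- t); rewrite sqrrN; lra.
have E s : expR (lam * (y - dec + D + s)) =
    expR (lam * y) * expR (- (lam * (dec - D))) * expR (lam * s).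
  by rewrite -!expRD; congr expR; ring.
rewrite !E -mulrDr mulrN.
apply: (@le_trans _ _ (expR (lam * y) * expR (- (lam * (dec - D))) *
    (2 * expR (2 * (lam * sg) ^+ 2)))).
  by rewrite ler_wpM2l// mulr_ge0// expR_ge0.
rewrite (_ : _ * (2 * _) = 2 * expR (lam * y) *
    expR (- (lam * (dec - D)) + 2 * (lam * sg) ^+ 2)); last first.
  by rewrite expRD; ring.
apply: ler_piMr; first by rewrite mulr_ge0// expR_ge0.
rewrite -[leRHS]expR0 ler_expR addrC subr_le0.
have sg2 : sg ^+ 2 <= m ^+ 2.
  rewrite -[sg ^+ 2]real_normK ?num_real// ler_pXn2r ?nnegrE//.
  exact: le_trans sgm.
apply: (@le_trans _ _ (lam * (2 * lam * m ^+ 2))); last by rewrite ler_pM2l.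
rewrite (_ : 2 * _ = lam * (2 * lam * sg ^+ 2)); last by ring.
by rewrite ler_pM2l// ler_wpM2l// mulr_ge0// ltW.
Qed.

Lemma natr_above (x : R) : 0 <= x -> exists N : nat, x <= N%:R <= x + 1.
Proof.
move=> x0; exists (Num.truncn x).+1; rewrite ltW ?truncnS_gt//=.
by rewrite -natr1 lerD2r truncn_le.
Qed.

End Potentials.

Section Constants.
Context {R : realType}.
Implicit Types (eps gam delta l M : R).

Lemma ler_exprn_expR l n : 0 <= l -> l ^+ n <= expR (l * n%:R).
Proof.
move=> l0; rewrite expRM_natr lerXn2r ?nnegrE ?expR_ge0//.
by have := expR_ge1Dx l; lra.
Qed.

Section Scales.
Variables (eps gam delta : R).
Hypotheses (eps01 : 0 < eps <= 1) (gam01 : 0 < gam <= 1) (delta01 : 0 < delta < 1).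
Local Notation l := (log_factor eps gam delta).
Local Notation M := (Num.max (1 / eps ^+ 2) (1 / gam ^+ 3)).

Let eps_gt0 : 0 < eps. Proof. by case/andP: eps01. Qed.
Let gam_gt0 : 0 < gam. Proof. by case/andP: gam01. Qed.
Let delta_gt0 : 0 < delta. Proof. by case/andP: delta01. Qed.
Let eps_le1 : eps <= 1. Proof. by case/andP: eps01. Qed.
Let gam_le1 : gam <= 1. Proof. by case/andP: gam01. Qed.
Let delta_le1 : delta <= 1. Proof. by case/andP: delta01 => _ /ltW. Qed.
Let r := (eps * gam * delta)^-1.

Let egd_gt0 : 0 < eps * gam * delta. Proof. by rewrite !mulr_gt0. Qed.

Let egd_le1 : eps * gam * delta <= 1.
Proof. by rewrite mulr_ile1 ?mulr_ge0 ?mulr_ile1// ltW. Qed.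

Lemma log_factor_ge1 : 1 <= l.
Proof. by rewrite lerDl ln_ge0// -invr1 lef_pV2 ?posrE. Qed.

Let expR_l : r <= expR l.
Proof. by rewrite -[r]lnK ?posrE ?invr_gt0// ler_expR lerDr. Qed.

(** The summand 1 in [log_factor] absorbs ln 2. *)
Lemma ln_confidence_le : ln (2 / delta) <= l.
Proof.
have d1 : ln delta^-1 <= ln r.
  rewrite ler_ln ?posrE ?invr_gt0// lef_pV2 ?posrE//.
  by rewrite ler_piMl ?mulr_ile1// ltW.
have l2 : ln 2 <= 1 :> R.
  by have := @le_ln1Dx R 1; rewrite -(natrD _ 1 1); apply; lra.
by rewrite lnM ?posrE ?invr_gt0// /log_factor -/r lerD.
Qed.

Lemma max_scale_ge1 : 1 <= M.
Proof.
by rewrite le_max div1r invf_ge1 ?exprn_gt0// exprn_ile1// ltW.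
Qed.

(** The largest power among eps^-2, gam^-3 and delta^-2 is 3, and [l] exceeds the logarithm of
    1/(eps gam delta). *)
Lemma max_scale_confidence_le : M / delta / delta <= expR (l * 3%:R).
Proof.
apply: (@le_trans _ _ (r ^+ 3)); last first.
  by rewrite expRM_natr lerXn2r ?nnegrE ?expR_ge0// invr_ge0 ltW.
have inv_ge1 x : 0 < x -> x <= 1 -> 1 <= x^-1 :> R.
  by move=> x0 x1; rewrite -invr1 lef_pV2 ?posrE.
have p1 := inv_ge1 _ eps_gt0 eps_le1; have g1 := inv_ge1 _ gam_gt0 gam_le1.
have e1 := inv_ge1 _ delta_gt0 delta_le1.
rewrite /r !div1r -!exprVn (invfM (eps * gam)) (invfM eps) -mulrA -expr2.
set p := eps^-1 in p1 *; set g := gam^-1 in g1 *; set e := delta^-1 in e1 *.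
have p0 : 0 <= p := le_trans ler01 p1; have g0 : 0 <= g := le_trans ler01 g1.
have e0 : 0 <= e := le_trans ler01 e1.
rewrite !exprMn ler_pM ?exprn_ge0//.
- by rewrite le_max exprn_ge0.
- rewrite ge_max; apply/andP; split.
    rewrite (le_trans (ler_weXn2l p1 (leqnSn 2)))// ler_peMr ?exprn_ge0//.
    exact: exprn_ege1.
  by rewrite ler_peMl ?exprn_ge0// exprn_ege1.
exact: ler_weXn2l.
Qed.

End Scales.
End Constants.

(** * Drift, potential and number of iterations *)

Section Budget.
Context {R : realType}.
Variables (L1 L2 Delta kap eps gam delta c : R) (pc : nat).
Hypotheses (L1_gt0 : 0 < L1) (L2_gt0 : 0 < L2) (Delta_ge0 : 0 <= Delta)
  (kap_ge0 : 0 <= kap) (eps01 : 0 < eps <= 1) (gam01 : 0 < gam <= 1)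
  (delta01 : 0 < delta < 1) (c_gt0 : 0 < c).
Local Notation l := (log_factor eps gam delta).
Hypothesis c_ge : c^-1 <= kap * l ^+ pc.
Local Notation M := (Num.max (1 / eps ^+ 2) (1 / gam ^+ 3)).

(* The drift per iteration is [(A l^(3 pc) M)^-1] with this constant [A]. *)
Definition drift_constant (L1 L2 kap : R) : R := 12 * L2 ^+ 2 * kap ^+ 3 + 4 * L1.

(** Large enough for both regimes of [potential_exists]; [54 * kap] stems from the inverse 54/c of
    the exponential rate. *)
Definition iteration_constant (L1 L2 Delta kap : R) : R :=
  2 * (Delta + 54 * kap + 1) * (drift_constant L1 L2 kap + 1).

Local Notation A := (drift_constant L1 L2 kap).
Local Notation K1 := (iteration_constant L1 L2 Delta kap).

Let eps_gt0 : 0 < eps. Proof. by case/andP: eps01. Qed.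
Let gam_gt0 : 0 < gam. Proof. by case/andP: gam01. Qed.
Let delta_gt0 : 0 < delta. Proof. by case/andP: delta01. Qed.
Let delta_le1 : delta <= 1. Proof. by case/andP: delta01 => _ /ltW. Qed.
Let l_ge1 : 1 <= l. Proof. exact: log_factor_ge1. Qed.
Let l_ge0 : 0 <= l. Proof. exact: le_trans l_ge1. Qed.
Let M_ge1 : 1 <= M. Proof. exact: max_scale_ge1. Qed.

Let drift : R := (A * l ^+ (3 * pc) * M)^-1.
Let dec : R := c ^+ 3 * gam ^+ 3 / (6 * L2 ^+ 2).

Let ln_ge1 n : 1 <= l ^+ n. Proof. exact: exprn_ege1. Qed.

Lemma drift_constant_gt0 : 0 < A.
Proof. by rewrite ltr_wpDl ?mulr_gt0// !mulr_ge0 ?exprn_ge0// ltW. Qed.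

Let drift_inv_gt0 : 0 < A * l ^+ (3 * pc) * M.
Proof.
by rewrite !mulr_gt0 ?drift_constant_gt0 ?(lt_le_trans ltr01).
Qed.

Let drift_gt0 : 0 < drift. Proof. by rewrite invr_gt0. Qed.

Let drift_sgd : drift <= eps ^+ 2 / (4 * L1).
Proof.
rewrite -[leRHS]invrK lef_pV2 ?posrE//; last first.
  by rewrite invr_gt0 divr_gt0 ?exprn_gt0 ?mulr_gt0.
rewrite invf_div; apply: ler_pM.
- by rewrite mulr_ge0// ltW.
- by rewrite invr_ge0 exprn_ge0// ltW.
- apply: (@le_trans _ _ A); last by rewrite ler_peMr// ltW ?drift_constant_gt0.
  by rewrite lerDr !mulr_ge0 ?exprn_ge0// ltW.
by rewrite le_max div1r lexx.
Qed.

(** The other half of [dec] is kept to pay for the random sign in the exponential potential. *)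
Let drift_neon : drift <= dec / 2.
Proof.
rewrite -[leRHS]invrK lef_pV2 ?posrE//; last first.
  by rewrite invr_gt0 !divr_gt0 ?mulr_gt0 ?exprn_gt0.
have -> : (dec / 2)^-1 = 12 * L2 ^+ 2 * (c^-1) ^+ 3 * (gam ^+ 3)^-1.
  by rewrite /dec; field; rewrite !gt_eqF.
apply: ler_pM.
- by rewrite !mulr_ge0 ?exprn_ge0 ?invr_ge0 ?ltW.
- by rewrite invr_ge0 exprn_ge0// ltW.
- apply: (@le_trans _ _ (12 * L2 ^+ 2 * kap ^+ 3 * l ^+ (3 * pc))).
    rewrite -[leRHS]mulrA ler_wpM2l ?mulr_ge0 ?exprn_ge0 ?(ltW L2_gt0)//.
    rewrite mulnC exprM -exprMn.
    by rewrite lerXn2r ?nnegrE ?invr_ge0 ?mulr_ge0 ?exprn_ge0// ltW.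
  by rewrite ler_wpM2r ?exprn_ge0// lerDl mulr_ge0// ltW.
by rewrite le_max [1 / gam ^+ 3]div1r lexx orbT.
Qed.

Lemma iteration_constant_ge1 : 1 <= K1.
Proof.
rewrite /iteration_constant -mulrA.
have A0 := drift_constant_gt0.
suff : 1 * 1 <= (Delta + 54 * kap + 1) * (A + 1) by lra.
by apply: ler_pM => //; have := Delta_ge0; have := kap_ge0; lra.
Qed.

Lemma potential_exists : exists (psi : R -> R) (D : R) (N : nat),
  [/\ drift_potential (c * gam / L2 * (3 / 2 * eps)) dec D psi,
      0 <= D <= eps ^+ 2 / (4 * L1), 0 < psi (N%:R * D),
      psi Delta / psi (N%:R * D) <= delta / 2 &
      N%:R <= bound_constant K1 eps gam delta * l ^+ (4 * pc).+1 * M].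
Proof.
have A0 := drift_constant_gt0.
have T1 : 1 <= l ^+ (4 * pc).+1 * M by apply: mulr_ege1.
have T0 := le_trans ler01 T1.
have expE : l ^+ (4 * pc).+1 * M = l ^+ pc.+1 * (l ^+ (3 * pc) * M).
  by rewrite mulrA -exprD addSn -mulSn.
have K1E : K1 = 2 * (Delta + 54 * kap + 1) * (A + 1) by [].
rewrite /bound_constant; case: ifP => eg.
- have lam0 : 0 < c / 54 by rewrite divr_gt0.
  (* The product of [c / 54] and [N%:R * drift - Delta] must reach ln(2/delta), which is at most
     [l]; as 54/c is at most [54 * kap * l ^+ pc], a total drift of [Q] is enough. *)
  pose Q := Delta + 54 * kap * l ^+ pc.+1.
  have Q0 : 0 <= Q by rewrite addr_ge0// !mulr_ge0 ?exprn_ge0.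
  have [|N /andP[N1 N2]] := @natr_above R (Q / drift).
    by rewrite divr_ge0// ltW.
  exists (fun y => expR (c / 54 * y)), drift, N; split.
  (* With [lam = c / 54], [2 lam m^2] is [eps^2 / gam] times [dec / 2]. *)
  + apply: expR_potential => //.
    apply: (@le_trans _ _ (dec / 2)); last by move: drift_neon; lra.
    have -> : 2 * (c / 54) * (c * gam / L2 * (3 / 2 * eps)) ^+ 2 =
        c ^+ 3 * gam ^+ 2 / (12 * L2 ^+ 2) * eps ^+ 2.
      by field; rewrite gt_eqF.
    have -> : dec / 2 = c ^+ 3 * gam ^+ 2 / (12 * L2 ^+ 2) * gam.
      by rewrite /dec; field; rewrite gt_eqF.
    by rewrite ler_wpM2l// divr_ge0// !mulr_ge0 ?exprn_ge0 ?ltW.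
  + by rewrite ltW//; exact: drift_sgd.
  + exact: expR_gt0.
  + rewrite -expRN -expRD -[leRHS]lnK ?posrE ?divr_gt0// ler_expR.
    have -> : ln (delta / 2) = - ln (2 / delta).
      by rewrite -lnV ?posrE ?divr_gt0// invf_div.
    rewrite -mulrN -mulrDr -[_ - _]opprB mulrN lerN2.
    apply: (le_trans (ln_confidence_le eps01 gam01 delta01)).
    rewrite -ler_pdivrMl// invf_div.
    have ND : Q <= N%:R * drift by rewrite -ler_pdivrMr.
    apply: (@le_trans _ _ (Q - Delta)); last by rewrite lerB.
    rewrite /Q addrC addKr exprSr mulrA ler_wpM2r//.
    by rewrite -mulrA ler_wpM2l.
  apply: (le_trans N2); rewrite /drift invrK.
  have hQ : Q <= (Delta + 54 * kap) * l ^+ pc.+1 by rewrite mulrDl lerD2r ler_peMr.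
  have h : Q * (A * l ^+ (3 * pc) * M) <= (Delta + 54 * kap) * A * (l ^+ (4 * pc).+1 * M).
    apply: (le_trans (ler_wpM2r (ltW drift_inv_gt0) hQ)).
    by rewrite expE le_eqVlt; apply/orP; left; apply/eqP; ring.
  apply: (le_trans (lerD h T1)); rewrite -[leRHS]mulrA K1E.
  set T := l ^+ _ * M in T0 *.
  apply: (@le_trans _ _ (((Delta + 54 * kap) * A + 1) * T)); first by rewrite [leRHS]mulrDl mul1r.
  rewrite ler_wpM2r//; have q0 : 0 <= Delta + 54 * kap by rewrite addr_ge0 ?mulr_ge0.
  by have := mulr_ge0 q0 (ltW A0); move: q0 A0; set q := Delta + _; set B := A; nra.
have d0 := ltW delta_gt0.
(* The identity potential needs [Delta / (N%:R * drift) <= delta / 2]. Aiming at [Delta + 1] keeps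
   the denominator positive when [Delta] is 0. *)
have [|N /andP[N1 N2]] := @natr_above R (2 * (Delta + 1) / delta / drift).
  by rewrite !divr_ge0 ?mulr_ge0 ?addr_ge0// ltW.
have ND : 2 * (Delta + 1) / delta <= N%:R * drift by rewrite -ler_pdivrMr.
have ND0 : 0 < N%:R * drift.
  by apply: lt_le_trans ND; rewrite divr_gt0// mulr_gt0// ltr_wpDl.
exists id, drift, N; split=> //.
- by apply: id_potential; move: drift_neon drift_gt0; lra.
- by rewrite ltW//; exact: drift_sgd.
- rewrite ler_pdivrMr// mulrC -ler_pdivrMr ?divr_gt0//.
  apply: le_trans ND; rewrite invf_div mulrA ler_wpM2r ?invr_ge0//.
  by have := Delta_ge0; lra.
apply: (le_trans N2); rewrite /drift invrK.
have h : 2 * (Delta + 1) / delta * (A * l ^+ (3 * pc) * M) <=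
    2 * (Delta + 1) * A * (l ^+ (4 * pc).+1 * M / delta).
  apply: (@le_trans _ _ (2 * (Delta + 1) * A / delta * (l ^+ (3 * pc) * M))).
    by rewrite le_eqVlt; apply/orP; left; apply/eqP; ring.
  apply: (@le_trans _ _ (2 * (Delta + 1) * A / delta * (l ^+ (4 * pc).+1 * M))).
    rewrite ler_wpM2l//; first by rewrite divr_ge0// mulr_ge0 ?(ltW A0)// mulr_ge0// addr_ge0.
    by rewrite expE ler_peMl ?mulr_ge0 ?exprn_ge0// (le_trans ler01).
  by rewrite le_eqVlt; apply/orP; left; apply/eqP; ring.
have T2 : 1 <= l ^+ (4 * pc).+1 * M / delta.
  by rewrite mulr_ege1// -invr1 lef_pV2 ?posrE.
apply: (le_trans (lerD h T2)); 
rewrite (_ : K1 / delta * _ * M = K1 * (l ^+ (4 * pc).+1 * M / delta)); last by ring.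
rewrite K1E.
set T := l ^+ _ * M / delta in T2 *.
apply: (@le_trans _ _ ((2 * (Delta + 1) * A + 1) * T)); first by rewrite [leRHS]mulrDl mul1r.
rewrite ler_wpM2r ?(le_trans ler01 T2)//.
have := mulr_ge0 Delta_ge0 (ltW A0); have := mulr_ge0 kap_ge0 (ltW A0).
by move: A0 kap_ge0 Delta_ge0; set B := A; nra.
Qed.

End Budget.

(** * Batch sizes against the union bound *)

Section Sampling.
Context {R : realType}.

(* The terms absorb [M / delta^2], [l ^+ p] and the constant factor of the number
   of failures, in this order. *)
Definition sampling_rate (d p : nat) (K : R) : R := 3 + p%:R + 32 * d.+1%:R * K.

(** A batch of at least this constant times [l / eps ^+ 2] makes the exponent in [batch_fails_le] at
    least [sampling_rate d p K * l]. *)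
Definition sampling_constant (d p : nat) (G K : R) : R :=
  384 * d.+1%:R ^+ 2 * (G + 1) ^+ 2 * sampling_rate d p K.

Lemma bound_constant_le (K eps gam delta : R) : 0 <= K -> 0 < delta <= 1 ->
  bound_constant K eps gam delta <= K / delta.
Proof.
move=> K0 /andP[d0 d1]; rewrite /bound_constant; case: ifP => // _.
by rewrite ler_peMr// -invr1 lef_pV2 ?posrE.
Qed.

Lemma bound_constant_ge (K eps gam delta : R) : 0 <= K -> 0 < delta <= 1 ->
  K <= bound_constant K eps gam delta.
Proof.
move=> K0 /andP[d0 d1]; rewrite /bound_constant; case: ifP => // _.
by rewrite ler_peMr// -invr1 lef_pV2 ?posrE.
Qed.

Lemma bound_constantM (a K eps gam delta : R) :
  bound_constant (a * K) eps gam delta = a * bound_constant K eps gam delta.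
Proof. by rewrite /bound_constant; case: ifP; rewrite ?mulrA. Qed.

(** The number of iterations is polynomial in 1/eps, 1/gam and 1/delta up to powers of [l], while
    the failure probability is exponentially small in [l]; hence even the factor 1/delta of the
    second regime costs only a constant in the rate. *)
Lemma sampling_failures_le (d p N : nat) (K eps gam delta : R) :
  0 <= K -> 0 < eps <= 1 -> 0 < gam <= 1 -> 0 < delta < 1 ->
  let l := log_factor eps gam delta in
  N%:R <= bound_constant K eps gam delta * l ^+ p *
    Num.max (1 / eps ^+ 2) (1 / gam ^+ 3) ->
  N%:R * (d.+1%:R * 2 * expR (- (sampling_rate d p K * l))) * 16 <= delta.
Proof.
move=> K0 eps01 gam01 delta01 l; set M := Num.max _ _ => NK.
have l1 : 1 <= l := log_factor_ge1 eps01 gam01 delta01.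
have l0 := le_trans ler01 l1.
have M1 : 1 <= M := max_scale_ge1 gam eps01.
have M0 := le_trans ler01 M1.
have [d0 d1] : 0 < delta /\ delta <= 1 by case/andP: delta01 => ? /ltW.
have NK' : N%:R <= K / delta * l ^+ p * M.
  apply: (le_trans NK); rewrite !ler_wpM2r ?exprn_ge0//.
  by apply: bound_constant_le => //; rewrite d0.
set x := 32 * d.+1%:R * K; have x0 : 0 <= x by rewrite mulr_ge0.
set e := expR _; have e0 : 0 < e := expR_gt0 _.
apply: (@le_trans _ _ (K / delta * l ^+ p * M * (d.+1%:R * 2 * e) * 16)).
  by rewrite ler_wpM2r// ler_wpM2r// mulr_ge0// ltW.
have -> : K / delta * l ^+ p * M * (d.+1%:R * 2 * e) * 16 =
    delta * (x * (l ^+ p * (M / delta / delta) * e)).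
  by rewrite /x; field; rewrite gt_eqF.
apply: ler_piMr; first exact: ltW.
apply: (@le_trans _ _ (x * (expR (l * p%:R) * expR (l * 3%:R) * e))).
  apply: ler_wpM2l => //; apply: ler_wpM2r; first exact: ltW.
  apply: ler_pM.
  - exact: exprn_ge0.
  - by rewrite !divr_ge0// ltW.
  - exact: ler_exprn_expR.
  exact: max_scale_confidence_le.
rewrite /e -!expRD (_ : _ + _ = - (x * l)); last first.
  by rewrite /sampling_rate -/x; ring.
rewrite expRN ler_pdivrMr ?expR_gt0// mul1r.
have xl : x <= x * l by rewrite ler_peMr.
by have := expR_ge1Dx (x * l); lra.
Qed.

Lemma batch_size_le (a b eps l : R) (q n : nat) : 0 <= l ->
  batch_size a b q l eps n -> n%:R <= `|b| * l ^+ q * (1 / eps ^+ 2).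
Proof.
move=> l0 /andP[_ h]; apply: (le_trans h); rewrite div1r ler_wpM2r ?invr_ge0 ?sqr_ge0//.
by rewrite ler_wpM2r ?exprn_ge0// ler_norm.
Qed.

End Sampling.

(** The constant [a] precedes [b] and [q]: it depends only on the data that fix the number of
    iterations and on the noise. The upper bounds on the batches enter later, through the cost of an
    iteration. *)
Theorem corollary6 (R : realType) (d : nat) (L1 L2 Delta G V kc : R) (pc : nat)
    (L1_gt0 : 0 < L1) (L2_gt0 : 0 < L2) (G_gt0 : 0 < G) (V_gt0 : 0 < V) :
  exists2 a : R, 0 < a & forall (b : R) (q : nat),
  exists (K : R) (p : nat), 0 < K /\
  forall (dX : measure_display) (X : measurableType dX) (P : probability X R)
    (f : 'rV[R]_d -> X -> R) (x1 : 'rV[R]_d),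
  problem P f L1 L2 Delta G V x1 ->
  forall (eps gam delta c : R) (n1 nc : nat),
  0 < eps <= 1 -> 0 < gam <= 1 -> 0 < delta < 1 ->
  let l := log_factor eps gam delta in
  0 < c -> c^-1 <= kc * l ^+ pc ->
  batch_size a b q l eps n1 -> batch_size a b q l eps nc ->
  let alg : 'rV[R]_d -> prog R d n1 ('rV[R]_d * 'rV[R]_d) := msgd L1 in
  [/\ forall (x : 'rV[R]_d) (S1 : n1.-tuple X),
        (ifo f (alg x) S1)%:R <= K * l ^+ p * (1 / eps ^+ 2),
      decrease_guarantee P f alg eps (eps ^+ 2 / (4 * L1)) &
      let B := bound_constant K eps gam delta * l ^+ p *
               Num.max (1 / eps ^+ 2) (1 / gam ^+ 3) in
      forall (n2 : nat) (dT : measure_display) (T : measurableType dT)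
        (mu : probability T R) (neon : 'rV[R]_d -> T -> prog R d n2 'rV[R]_d)
        (Tn : nat),
      neon_spec P f mu neon Tn gam c (delta / B) ->
      forall (dO : measure_display) (O : measurableType dO)
        (Pr : probability O R) (w : nat -> O -> seed n1 nc n2 X T),
      iid Pr (seed_law P mu) w ->
      let neon_msgd (o : O) := neonA f L2 eps gam c alg neon x1 (w ^~ o) in
      let finds (o : O) := neonA_finds f L2 eps gam c alg neon x1 (w ^~ o) in
      let returns (o : O) :=
        neonA_returns f L2 eps gam c alg neon x1 (w ^~ o) in
      let ssp := second_order_stationary (objective P f) (3 / 2 * eps) gam in
      exists N : nat,
        with_probability Pr (1 - delta)
          [set o | finds o N ssp /\
             (neon_msgd o N).2%:R <= B * (Tn%:R + 1 / eps ^+ 2)] /\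
        (neon_certifies P f mu neon gam c (delta / B) ->
         with_probability Pr (1 - delta)
          [set o | returns o N ssp /\
             (neon_msgd o N).2%:R <= B * (Tn%:R + 1 / eps ^+ 2)])].
Proof.
(* [Delta] and [kc] have no sign yet; absolute values make the constant at least 1 in any case, and
   [problem] later implies that [Delta] is nonnegative. *)
have [K1 K1E] : exists K1 : R, K1 = iteration_constant L1 L2 `|Delta| `|kc| by eexists.
pose p1 := (4 * pc).+1.
have K1_ge1 : 1 <= K1 by rewrite K1E; apply: iteration_constant_ge1.
have K1_ge0 := le_trans ler01 K1_ge1.
have rate1 : 1 <= sampling_rate d p1 K1.
  have : 0 <= 32 * d.+1%:R * K1 by rewrite mulr_ge0.
  by have : 0 <= p1%:R :> R by []; rewrite /sampling_rate; lra.
have rate0 := lt_le_trans ltr01 rate1.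
have G1 : 0 < G + 1 by rewrite addr_gt0.
have s0 : 0 < 384 * d.+1%:R ^+ 2 * (G + 1) ^+ 2 
  by apply: mulr_gt0; [apply: mulr_gt0; [rewrite ltr0n|]|]; rewrite ?exprn_gt0.
exists (sampling_constant d p1 G K1); first exact: mulr_gt0.
(* [2 * |b| + 1] covers two batches and one NEON call per iteration, and the 8 gives
   [N%:R * 8 <= B], so that NEON failures of probability [delta / B] add up to at most delta/8. *)
move=> b q; exists (8 * (2 * `|b| + 1) * K1), (p1 + q)%N.
have b0 := normr_ge0 b.
have b1_gt0 : 0 < 2 * `|b| + 1 by rewrite ltr_wpDl// mulr_ge0.
split; first by rewrite !mulr_gt0// (lt_le_trans ltr01 K1_ge1).
move=> dX X P f x1 fP eps gam delta c n1 nc eps01 gam01 delta01 l c_gt0 c_ge nb1 nbc alg.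
have [eps0 eps1] := andP eps01; have [gam0 gam1] := andP gam01.
have [d0 d1'] := andP delta01; have d1 := ltW d1'.
have l1 : 1 <= l := log_factor_ge1 eps01 gam01 delta01.
have l0 := le_trans ler01 l1.
have ln1 n : 1 <= l ^+ n by exact: exprn_ege1.
have ln0 n : 0 <= l ^+ n by exact: exprn_ge0.
set M := Num.max _ _.
have M1 : 1 <= M := max_scale_ge1 gam eps01.
have M0 := le_trans ler01 M1.
have eps2 : 0 < eps ^+ 2 by rewrite exprn_gt0.
have n_large n : batch_size (sampling_constant d p1 G K1) b q l eps n ->
    (0 < n)%N /\ sampling_constant d p1 G K1 * l <= n%:R * eps ^+ 2.
  move=> /andP[h _]; split; last by rewrite -ler_pdivrMr.
  rewrite -(ltr0n R); apply: lt_le_trans h.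
  by rewrite divr_gt0// mulr_gt0 ?(lt_le_trans ltr01 l1)// mulr_gt0.
have [n1_gt0 n1_large] := n_large _ nb1; have [nc_gt0 nc_large] := n_large _ nbc.
have n1_le := batch_size_le l0 nb1; have nc_le := batch_size_le l0 nbc.
split.
- move=> x S1; rewrite ifo_msgd (le_trans n1_le)//.
  rewrite ler_wpM2r ?divr_ge0 ?(ltW eps2)// exprD mulrA ler_wpM2r//.
  apply: (@le_trans _ _ (8 * (2 * `|b| + 1) * K1)).
    apply: (@le_trans _ _ (8 * (2 * `|b| + 1))); first lra.
    by rewrite ler_peMr// mulr_ge0// addr_ge0// mulr_ge0.
  by rewrite ler_peMr// !mulr_ge0// addr_ge0// mulr_ge0.
- apply: (msgd_decrease L1_gt0 G_gt0 fP) => //.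
  have n0 : 0 < n1%:R :> R by rewrite ltr0n.
  rewrite ler_pdivrMr//.
  suff h : 384 * d%:R * (G + 1) ^+ 2 <= sampling_constant d p1 G K1 * l.
    by move: (le_trans h n1_large); lra.
  apply: (@le_trans _ _ (384 * d.+1%:R ^+ 2 * (G + 1) ^+ 2)).
    apply: ler_wpM2r; first exact: sqr_ge0.
    apply: ler_wpM2l; first by rewrite ler0n.
    apply: (@le_trans _ _ d.+1%:R); first by rewrite ler_nat.
    by rewrite expr2 ler_peMr// ler1n.
  by rewrite /sampling_constant -[leRHS]mulrA ler_peMr ?(ltW s0)// mulr_ege1.
move=> B n2 dT T mu neon Tn neonP dO O Pr w w_iid neon_msgd finds returns ssp.
have Delta0 : 0 <= Delta by have := problem_gap fP x1; rewrite subrr.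
have c_ge' : c^-1 <= `|kc| * l ^+ pc.
  by rewrite (le_trans c_ge)// ler_wpM2r// ler_norm.
have [psi [D [N [[psi0 psi_mono m_psi psi_sign] /andP[D0 D_sgd] psi_N psi_end N_le]]]] :=
  potential_exists L1_gt0 L2_gt0 Delta0 (normr_ge0 kc) eps01 gam01 delta01 c_gt0 c_ge'.
have KE : iteration_constant L1 L2 Delta `|kc| = K1 by rewrite K1E (ger0_norm Delta0).
rewrite KE -/p1 -/M -/l in N_le.
have BE : B = 8 * (2 * `|b| + 1) * l ^+ q *
    (bound_constant K1 eps gam delta * l ^+ p1 * M).
  by rewrite /B bound_constantM exprD; ring.
have N0 : 0 <= N%:R :> R by [].
have b1 : 1 <= (2 * `|b| + 1) * l ^+ q.
  by rewrite mulr_ege1// lerDr mulr_ge0.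
set T0 := bound_constant K1 eps gam delta * _ * _ in BE N_le.
have T0_gt0 : 0 < T0.
  rewrite !mulr_gt0 ?(lt_le_trans ltr01)//.
  by rewrite (le_trans K1_ge1)// bound_constant_ge// d0.
have B_ge : 8 * T0 <= B.
  by rewrite BE -mulrA -mulrA ler_wpM2l// mulrA ler_peMl// ltW.
have NB : N%:R * 8 <= B by move: N_le B_ge; lra.
have B0 : 0 < B by move: T0_gt0 B_ge; lra.
have pfail0 : 0 <= delta / B by rewrite divr_ge0// ltW.
pose pg := d.+1%:R * 2 * expR (- (sampling_rate d p1 K1 * l)).
have pg0 : 0 <= pg by rewrite mulr_ge0// expR_ge0.
have Npg : N%:R * pg * 16 <= delta.
  exact: (sampling_failures_le d K1_ge0 eps01 gam01 delta01 N_le).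
have batch n x : (0 < n)%N -> sampling_constant d p1 G K1 * l <= n%:R * eps ^+ 2 ->
    (sample_law P n [set S | batch_fails P f eps x S] <= pg%:E)%E.
  move=> n0 nl; apply: (le_trans (batch_fails_le L1_gt0 G_gt0 fP eps0 x n0 eps1)).
  rewrite lee_fin ler_wpM2l// ler_expR lerN2 ler_pdivlMr//.
  by apply: le_trans nl; rewrite mulrC mulrA.
(* The budget is exact: mini-batches take at most delta/4, NEON calls delta/4, and running until the
   horizon delta/2. *)
have delta_ge : N%:R * (2 * pg + delta / B) * 2 + psi Delta / psi (N%:R * D) <= delta.
  have : N%:R * (delta / B) * 8 <= delta.
    by rewrite mulrAC mulrCA mulrA ler_pdivrMr// ler_wpM2l// ltW.
  rewrite mulrDr; move: psi_end Npg; lra.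
have cost_le : (N * (n1 + nc + Tn))%:R <= B * (Tn%:R + 1 / eps ^+ 2).
  have E0 : 0 <= 1 / eps ^+ 2 by rewrite divr_ge0// ltW.
  have Tn0 : 0 <= Tn%:R :> R by [].
  have step_cost : n1%:R + nc%:R + Tn%:R <=
      (2 * `|b| + 1) * l ^+ q * (Tn%:R + 1 / eps ^+ 2).
    apply: (@le_trans _ _ (2 * `|b| * l ^+ q * (1 / eps ^+ 2) + Tn%:R)).
      by move: n1_le nc_le; lra.
    rewrite mulrDr [leRHS]addrC; apply: lerD; last by rewrite ler_peMl.
    by rewrite ler_wpM2r// ler_wpM2r// lerDl.
  rewrite natrM !natrD; apply: (@le_trans _ _
      (T0 * ((2 * `|b| + 1) * l ^+ q * (Tn%:R + 1 / eps ^+ 2)))).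
    by apply: ler_pM; rewrite ?addr_ge0.
  rewrite mulrA ler_wpM2r ?addr_ge0//.
  have : 0 <= T0 * ((2 * `|b| + 1) * l ^+ q).
    by rewrite mulr_ge0 ?(ltW T0_gt0)// (le_trans ler01).
  by rewrite BE; lra.
exists N; split.
  exact: (neon_msgd_finds L1_gt0 L2_gt0 fP eps0 gam0 c_gt0 pfail0 neonP w_iid psi0
    psi_mono m_psi D0 D_sgd psi_sign psi_N pg0 (fun x => batch n1 x n1_gt0 n1_large)
    (fun x => batch nc x nc_gt0 nc_large) delta_ge cost_le).
exact: (neon_msgd_returns L1_gt0 L2_gt0 fP eps0 gam0 c_gt0 pfail0 neonP w_iid psi0
    psi_mono m_psi D0 D_sgd psi_sign psi_N pg0 (fun x => batch n1 x n1_gt0 n1_large)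
    (fun x => batch nc x nc_gt0 nc_large) delta_ge cost_le).
Qed.
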